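(* Suppose the noise $\varepsilon$ follows a normal distribution with mean $0$ and variance $\sigma^2$, and there exists a known constant $\overline\sigma$ such that $0<\sigma\le\overline\sigma<\infty$. Also assume there exists a known constant $L_0>0$ such that $\sup_{1\le j\le M_n}\|X_j\|_\infty\le L_0<\infty$. (i) For $0<q\le1$, under Assumption SRC with $\gamma=m_*$, $$\inf_{\hat f}\sup_{f_0\in\mathcal{F}_q^L(t;M_n)}E\|\hat f-f_0\|^2\asymp1\wedge\begin{cases}1&\text{if }m_*=n,\\ \frac{M_n}{n}&\text{if }m_*=M_n<n,\\ \Bigl(\frac{1+\log\frac{M_n}{(nt^2\tau)^{q/2}}}{n}\Bigr)^{1-q/2}&\text{if }1\le m_*<M_n\wedge n.\end{cases}$$ (ii) If there exists a constant $K_0>0$ such that $\frac{k_n^2(1+\log\frac{M_n}{k_n})}{n}\le K_0$, then under Assumption SRC with $\gamma=k_n$, $$\inf_{\hat f}\sup_{f_0\in\mathcal{F}_0^L(k_n;M_n)\cap\{f_\theta:\|\theta\|_\infty\le L_0\}}E\|\hat f-f_0\|^2\asymp1\wedge\frac{k_n(1+\log\frac{M_n}{k_n})}{n}.$$ (iii) If $\sigma>0$ is actually known, then under the condition $\frac{k_n^2(1+\log\frac{M_n}{k_n})}{n}\le K_0$ and Assumption SRC with $\gamma=k_n$, we have $$\inf_{\hat f}\sup_{f_0\in\mathcal{F}_0^L(k_n;M_n)}E\|\hat f-f_0\|^2\asymp1\wedge\frac{k_n(1+\log\frac{M_n}{k_n})}{n},$$ and for any $0<q\le1$, under Assumption SRC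 with $\gamma=k_n\wedge m_*$, we have $$\inf_{\hat f}\sup_{f_0\in\mathcal{F}_0^L(k_n;M_n)\cap\mathcal{F}_q^L(t;M_n)}E\|\hat f-f_0\|^2\asymp1\wedge\begin{cases}\frac{k_n(1+\log\frac{M_n}{k_n})}{n}&\text{if }m_*>k_n,\\ \Bigl(\frac{1+\log\frac{M_n}{(nt^2\tau)^{q/2}}}{n}\Bigr)^{1-q/2}&\text{if }1\le m_*\le k_n.\end{cases}$$
   Context: $n\ge2$, $M_n\ge2$. Data $(\mathbf{X}_i,Y_i)_{i=1}^n$ are i.i.d. copies of $(\mathbf{X},Y)$ with $\mathbf{X}=(X_1,\ldots,X_{M_n})\sim P_X$, $Y=f_0(\mathbf{X})+\varepsilon$, $\varepsilon$ independent of $\mathbf{X}$. $\|\cdot\|$ on functions is the $L_2(P_X)$ norm; $\hat f$ ranges over all estimators. $f_\theta(\mathbf{x})=\sum_{j=1}^{M_n}\theta_jx_j$; $\|\theta\|_0$ is the number of nonzero components, $\|\theta\|_q=(\sum_j|\theta_j|^q)^{1/q}$, $\|\theta\|_\infty=\max_j|\theta_j|$. $\mathcal{F}_q^L(t;M_n)=\{f_\theta:\|\theta\|_q\le t,\ \|f_\theta\|_\infty\le L\}$, where $t>0$ is the radius $t_n=t$, held fixed; $\mathcal{F}_0^L(k_n;M_n)=\{f_\theta:\|\theta\|_0\le k_n,\ \|f_\theta\|_\infty\le L\}$, $1\le k_n\le M_n$ an integer; $L>0$ is a known constant. In (iii), $K_0>0$ is a constant as in (ii). Assumption SRC: for some $\gamma>0$,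 there exist two positive constants $\underline a$ and $\overline a$ that do not depend on $n$ such that for every $\theta$ with $\|\theta\|_0\le\min(2\gamma,M_n)$, $\underline a\|\theta\|_2\le\|f_\theta\|\le\overline a\|\theta\|_2$. $\tau=\sigma^{-2}$; $m^*=\lceil(nt^2\tau)^{q/2}\rceil\wedge M_n\wedge n$; $m_*=m^*$ if $m^*=M_n\wedge n$, otherwise $m_*=\lceil m^*/(1+\log(M_n/m^* ))^{q/2}\rceil$. $\asymp$ means of the same order when $L$, $L_0$, $q$, $t_n=t$, and $\overline\sigma^2$ are held constant in the relevant expressions.
   Formalization: In the second claim of (iii), the case m_* ≤ k_n also assumes (nt²τ)^{q/2} ≤ M_n, since otherwise 1+log(M_n/(nt²τ)^{q/2}) can be negative; the constants in ≍ may depend on a positive lower bound for σ, since the lower bounds fail uniformly as σ→0. *)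

(* Defs.v *)
From HB Require Import structures.
From mathcomp Require Import all_boot all_order all_algebra.
From mathcomp Require Import all_classical all_reals all_analysis.

Set Implicit Arguments.
Unset Strict Implicit.
Unset Printing Implicit Defensive.

Import Order.TTheory GRing.Theory Num.Theory.
Import numFieldNormedType.Exports.

Local Open Scope classical_set_scope.
Local Open Scope ring_scope.

Section Coefficients.
Context {R : realType} {M : nat}.
Implicit Types (theta : 'rV[R]_M) (x : M.-tuple R).

Definition flin theta : M.-tuple R -> R :=
  fun x => \sum_(j < M) theta ord0 j * tnth x j.

Definition l0norm theta : nat := #|[set j | theta ord0 j != 0]%SET|.

Definition lqnorm (q : R) theta : R :=
  (\sum_(j < M) `|theta ord0 j| `^ q) `^ q^-1.

Definition linfnorm theta : R := \big[Num.max/0]_(j < M) `|theta ord0 j|.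

End Coefficients.

Section Classes.
Context {R : realType} {M : nat} (PX : probability (M.-tuple R) R).

(* Sup norms of functions of the design are essential suprema under PX: a
   nonzero linear function is unbounded on the whole of R^M. *)
Definition fnorm2 (f : M.-tuple R -> R) : \bar R := 'N[PX]_2%:E [EFin \o f].
Definition fnormoo (f : M.-tuple R -> R) : \bar R := 'N[PX]_+oo [EFin \o f].

Definition Fq (q t L : R) : set (M.-tuple R -> R) :=
  @flin R M @`
    [set theta | lqnorm q theta <= t /\ (fnormoo (flin theta) <= L%:E)%E].

Definition F0 (k : nat) (L : R) : set (M.-tuple R -> R) :=
  @flin R M @`
    [set theta | (l0norm theta <= k)%N /\ (fnormoo (flin theta) <= L%:E)%E].

Definition Finf (r : R) : set (M.-tuple R -> R) :=
  @flin R M @` [set theta | linfnorm theta <= r].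

Definition bounded_features (L0 : R) : Prop :=
  forall j : 'I_M, (fnormoo (fun x => tnth x j) <= L0%:E)%E.

Definition SRC (alo ahi : R) (gamma : nat) : Prop :=
  forall theta : 'rV[R]_M, (l0norm theta <= minn (2 * gamma) M)%N ->
    ((alo * lqnorm 2 theta)%:E <= fnorm2 (flin theta) <=
     (ahi * lqnorm 2 theta)%:E)%E.

End Classes.

Definition mutually_independent d d' (T : measurableType d)
    (T' : measurableType d') (R : realType) (P : probability T R) (n : nat)
    (Z : 'I_n -> T -> T') : Prop :=
  forall (I : {set 'I_n}) (A : 'I_n -> set T'),
    (forall i, measurable (A i)) ->
    P (\bigcap_(i in [set` I]) (Z i @^-1` A i)) =
    (\prod_(i in I) P (Z i @^-1` A i))%E.

Definition independent2 d d1 d2 (T : measurableType d)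
    (T1 : measurableType d1) (T2 : measurableType d2) (R : realType)
    (P : probability T R) (Z1 : T -> T1) (Z2 : T -> T2) : Prop :=
  forall (A : set T1) (B : set T2), measurable A -> measurable B ->
    P ((Z1 @^-1` A) `&` (Z2 @^-1` B)) =
    (P (Z1 @^-1` A) * P (Z2 @^-1` B))%E.

(* n i.i.d. copies of a pair (X, eps) with X ~ PX, eps ~ N(0, sigma^2), and
   X, eps independent, on some probability space. The second parameter of
   normal_prob is the standard deviation. *)
Record sample (R : realType) (n M : nat) (PX : probability (M.-tuple R) R)
    (sigma : R) := Sample {
  sdisp : measure_display ;
  sspace : measurableType sdisp ;
  sprob : probability sspace R ;
  design : 'I_n -> {RV sprob >-> M.-tuple R} ;
  noise : 'I_n -> {RV sprob >-> R} ;
  pairs_independent : mutually_independent sprob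
    (fun i w => (design i w, noise i w)) ;
  design_law : forall i A, measurable A ->
    distribution sprob (design i) A = PX A ;
  noise_law : forall i B, measurable B ->
    distribution sprob (noise i) B = normal_prob 0 sigma B ;
  noise_independent : forall i, independent2 sprob (design i) (noise i) }.

Section Risk.
Context {R : realType} {n M : nat}.

(* Joint measurability in the data and the evaluation point makes the loss a
   measurable function of the data. *)
Definition estimator : Type :=
  {mfun (n.-tuple (M.-tuple R * R) * M.-tuple R)%type >-> R}.

Context {PX : probability (M.-tuple R) R} {sigma : R} (S : sample n PX sigma).

Definition data (f0 : M.-tuple R -> R) (w : sspace S) :
    n.-tuple (M.-tuple R * R) :=
  [tuple (design S i w, f0 (design S i w) + noise S i w) | i < n].

Definition risk (fhat : estimator) (f0 : M.-tuple R -> R) : \bar R :=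
  (\int[sprob S]_w (fnorm2 PX (fun x => fhat (data f0 w, x) - f0 x)%R) ^+ 2)%E.

Definition max_risk (F : set (M.-tuple R -> R)) (fhat : estimator) : \bar R :=
  ereal_sup (risk fhat @` F).

Definition minimax_risk (F : set (M.-tuple R -> R)) : \bar R :=
  ereal_inf (range (max_risk F)).

End Risk.

Arguments estimator : clear implicits.

Section Rates.
Context {R : realType} (n M : nat).
Implicit Types q t sigma : R.

Definition snr q t sigma : R := (n%:R * t ^+ 2 * sigma ^- 2) `^ (q / 2).

(* m^* and, below, m_*; the absolute value only casts a nonnegative int. *)
Definition m_up q t sigma : nat :=
  minn (minn `|Num.ceil (snr q t sigma)|%N M) n.

Definition m_low q t sigma : nat :=
  let m := m_up q t sigma in
  if m == minn M n then m
  else `|Num.ceil (m%:R / (1 + ln (M%:R / m%:R)) `^ (q / 2))|%N.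

(* Meaningful only for snr q t sigma <= M: powR totalizes the power of a
   negative base to 1. *)
Definition lq_rate q t sigma : R :=
  ((1 + ln (M%:R / snr q t sigma)) / n%:R) `^ (1 - q / 2).

Definition l0_rate (k : nat) : R := k%:R * (1 + ln (M%:R / k%:R)) / n%:R.

Definition rate_q q t sigma : R :=
  let m := m_low q t sigma in
  Num.min 1 (if m == n then 1
             else if (m == M) && (M < n)%N then M%:R / n%:R
             else lq_rate q t sigma).

Definition rate_0 (k : nat) : R := Num.min 1 (l0_rate k).

Definition rate_0q (k : nat) q t sigma : R :=
  Num.min 1 (if (k < m_low q t sigma)%N then l0_rate k
             else lq_rate q t sigma).

Definition sparsity_bound (k : nat) (K0 : R) : Prop :=
  k%:R ^+ 2 * (1 + ln (M%:R / k%:R)) / n%:R <= K0.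

End Rates.

Definition within_factors (R : realType) (c C : R) (v : \bar R) (r : R) : Prop :=
  ((c * r)%:E <= v <= (C * r)%:E)%E.

(* Main.v *)
Require Import Defs.
From HB Require Import structures.
From mathcomp Require Import all_boot all_order all_algebra.
From mathcomp Require Import all_classical all_reals all_analysis.
From mathcomp Require Import measurable_realfun ess_sup_inf ring lra zify.
Import Order.TTheory GRing.Theory Num.Theory.
Import numFieldNormedType.Exports.
Local Open Scope classical_set_scope.
Local Open Scope ring_scope.

Set Implicit Arguments.
Unset Strict Implicit.
Unset Printing Implicit Defensive.

Import HBNNSimple.

(** Both bounds rest on explicit finite families of linear functions.

    Upper bounds.  Let fhat minimize the residual sum of squares over a finite
    family of functions g bounded by B.  For a small multiple lam of
    1 / (sbar^2 + B^2), the exponential moment of the loss contrast between g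
    and a reference function f* shows that g is selected with probability at
    most exp (- n lam (|g - f0|^2 / 2 - 2 |f* - f0|^2)).  By Jensen's
    inequality the risk is then at most a constant times
    |f* - f0|^2 + (1 / n) ln (sum_g exp (- c n |g - f0|^2)) (ls_risk_le).
    Two families are used.

    - For k-sparse vectors, the coordinates are cut into cells of width
      n^(-1/2), with one representative for every cell that is hit.  The
      restricted eigenvalue condition compares |g - f0| with the distance of
      the coefficients, so that the sum above is at most
      exp (C k (1 + ln (M / k))): far cells have small weights, and no bound
      on the number of cells is needed (sparse_upper).
    - For an lq-ball, the vectors delta z with z integral are used, where
      sum_j |z_j|^q is at most a multiple of (t / delta)^q.  Rounding the
      coefficients at random to neighbouring multiples of delta, without bias,
      approximates f0 up to delta^2 (t / delta)^q in mean square, by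
      orthogonality of the rounding errors, whatever the design; and the
      number of such z is controlled by exponential weights.  Balancing the
      two errors gives delta^2 = (1 + ln (1 + M / n^(q/2))) / n (lq_upper).

    Lower bounds.  A feature is picked in each of k blocks of features and
    given the coefficient a.  All M/k to the power k such signals are used:
    only a small fraction of them is within a multiple of k a^2 of a given
    one.  If n a^2 is at most a small multiple of 1 + ln (M / k), the
    chi-square distance between the law of the data under each signal and the
    law under the zero signal is below a small multiple of the inverse of that
    fraction, and no estimator can identify the signals; the risk is therefore
    at least of order k a^2 (fano_risk, minimax_lower).  In an lq-ball, a is
    also limited by t k^(-1/q), and the bound becomes the minimum of
    k (1 + ln (M / k)) / n and k^(1 - 2/q) (lq_lower).

    Comparison.  With k = m_*, both terms of this minimum are at least of the
    order of the claimed rate: m_* is chosen so that m_*^(2/q) times the logarithmic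
    level is of order n (rate_le_l0, rate_le_pow).  The least-squares net of
    the lq-ball attains that rate except when M is much smaller than n^(q/2);
    there the net of all coefficient vectors attains M / n, and sbar is enough
    to detect this case (lq_estimator). *)

(** * Independence and the law of a sample *)

(** An identity between measures of sets extends to nonnegative functions by
    monotone convergence from simple functions. *)
Lemma ge0_integral_transfer d d' (T : measurableType d)
    (T' : measurableType d') (R : realType) (P : {measure set T -> \bar R})
    (mu : {measure set T' -> \bar R}) (g : T -> R) (Z : T -> T') (c : R)
    (phi : T' -> R) :
  measurable_fun setT g -> (forall w, 0 <= g w) -> measurable_fun setT Z ->
  0 <= c ->
  (forall A, measurable A ->
    (\int[P]_w (g w * \1_A (Z w))%:E = c%:E * mu A)%E) ->
  measurable_fun setT phi -> (forall x, 0 <= phi x) ->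
  (\int[P]_w (g w * phi (Z w))%:E = c%:E * \int[mu]_x (phi x)%:E)%E.
Proof.
move=> mg g0 mZ c0 gA mphi phi0.
have mphiE : measurable_fun [set: T'] (fun x => (phi x)%:E) by exact/measurable_EFinP.
pose f_ := nnsfun_approx measurableT mphiE.
have f_cvg x : ((f_ n x)%:E @[n --> \oo] --> (phi x)%:E)%E.
  by apply: (@cvg_nnsfun_approx _ _ _ _ measurableT _ mphiE) => // y _; rewrite lee_fin.
have f_nd x m n : (m <= n)%N -> f_ m x <= f_ n x.
  by move=> mn; exact/lefP/nd_nnsfun_approx.
have mgf (h : T' -> R) : measurable_fun setT h ->
    measurable_fun setT (fun w => (g w * h (Z w))%:E).
  move=> mh; apply/measurable_EFinP/measurable_funM => //.
  exact: measurableT_comp.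
have step n : (\int[P]_w (g w * f_ n (Z w))%:E =
               c%:E * \int[mu]_x (f_ n x)%:E)%E.
  have fin := fimfunP (f_ n).
  have E (x : T') : f_ n x = \sum_(r \in range (f_ n)) r * \1_(f_ n @^-1` [set r]) x.
    exact: fimfunE.
  have mI r : measurable (f_ n @^-1` [set r]) by [].
  have m1 r : measurable_fun setT (\1_(f_ n @^-1` [set r]) : T' -> R).
    exact: measurable_indic.
  transitivity (\sum_(r \in range (f_ n))
      (r%:E * (c%:E * mu (f_ n @^-1` [set r]))))%E.
    under eq_integral => w _.
      rewrite E fsbig_finite//= mulr_sumr -sumEFin.
      over.
    rewrite ge0_integral_sum//=.
    - rewrite [RHS]fsbig_finite//=; apply: eq_big_seq => r.
      rewrite in_fset_set// inE => -[x _ <-].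
      under eq_integral do rewrite mulrCA EFinM.
      rewrite ge0_integralZl_EFin ?gA//.
      + by move=> w _; rewrite lee_fin mulr_ge0.
      + exact: mgf.
    - move=> r; under eq_fun do rewrite mulrCA.
      apply/measurable_EFinP/measurable_funM => //.
      by apply: measurable_funM => //; exact: measurableT_comp.
    - move=> r w _; rewrite lee_fin mulr_ge0//.
      have := nnfun_muleindic_ge0 (f_ n) r (Z w); by rewrite lee_fin.
  transitivity (c%:E * sintegral mu (f_ n))%E; last by rewrite integralT_nnsfun.
  rewrite sintegralE ge0_mule_fsumr; last by move=> r; exact: nnsfun_mulemu_ge0.
  by apply: eq_fsbigr => r _; rewrite muleCA.
have cvgL : (\int[P]_w (g w * f_ n (Z w))%:E @[n --> \oo] -->
             \int[P]_w (g w * phi (Z w))%:E)%E.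
  have -> : (\int[P]_w (g w * phi (Z w))%:E =
      \int[P]_w limn (fun n => (g w * f_ n (Z w))%:E))%E.
    apply: eq_integral => w _; apply/esym/cvg_lim => //.
    under eq_fun do rewrite EFinM.
    by rewrite EFinM; apply: cvgeZl.
  apply: cvg_monotone_convergence => //.
  - by move=> n; apply: mgf; exact: measurable_funP.
  - by move=> n w _; rewrite lee_fin mulr_ge0.
  - by move=> w _ m n mn; rewrite lee_fin ler_wpM2l// f_nd.
have cvgR : ((c%:E * \int[mu]_x (f_ n x)%:E) @[n --> \oo] -->
             c%:E * \int[mu]_x (phi x)%:E)%E.
  apply: cvgeZl => //.
  have -> : (\int[mu]_x (phi x)%:E = \int[mu]_x limn (fun n => (f_ n x)%:E))%E.
    by apply: eq_integral => w _; apply/esym/cvg_lim.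
  apply: cvg_monotone_convergence => //.
  - by move=> n; exact/measurable_EFinP/measurable_funP.
  - by move=> n w _; rewrite lee_fin.
  - by move=> w _ m n mn; rewrite lee_fin f_nd.
by move: cvgL; rewrite (funext step) => cvgL; exact: cvg_unique cvgL cvgR.
Qed.

(** Independence is a statement on indicators; the factors are replaced one by
    one by general functions, integrating the others against the law of the
    replaced variable. *)
Lemma integral_prod_indep d d' (T : measurableType d) (T' : measurableType d')
    (R : realType) (P : probability T R) (n : nat)
    (Z : 'I_n -> {RV P >-> T'}) (phi : 'I_n -> T' -> R) (e : 'I_n -> R) :
  mutually_independent P (fun i w => Z i w) ->
  (forall i, measurable_fun setT (phi i)) -> (forall i x, 0 <= phi i x) ->
  (forall i, (\int[P]_w (phi i (Z i w))%:E = (e i)%:E)%E) ->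
  (\int[P]_w (\prod_(i < n) phi i (Z i w))%:E = (\prod_(i < n) e i)%:E)%E.
Proof.
move=> ind.
have mZ (i : 'I_n) : measurable_fun setT (Z i) by exact: measurable_funP.
have mZA i A : measurable A -> measurable (Z i @^-1` A).
  by move=> mA; rewrite -[X in measurable X]setTI; exact: mZ.
suff main (s : seq 'I_n) : forall (phi : 'I_n -> T' -> R) (e : 'I_n -> R),
    (forall i, i \notin s ->
       exists2 A, measurable A & phi i = \1_A) ->
    (forall i, measurable_fun setT (phi i)) -> (forall i x, 0 <= phi i x) ->
    (forall i, (\int[P]_w (phi i (Z i w))%:E = (e i)%:E)%E) ->
    (\int[P]_w (\prod_(i < n) phi i (Z i w))%:E = (\prod_(i < n) e i)%:E)%E.
  move=> mphi phi0 phie; apply: (main (enum 'I_n)) => // i.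
  by rewrite mem_enum.
elim: s => [|j s IH] {}phi {}e phiI mphi phi0 phie.
  have /choice[A AP] : forall i, exists A, measurable A /\ phi i = \1_A.
    by move=> i; have [//|A mA AE] := phiI i; exists A.
  have := ind [set: 'I_n]%SET A (fun i => (AP i).1).
  under [in RHS]eq_bigl do rewrite inE.
  have -> : (\prod_(i < n) P (Z i @^-1` A i) = (\prod_(i < n) e i)%:E)%E.
    rewrite -prodEFin; apply: eq_bigr => i _; rewrite -phie (AP i).2.
    under eq_integral do rewrite -[\1_(A i) (Z i _)]/(\1_(Z i @^-1` A i) _).
    rewrite integral_indic ?setIT//; apply: mZA.
    exact: (AP i).1.
  move=> <-.
  transitivity (\int[P]_w (\1_(\bigcap_(i in [set` [set: 'I_n]%SET]) (Z i @^-1` A i)) w)%:E)%E.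
    apply: eq_integral => w _; congr (_%:E); rewrite indicE.
    have [/set_mem win|/negP wn] := boolP (w \in _).
      rewrite big1// => i _; rewrite (AP i).2 indicE mem_set//.
      by apply: win; rewrite /= inE.
    have [i Ni] : exists i, ~ A i (Z i w).
      by apply/existsNP => H; apply: wn; apply/mem_set => i _; exact: H.
    by rewrite (bigD1 i)//= (AP i).2 indicE memNset// mul0r.
  rewrite integral_indic ?setIT//; apply: fin_bigcap_measurable => [|i _]; first exact: finite_finset.
  by apply: mZA; exact: (AP i).1.
pose g w := \prod_(i < n | i != j) phi i (Z i w).
have mg : measurable_fun setT g.
  rewrite /g; under eq_fun do rewrite -big_filter.
  by apply: measurable_prod => i _; exact: measurableT_comp.
have g0 w : 0 <= g w by exact: prodr_ge0.
have e0 i : 0 <= e i.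
  by rewrite -lee_fin -phie; apply: integral_ge0 => w _; rewrite lee_fin.
under eq_integral do rewrite (bigD1 j)//= mulrC -[X in (X * _)%:E]/(g _).
rewrite (bigD1 j)//= mulrC EFinM -phie.
rewrite (@ge0_integral_transfer _ _ _ _ _ P (distribution P (Z j)) g (Z j)
  (\prod_(i < n | i != j) e i))//; last 2 first.
- exact: prodr_ge0.
- move=> A mA; pose phi' i := if i == j then \1_A else phi i.
  pose e' i := if i == j then fine (P (Z j @^-1` A)) else e i.
  have phi'E w : \prod_(i < n) phi' i (Z i w) = g w * \1_A (Z j w).
    rewrite (bigD1 j)//= mulrC /phi' eqxx; congr (_ * _).
    by apply: eq_bigr => i /negbTE ->.
  under eq_integral do rewrite -phi'E.
  rewrite (IH phi' e').
  + rewrite (bigD1 j)//= mulrC /e' eqxx EFinM fineK; last by apply: fin_num_measure; exact: mZA.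
    by congr (_ * _)%E; congr (_%:E); apply: eq_bigr => i /negbTE ->.
  + move=> i; rewrite /phi'; case: eqP => [_ _|/eqP ij is_]; first by exists A.
    by apply: phiI; rewrite inE negb_or ij.
  + by move=> i; rewrite /phi'; case: eqP.
  + by move=> i x; rewrite /phi'; case: eqP => // _; rewrite indicE.
  + move=> i; rewrite /phi' /e'; case: eqP => [->|_]; last exact: phie.
    under eq_integral do rewrite -[\1_A (Z j _)]/(\1_(Z j @^-1` A) _).
    rewrite integral_indic ?setIT; [|by []|exact: mZA].
    by rewrite fineK//; apply: fin_num_measure; exact: mZA.
congr (_ * _)%E; rewrite ge0_integral_distribution//.
- exact/measurable_EFinP.
- by move=> x; rewrite lee_fin.
Qed.

Section GaussLaw.
Context {R : realType}.

Let idR : measurableTypeR R -> R := idfun.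

Let measurable_idR : measurable_fun setT idR.
Proof. by move=> _ A mA; rewrite setTI. Qed.

Let idRV : {mfun measurableTypeR R >-> R} :=
  HB.pack idR (isMeasurableFun.Build _ _ _ _ _ measurable_idR).

(** The law normal_prob, transported to the Borel structure that R carries as
    a codomain of random variables. *)
Definition gauss_law (s : R) : probability R R :=
  distribution (normal_prob 0 s) idRV.

Lemma integral_gauss_law (s : R) (phi : R -> R) :
  measurable_fun setT phi -> (forall y, 0 <= phi y) ->
  (\int[gauss_law s]_y (phi y)%:E =
   \int[lebesgue_measure]_y (normal_pdf 0 s y * phi y)%:E)%E.
Proof.
move=> mphi phi0.
have mE : measurable_fun [set: R] (fun y => (phi y)%:E).
  exact/measurable_EFinP.
have pE y : (0 <= (phi y)%:E)%E by rewrite lee_fin.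
rewrite (ge0_integral_distribution _ mE pE).
have mpdf := measurable_normal_pdf (0 : R) s.
have := @ge0_integral_transfer _ _ _ _ _ (@lebesgue_measure R)
  (normal_prob 0 s) (normal_pdf 0 s) id 1 phi mpdf (normal_pdf_ge0 _ _)
  (@measurable_id _ _ _) ler01.
move=> -> //; first by rewrite mul1e.
move=> A mA; rewrite mul1e /normal_prob [RHS]integral_mkcond.
apply: eq_integral => y _; rewrite patchE indicE.
by case: ifP => yA; rewrite ?mulr1 ?mulr0.
Qed.

End GaussLaw.

Lemma lebesgue_measure_translate (R : realType) (m : R) (phi : R -> R) :
  measurable_fun setT phi -> (forall y, 0 <= phi y) ->
  (\int[lebesgue_measure]_y (phi (m + y))%:E =
   \int[lebesgue_measure]_y (phi y)%:E)%E.
Proof.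
move=> mphi phi0.
pose f (y : R) : R := m + y.
have mD : @measurable_fun _ _ (measurableTypeR R) (measurableTypeR R) setT f.
  exact: measurable_funD.
transitivity (\int[pushforward lebesgue_measure
    (f : measurableTypeR R -> measurableTypeR R)]_y (phi y)%:E)%E.
  rewrite ge0_integral_pushforward//; first exact/measurable_EFinP.
  by move=> y _; rewrite lee_fin.
pose D : {mfun measurableTypeR R >-> measurableTypeR R} :=
  HB.pack (f : measurableTypeR R -> measurableTypeR R)
    (isMeasurableFun.Build _ _ _ _ _ mD).
apply: eq_measure_integral => A mA _; apply/esym.
apply: (@lebesgue_measure_unique R (pushforward lebesgue_measure D)) => //.
move=> _ [[a b]] _ <- /=; rewrite /pushforward.
rewrite (_ : _ @^-1` _ = `]a - m, b - m]%classic); last first.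
  by apply/seteqP; split=> y /=; rewrite !in_itv/= ltrBlDl lerBrDl.
rewrite !lebesgue_measure_itv/= !lte_fin ltrD2r.
by case: ifP => // _; rewrite -!EFinD; congr (_%:E); ring.
Qed.

Lemma normal_pdf_shift (R : realType) (s m y : R) : s != 0 ->
  normal_pdf 0 s (y - m) =
  normal_pdf 0 s y * expR ((y * m - m ^+ 2 / 2) / s ^+ 2).
Proof.
move=> s0; rewrite !normal_pdfE// -mulrA; congr (_ * _).
by rewrite /normal_fun -expRD; congr expR; field.
Qed.

(** The exponential factor is the likelihood ratio of the laws with means m
    and 0. *)
Lemma integral_gauss_shift (R : realType) (s m : R) (phi : R -> R) :
  s != 0 -> measurable_fun setT phi -> (forall y, 0 <= phi y) ->
  (\int[gauss_law s]_y (phi (m + y))%:E =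
   \int[gauss_law s]_y
     (phi y * expR ((y * m - m ^+ 2 / 2) / s ^+ 2))%:E)%E.
Proof.
move=> s0 mphi phi0; have mpdf := measurable_normal_pdf (0 : R) s.
rewrite !integral_gauss_law//.
- transitivity (\int[@lebesgue_measure R]_y (normal_pdf 0 s (y - m) * phi y)%:E)%E;
    last by apply: eq_integral => y _; rewrite normal_pdf_shift//; congr (_%:E); ring.
  rewrite -(@lebesgue_measure_translate _ m
    (fun y => normal_pdf 0 s (y - m) * phi y)).
  + by apply: eq_integral => y _; rewrite [m + y - m]addrC addrA addNr add0r.
  + apply: measurable_funM => //.
    apply: (measurableT_comp mpdf); exact: measurable_funB.
  + by move=> y; rewrite mulr_ge0// normal_pdf_ge0.
- apply: measurable_funM => //; apply: measurableT_comp => //.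
  apply: measurable_funM => //; apply: measurable_funB => //.
  exact: measurable_funM.
- by move=> y; rewrite mulr_ge0// expR_ge0.
- by apply: (measurableT_comp mphi); exact: measurable_funD.
Qed.

Lemma gauss_mgf (R : realType) (s a : R) : s != 0 ->
  (\int[gauss_law s]_y (expR (a * y))%:E =
   (expR (a ^+ 2 * s ^+ 2 / 2))%:E)%E.
Proof.
move=> s0; have := @integral_gauss_shift R s (a * s ^+ 2) (cst 1) s0
  (measurable_cst _) (fun=> ler01).
rewrite -[X in X = _ -> _]/(\int[gauss_law s]_y (cst 1%:E y))%E.
rewrite integral_cst// [X in (_ * X)%E]probability_setT mule1 => E.
rewrite -[RHS]mule1 E -ge0_integralZl_EFin ?expR_ge0//.
- apply: eq_integral => y _; rewrite -EFinM mul1r -expRD; congr (expR _)%:E.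
  by field.
- by move=> y _; rewrite lee_fin mulr_ge0// expR_ge0.
- apply/measurable_EFinP; apply: measurable_funM => //.
  apply: measurableT_comp => //.
  apply: measurable_funM => //; apply: measurable_funB => //.
  exact: measurable_funM.
Qed.

Section SampleLaws.
Context {R : realType} {n M : nat} {PX : probability (M.-tuple R) R}
  {sigma : R} (S : sample n PX sigma).
Let XR := (M.-tuple R * R)%type.

Let mpair (i : 'I_n) :
  measurable_fun setT (fun w => (design S i w, noise S i w) : XR).
Proof. by apply: measurable_fun_pair; exact: measurable_funP. Qed.

Let pairRV (i : 'I_n) : {RV sprob S >-> XR} :=
  HB.pack (fun w => (design S i w, noise S i w) : XR)
    (isMeasurableFun.Build _ _ _ _ _ (mpair i)).

Lemma integral_pair_law (i : 'I_n) (phi : XR -> R) :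
  measurable_fun setT phi -> (forall z, 0 <= phi z) ->
  (\int[sprob S]_w (phi (design S i w, noise S i w))%:E =
   \int[PX]_x \int[gauss_law sigma]_y (phi (x, y))%:E)%E.
Proof.
move=> mphi phi0.
have mphiE : measurable_fun [set: XR] (fun z => (phi z)%:E).
  exact/measurable_EFinP.
have phiE0 z : (0 <= (phi z)%:E)%E by rewrite lee_fin.
rewrite -(@fubini_tonelli1 _ _ _ _ _ PX (gauss_law sigma) _ mphiE phiE0).
transitivity (\int[distribution (sprob S) (pairRV i)]_z (phi z)%:E)%E.
  by rewrite ge0_integral_distribution.
apply: (@eq_measure_integral _ _ R setT (PX \x gauss_law sigma)%E (distribution (sprob S) (pairRV i)) (fun z => (phi z)%:E)) => A mA _; apply/esym.
apply: product_measure_unique => // A1 A2 mA1 mA2.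
apply: (eq_trans (noise_independent S i mA1 mA2)).
by congr (_ * _)%E; [exact: design_law|exact: noise_law].
Qed.

Lemma measurable_data (f : M.-tuple R -> R) : measurable_fun setT f ->
  measurable_fun setT (data (S := S) f).
Proof.
move=> mf; apply/measurable_fun_tnthP => i.
rewrite (_ : _ \o _ = fun w => (design S i w, f (design S i w) + noise S i w)).
  apply: measurable_fun_pair; first exact: measurable_funP.
  apply: measurable_funD; last exact: measurable_funP.
  by apply: (measurableT_comp mf); exact: measurable_funP.
by apply/funext => w /=; rewrite tnth_mktuple.
Qed.

Lemma integral_prod_data (f : M.-tuple R -> R) (phi : 'I_n -> XR -> R)
    (e : 'I_n -> R) : measurable_fun setT f ->
  (forall i, measurable_fun setT (phi i)) -> (forall i z, 0 <= phi i z) ->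
  (forall i, (\int[PX]_x \int[gauss_law sigma]_y (phi i (x, f x + y)%R)%:E
              = (e i)%:E)%E) ->
  (\int[sprob S]_w (\prod_(i < n) phi i (tnth (data (S := S) f w) i))%:E =
   (\prod_(i < n) e i)%:E)%E.
Proof.
move=> mf mphi phi0 phie.
have ind : mutually_independent (sprob S) (fun i w => pairRV i w).
  exact: pairs_independent.
have mshift : measurable_fun setT (fun z : XR => (z.1, f z.1 + z.2)).
  apply: measurable_fun_pair => //; apply: measurable_funD => //.
  exact: (measurableT_comp mf).
have mphi' i : measurable_fun setT (fun z : XR => phi i (z.1, f z.1 + z.2)).
  exact: (measurableT_comp (mphi i)).
rewrite -(@integral_prod_indep _ _ _ _ _ _ _ _
  (fun i z => phi i (z.1, f z.1 + z.2)) e ind)//.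
  apply: eq_integral => w _; congr (_%:E); apply: eq_bigr => i _.
  by rewrite tnth_mktuple.
by move=> i; rewrite -phie (@integral_pair_law i (fun z => phi i (z.1, f z.1 + z.2))).
Qed.

End SampleLaws.

Definition lik_ratio {R : realType} {M : nat} (sigma : R) (f : M.-tuple R -> R)
    (z : M.-tuple R * R) : R :=
  expR ((z.2 * f z.1 - f z.1 ^+ 2 / 2) / sigma ^+ 2).

Lemma measurable_lik_ratio (R : realType) (M : nat) (sigma : R)
  (f : M.-tuple R -> R) : measurable_fun setT f ->
  measurable_fun setT (lik_ratio sigma f).
Proof.
move=> mf; have mf1 : measurable_fun setT (fun z : M.-tuple R * R => f z.1).
  exact: (measurableT_comp mf).
apply: measurableT_comp => //.
apply: measurable_funM => //; apply: measurable_funB.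
  exact: measurable_funM.
by apply: measurable_funM => //; exact: measurable_funX.
Qed.

(** Both sides are finite measures in A, and they agree on rectangles by
    independence and the one-observation shift of the noise. *)
Lemma change_of_measure (R : realType) (n M : nat)
    (PX : probability (M.-tuple R) R) (sigma : R) (S : sample n PX sigma)
    (f : M.-tuple R -> R) (A : set (n.-tuple (M.-tuple R * R))) :
  sigma != 0 -> measurable_fun setT f -> measurable A ->
  (sprob S (data (S := S) f @^-1` A) =
   \int[sprob S]_w (\1_A (data (S := S) (cst 0%R) w) *
     \prod_(i < n) lik_ratio sigma f (tnth (data (S := S) (cst 0%R) w) i))%:E)%E.
Proof.
move=> s0 mf mA.
have mdf := @measurable_data _ _ _ _ _ S f mf.
have md0 : measurable_fun setT (data (S := S) (cst 0%R)).
  exact: measurable_data.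
pose D := n.-tuple (M.-tuple R * R).
pose Lam (d : D) := \prod_(i < n) lik_ratio sigma f (tnth d i).
have mLam : measurable_fun setT Lam.
  apply: measurable_prod => i _.
  apply: (measurableT_comp (measurable_lik_ratio sigma mf)).
  exact: measurable_tnth.
have Lam0 d : 0 <= Lam d by apply: prodr_ge0 => i _; exact: expR_ge0.
pose LamE w := (Lam (data (S := S) (cst 0%R) w))%:E.
have mLamE : measurable_fun setT LamE.
  by apply/measurable_EFinP; exact: (measurableT_comp mLam).
have LamE0 w : (0 <= LamE w)%E by rewrite lee_fin.
pose nu A := (\int[sprob S]_(w in A) LamE w)%E.
have nu0 : nu set0 = 0%E by rewrite /nu integral_set0.
have nu_ge0 B : (0 <= nu B)%E by exact: integral_ge0.
have nu_add := @semi_sigma_additive_nng_induced _ _ _ (sprob S) _ mLamE LamE0.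
pose Q : {measure set (sspace S) -> \bar R} :=
  HB.pack nu (isMeasure.Build _ _ _ nu nu0 nu_ge0 nu_add).
pose df : {mfun sspace S >-> D} :=
  HB.pack (data (S := S) f) (isMeasurableFun.Build _ _ _ _ _ mdf).
pose d0 : {mfun sspace S >-> D} :=
  HB.pack (data (S := S) (cst 0%R)) (isMeasurableFun.Build _ _ _ _ _ md0).
have nuE B : measurable B -> pushforward Q d0 B =
    (\int[sprob S]_w (\1_B (data (S := S) (cst 0%R) w) * Lam (data (S := S) (cst 0%R) w))%:E)%E.
  move=> mB; rewrite /pushforward /= /nu integral_mkcond.
  apply: eq_integral => w _; rewrite patchE indicE.
  case: ifPn => [/set_mem h|/negP h]; first by rewrite mem_set ?mul1r.
  by rewrite memNset ?mul0r// => h'; apply: h; exact: mem_set.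
rewrite -[RHS]nuE//.
pose rect (B : 'I_n -> set (M.-tuple R * R)) : set D :=
  \bigcap_(i in [set` [set: 'I_n]%SET]) ((fun d : D => tnth d i) @^-1` B i).
pose G := [set C | exists2 B, (forall i, measurable (B i)) & C = rect B].
have mrect B : (forall i, measurable (B i)) -> measurable (rect B).
  move=> mB; apply: fin_bigcap_measurable; first exact: finite_finset.
  move=> i _; rewrite -[X in measurable X]setTI.
  exact: (measurable_tnth i).
have rectT : rect (fun=> setT) = setT by apply/seteqP; split.
have GE C : G C -> pushforward (sprob S) df C = pushforward Q d0 C.
  move=> [B mB ->]; rewrite nuE; last exact: mrect.
  have rI d : \1_(rect B) d = \prod_(i < n) \1_(B i) (tnth d i) :> R.
    rewrite indicE; have [/set_mem win|/negP wn] := boolP (d \in _).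
      rewrite big1// => i _; rewrite indicE mem_set//.
      by apply: win; rewrite /= inE.
    have [i Ni] : exists i, ~ B i (tnth d i).
      by apply/existsNP => H; apply: wn; apply/mem_set => i _; exact: H.
    by rewrite (bigD1 i)//= indicE memNset// mul0r.
  have mI i : measurable_fun setT (\1_(B i) : _ -> R) by exact: measurable_indic.
  pose e i := fine (\int[PX]_x \int[gauss_law sigma]_y (\1_(B i) (x, f x + y)%R)%:E)%E.
  have eE i : (\int[PX]_x \int[gauss_law sigma]_y
      (\1_(B i) (x, f x + y)%R)%:E = (e i)%:E)%E.
    rewrite fineK// ge0_fin_numE; last first.
      by apply: integral_ge0 => x _; apply: integral_ge0 => y _; rewrite lee_fin indicE.
    have mshift : measurable_fun setT (fun z : M.-tuple R * R => (z.1, f z.1 + z.2)).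
      apply: measurable_fun_pair => //; apply: measurable_funD => //.
      exact: (measurableT_comp mf).
    have m1 : measurable_fun [set: (M.-tuple R * R)%type]
        (fun z => (\1_(B i) (z.1, f z.1 + z.2))%:E : \bar R).
      by apply/measurable_EFinP; exact: (measurableT_comp (mI i)).
    have p1 (z : M.-tuple R * R) : (0 <= (\1_(B i) (z.1, f z.1 + z.2))%:E :> \bar R)%E.
      by rewrite lee_fin indicE.
    rewrite -(@fubini_tonelli1 _ _ _ _ _ PX (gauss_law sigma) _ m1 p1).
    apply: (@le_lt_trans _ _ 1%E); last exact: ltry.
    rewrite -(@probability_setT _ _ _ (PX \x gauss_law sigma)%E).
    rewrite -[leRHS]mul1e -integral_cst//; apply: ge0_le_integral => //.
    by move=> z _; rewrite lee_fin indicE; case: (_ \in _).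
  transitivity ((\prod_(i < n) e i)%:E : \bar R)%E.
    rewrite -(@integral_prod_data _ _ _ _ _ S f (fun i => \1_(B i)) e)//.
    transitivity (\int[sprob S]_w (\1_(data (S := S) f @^-1` rect B) w)%:E)%E.
      rewrite integral_indic ?setIT// -[X in measurable X]setTI.
      exact: (mdf measurableT _ (mrect _ mB)).
    by apply: eq_integral => w _; rewrite -[\1_(_ @^-1` _) w]/(\1_(rect B) (data (S := S) f w)) rI.
  rewrite -(@integral_prod_data _ _ _ _ _ S (cst 0%R)
      (fun i z => \1_(B i) z * lik_ratio sigma f z) e)//.
  - by apply: eq_integral => w _; rewrite rI /Lam -big_split.
  - by move=> i; apply: measurable_funM => //; exact: measurable_lik_ratio.
  - by move=> i z; rewrite mulr_ge0// ?indicE// expR_ge0.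
  - move=> i; rewrite -eE; apply: eq_integral => x _.
    rewrite (@integral_gauss_shift _ sigma (f x) (fun y => \1_(B i) (x, y)))//.
    + by apply: eq_integral => y _; rewrite /lik_ratio add0r.
    + by apply: (measurableT_comp (mI i)); exact: measurable_fun_pair.
apply: (measure_unique G (fun=> setT) _ _ _ _ (pushforward (sprob S) df)
   (pushforward Q d0)) => //.
- rewrite [LHS]/measurable/= /g_sigma_preimage; apply/seteqP; split.
  + apply: smallest_sub; first exact: smallest_sigma_algebra.
    apply: (big_ind (fun X : set (set D) => X `<=` <<s G >>)) => //.
      by move=> X Y XG YG C [/XG|/YG].
    move=> i _ _ [B mB <-]; apply: sub_sigma_algebra.
    exists (fun j => if j == i then B else setT).
      by move=> j; case: eqP.
    apply/seteqP; split=> d /=; first by move=> [_ Bd] j _ /=; case: eqP => // ->.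
    by move=> H; split => //; have := H i; rewrite /= eqxx; apply; rewrite inE.
  + apply: smallest_sub; first exact: sigma_algebra_measurable.
    by move=> _ [B mB ->]; exact: mrect.
- move=> _ _ [B1 mB1 ->] [B2 mB2 ->]; exists (fun i => B1 i `&` B2 i).
    by move=> i; exact: measurableI.
  by rewrite /rect -bigcapI.
- by move=> _; exists (fun=> setT); rewrite ?rectT.
- by apply/seteqP; split => // d _; exists 0%N.
- by move=> k; rewrite -[X in (X < _)%E]/(sprob S setT) probability_setT ltry.
Qed.

(** * Linear forms and their norms *)

Section LinearForms.
Context {R : realType} {M : nat}.
Implicit Types (theta : 'rV[R]_M) (x : M.-tuple R).

Lemma measurable_flin theta : measurable_fun setT (flin theta).
Proof.
apply: measurable_sum => j; apply: measurable_funM => //.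
exact: measurable_tnth.
Qed.

Lemma flin0 x : flin (0 : 'rV[R]_M) x = 0.
Proof. by rewrite /flin big1// => j _; rewrite mxE mul0r. Qed.

Lemma flinB theta theta' x :
  flin (theta - theta') x = flin theta x - flin theta' x.
Proof.
rewrite /flin -sumrB; apply: eq_bigr => j _.
by rewrite !mxE mulrBl.
Qed.

Lemma lqnorm2_sqr theta : lqnorm 2 theta ^+ 2 = \sum_j theta ord0 j ^+ 2.
Proof.
have s0 : 0 <= \sum_(j < M) `|theta ord0 j| `^ 2.
  by apply: sumr_ge0 => j _; exact: powR_ge0.
rewrite /lqnorm -powR_mulrn ?powR_ge0// -powRrM mulVf ?pnatr_eq0// powRr1//.
by apply: eq_bigr => j _; rewrite powR_mulrn// real_normK// num_real.
Qed.

Lemma lqnorm_ge0 q theta : 0 <= lqnorm q theta.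
Proof. exact: powR_ge0. Qed.

Lemma lqnorm_leP q t theta : 0 < q -> 0 <= t ->
  (lqnorm q theta <= t) = (\sum_j `|theta ord0 j| `^ q <= t `^ q).
Proof.
move=> q0 t0.
have s0 : 0 <= \sum_(j < M) `|theta ord0 j| `^ q.
  by apply: sumr_ge0 => j _; exact: powR_ge0.
rewrite /lqnorm; apply/idP/idP => h.
  rewrite -[leLHS]powRr1// -(mulVf (lt0r_neq0 q0)) powRrM.
  by apply: ge0_ler_powR; rewrite ?nnegrE ?powR_ge0// ltW.
rewrite -[leRHS]powRr1// -(mulfV (lt0r_neq0 q0)) powRrM.
by apply: ge0_ler_powR; rewrite ?nnegrE ?powR_ge0 ?invr_ge0// ltW.
Qed.

End LinearForms.

Section SquareNorm.
Context {R : realType} {M : nat} (PX : probability (M.-tuple R) R).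
Implicit Types (f g : M.-tuple R -> R) (theta : 'rV[R]_M).

Definition sqint f : \bar R := (\int[PX]_x (f x ^+ 2)%:E)%E.

Definition sqnorm f : R := fine (sqint f).

Lemma fnorm2_sqr f : (fnorm2 PX f ^+ 2 = sqint f)%E.
Proof.
have := @poweR_Lnorm _ _ _ PX (EFin \o f) 2 (lt0r_neq0 (ltr0n _ 2)).
rewrite -/(fnorm2 PX f) => E.
have P (y : \bar R) : (0 <= y)%E -> (y ^+ 2 = y `^ 2)%E.
  case: y => [r r0|_|//]; last by rewrite poweRyr ?pnatr_eq0// expe2 mulyy.
  by rewrite poweR_EFin powR_mulrn// EFin_expe.
rewrite P; last exact: Lnorm_ge0.
rewrite E; apply: eq_integral => x _ /=.
by rewrite powR_mulrn// real_normK// num_real.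
Qed.

Lemma sqint_ge0 f : (0 <= sqint f)%E.
Proof. by apply: integral_ge0 => x _; rewrite lee_fin sqr_ge0. Qed.

Lemma sqnorm_ge0 f : 0 <= sqnorm f.
Proof. exact: fine_ge0 (sqint_ge0 f). Qed.

Lemma measurable_sqr f : measurable_fun setT f ->
  measurable_fun [set: M.-tuple R] (fun x => (f x ^+ 2)%:E).
Proof. by move=> mf; apply/measurable_EFinP; exact: measurable_funX. Qed.

Lemma fnormoo_leP f c :
  (fnormoo PX f <= c%:E)%E <-> (\forall x \ae PX, `|f x| <= c).
Proof.
rewrite /fnormoo unlock /= probability_setT lte01; split.
  by move/ess_supP; apply: filterS => x; rewrite /= lee_fin.
move=> H; apply/ess_supP; apply: filterS H => x /=.
by rewrite lee_fin.
Qed.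

Lemma sqint_le f B : measurable_fun setT f ->
  (\forall x \ae PX, `|f x| <= B) -> (sqint f <= (B ^+ 2)%:E)%E.
Proof.
move=> mf fB; apply: (@le_trans _ _ (\int[PX]_x (B ^+ 2)%:E)%E); last first.
  by rewrite integral_cst// [X in (_ * X)%E]probability_setT mule1.
apply: ae_ge0_le_integral => //.
- by move=> x _; rewrite lee_fin sqr_ge0.
- exact: measurable_sqr.
- by move=> x _; rewrite lee_fin sqr_ge0.
- apply: filterS fB => x fxB _; rewrite lee_fin -real_normK ?num_real//.
  by rewrite lerXn2r ?nnegrE// (le_trans _ fxB).
Qed.

Lemma sqintE f B : measurable_fun setT f -> (\forall x \ae PX, `|f x| <= B) ->
  sqint f = (sqnorm f)%:E.
Proof.
move=> mf fB; rewrite /sqnorm fineK// ge0_fin_numE ?sqint_ge0//.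
exact: le_lt_trans (sqint_le mf fB) (ltry _).
Qed.

Lemma sqnorm_le f B : measurable_fun setT f ->
  (\forall x \ae PX, `|f x| <= B) -> sqnorm f <= B ^+ 2.
Proof. by move=> mf fB; rewrite -lee_fin -(sqintE mf fB) sqint_le. Qed.

Lemma ae_bounded_sub f g B B' : (\forall x \ae PX, `|f x| <= B) ->
  (\forall x \ae PX, `|g x| <= B') -> \forall x \ae PX, `|f x - g x| <= B + B'.
Proof.
apply: filterS2 => x fB gB; apply: (le_trans (ler_normB _ _)).
exact: lerD.
Qed.

Lemma ae_bounded_flin L0 theta : bounded_features PX L0 ->
  \forall x \ae PX, `|flin theta x| <= L0 * \sum_j `|theta ord0 j|.
Proof.
move=> bf.
have H : \forall x \ae PX, forall j, `|tnth x j| <= L0.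
  by apply: filter_forall => j; apply/fnormoo_leP; exact: bf.
apply: filterS H => x Hx; rewrite /flin (le_trans (ler_norm_sum _ _ _))//.
rewrite mulr_sumr; apply: ler_sum => j _.
by rewrite normrM mulrC ler_wpM2r.
Qed.

End SquareNorm.

(** * Least squares over a finite family *)

Section ScalarBounds.
Context {R : realType}.

Lemma expR_le_quad (z : R) : z <= 4^-1 -> expR z <= 1 + z + z ^+ 2.
Proof.
move=> z4; set w := 1 - z / 2.
have w0 : 0 < w by rewrite /w; lra.
have h : expR (z / 2) <= w^-1.
  rewrite -[leLHS]invrK lef_pV2 ?posrE ?invr_gt0 ?expR_gt0// -expRN.
  exact: expR_ge1Dx.
have -> : z = z / 2 + z / 2 by field.
rewrite expRD; apply: (@le_trans _ _ (w^-1 * w^-1)).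
  by apply: ler_pM; rewrite ?expR_ge0.
rewrite -invfM -[leLHS]mul1r ler_pdivrMr ?mulr_gt0//.
rewrite -(_ : z = z / 2 + z / 2); last by field.
rewrite /w -subr_ge0.
have -> : (1 + z + z ^+ 2) * ((1 - z / 2) * (1 - z / 2)) - 1 =
  z ^+ 2 / 4 * (1 - 3 * z + z ^+ 2) by field.
apply: mulr_ge0; first by rewrite divr_ge0// sqr_ge0.
have := sqr_ge0 z; lra.
Qed.

(** Pointwise form of the exponential moment bound, with a, b, c the values of
    f0, g and the reference function.  The constants 16 and 20 make both
    lam * sigma^2 and lam * B^2 small enough for the exponential to be replaced
    by its quadratic upper bound. *)
Lemma contrast_exponent_le (B sbar sigma a b c lam : R) : 0 < B ->
  0 < sigma <= sbar -> `|a| <= B -> `|b| <= B -> `|c| <= B ->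
  lam = (16 * sbar ^+ 2 + 20 * B ^+ 2)^-1 ->
  expR (lam * ((a - c) ^+ 2 - (a - b) ^+ 2) +
        (2 * lam * (b - c)) ^+ 2 * sigma ^+ 2 / 2)
    + lam / 2 * (a - b) ^+ 2 <= 1 + 2 * lam * (a - c) ^+ 2.
Proof.
move=> B0 /andP[s0 ss] aB bB cB lamD.
have sbar0 : 0 < sbar by exact: lt_le_trans ss.
have D0 : 0 < 16 * sbar ^+ 2 + 20 * B ^+ 2.
  by rewrite addr_gt0// mulr_gt0// exprn_gt0.
have lam0 : 0 < lam by rewrite lamD invr_gt0.
have lamE : lam * (16 * sbar ^+ 2 + 20 * B ^+ 2) = 1.
  by rewrite lamD mulVf ?gt_eqF.
have sb2 : sigma ^+ 2 <= sbar ^+ 2 by rewrite lerXn2r// nnegrE ltW.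
have lams : lam * sigma ^+ 2 <= 16^-1.
  have : lam * sigma ^+ 2 <= lam * sbar ^+ 2 by rewrite ler_pM2l.
  have : 0 <= lam * B ^+ 2 by rewrite mulr_ge0 ?sqr_ge0// ltW.
  move: lamE; rewrite mulrDr !(mulrCA lam); lra.
have lamB : lam * B ^+ 2 <= 20^-1.
  have : 0 <= lam * sbar ^+ 2 by rewrite mulr_ge0 ?sqr_ge0// ltW.
  move: lamE; rewrite mulrDr !(mulrCA lam); lra.
set u := (a - b) ^+ 2; set v := (a - c) ^+ 2.
have u0 : 0 <= u by exact: sqr_ge0.
have v0 : 0 <= v by exact: sqr_ge0.
have sq4 (p r : R) : `|p| <= B -> `|r| <= B -> (p - r) ^+ 2 <= 4 * B ^+ 2.
  move=> pB rB; rewrite -real_normK ?num_real//.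
  apply: (@le_trans _ _ ((B + B) ^+ 2)).
    rewrite lerXn2r// ?nnegrE ?addr_ge0 ?(ltW B0)//.
    by apply: (le_trans (ler_normB _ _)); exact: lerD.
  by rewrite -mulr2n -[B *+ 2]mulr_natl exprMn; lra.
have uB : u <= 4 * B ^+ 2 by exact: sq4.
have vB : v <= 4 * B ^+ 2 by exact: sq4.
have lu : lam * u <= 5^-1.
  by apply: (@le_trans _ _ (lam * (4 * B ^+ 2))); [rewrite ler_pM2l|lra].
have lv : lam * v <= 5^-1.
  by apply: (@le_trans _ _ (lam * (4 * B ^+ 2))); [rewrite ler_pM2l|lra].
have lu0 : 0 <= lam * u by rewrite mulr_ge0// ltW.
have lv0 : 0 <= lam * v by rewrite mulr_ge0// ltW.
have bc : (b - c) ^+ 2 <= 2 * u + 2 * v.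
  rewrite /u /v -subr_ge0.
  have -> : 2 * (a - b) ^+ 2 + 2 * (a - c) ^+ 2 - (b - c) ^+ 2 =
     ((a - b) + (a - c)) ^+ 2 by ring.
  exact: sqr_ge0.
set z := 5 / 4 * (lam * v) - 3 / 4 * (lam * u).
have ez : lam * (v - u) + (2 * lam * (b - c)) ^+ 2 * sigma ^+ 2 / 2 <= z.
  have -> : (2 * lam * (b - c)) ^+ 2 * sigma ^+ 2 / 2 =
    2 * (lam * (b - c) ^+ 2) * (lam * sigma ^+ 2) by field.
  have h1 : 0 <= lam * (b - c) ^+ 2 by rewrite mulr_ge0 ?sqr_ge0 ?ltW.
  have h2 : lam * (b - c) ^+ 2 * (lam * sigma ^+ 2) <=
      lam * (b - c) ^+ 2 * 16^-1 by apply: ler_wpM2l.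
  have h3 : lam * (b - c) ^+ 2 <= lam * (2 * u + 2 * v) by rewrite ler_pM2l.
  rewrite /z; move: h2 h3; rewrite mulrBr mulrDr !(mulrCA lam 2); lra.
have ez2 : expR (lam * (v - u) + (2 * lam * (b - c)) ^+ 2 * sigma ^+ 2 / 2)
   <= 1 + z + z ^+ 2.
  apply: (@le_trans _ _ (expR z)); first by rewrite ler_expR.
  by apply: expR_le_quad; rewrite /z; lra.
have zz : z ^+ 2 <= 4^-1 * (5 / 4 * (lam * v) + 3 / 4 * (lam * u)).
  rewrite -real_normK ?num_real// expr2.
  have n1 : `|z| <= 5 / 4 * (lam * v) + 3 / 4 * (lam * u).
    by rewrite ler_norml /z; lra.
  have n2 : `|z| <= 4^-1 by rewrite ler_norml /z; lra.
  by apply: ler_pM.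
apply: (@le_trans _ _ (1 + z + z ^+ 2 + lam / 2 * u)); first by rewrite lerD2r.
have -> : lam / 2 * u = (lam * u) / 2 by ring.
have -> : 2 * lam * v = 2 * (lam * v) by ring.
rewrite /z in zz *; lra.
Qed.

(** By Jensen's inequality the mean of x is at most ln (sum_i p_i exp x_i), and
    p_i exp x_i <= exp (- x_i). *)
Lemma weighted_mean_le_ln_sum (I : finType) (p x : I -> R) :
  (forall i, 0 <= p i) -> \sum_i p i = 1 ->
  (forall i, p i <= expR (- (2 * x i))) ->
  \sum_i p i * x i <= ln (\sum_i expR (- x i)).
Proof.
move=> p0 p1 pe; set S := \sum_i expR (- x i).
have S0 : 0 < S.
  rewrite lt_neqAle eq_sym sumr_ge0 ?andbT => [|i _]; last exact: expR_ge0.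
  apply/negP => /eqP S0.
  have [i pi] : exists i, p i != 0.
    apply/existsP; apply: contraT; rewrite negb_exists => /forallP h.
    move: p1; rewrite big1 => [/eqP|i _]; first by rewrite eq_sym oner_eq0.
    by apply/eqP; rewrite -[_ == _]negbK; exact: h.
  have := expR_gt0 (- x i); rewrite -[X in _ < X -> _]addr0.
  suff : expR (- x i) <= 0 by rewrite leNgt addr0 => /negP.
  rewrite -S0 /S (bigD1 i)//= lerDl sumr_ge0// => j _; exact: expR_ge0.
have lnSE : expR (ln S) = S by rewrite lnK// posrE.
suff h : \sum_i p i * (x i - ln S) <= 0.
  move: h; under eq_bigr do rewrite mulrBr.
  by rewrite sumrB -mulr_suml p1 mul1r subr_le0.
apply: (@le_trans _ _ (\sum_i p i * (expR (x i) / S - 1))).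
  apply: ler_sum => i _; apply: ler_wpM2l => //.
  rewrite -[X in _ / X]lnSE -expRB lerBrDl.
  exact: expR_ge1Dx.
under eq_bigr do rewrite mulrBr mulr1.
rewrite sumrB p1 subr_le0.
apply: (@le_trans _ _ (\sum_i expR (- x i) / S)).
  apply: ler_sum => i _; rewrite mulrA; apply: ler_wpM2r.
    by rewrite invr_ge0 ltW.
  apply: (@le_trans _ _ (expR (- (2 * x i)) * expR (x i))).
    by rewrite ler_wpM2r ?expR_ge0.
  by rewrite -expRD ler_expR; lra.
by rewrite -mulr_suml mulfV ?gt_eqF.
Qed.

End ScalarBounds.

(** After integrating out the Gaussian noise, the pointwise bound is linear in
    the squared errors, so it integrates to 1 + 2 lam |f0 - gs|^2
    - (lam / 2) |f0 - g|^2, and 1 + x <= exp x. *)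
Lemma contrast_mgf (R : realType) (M : nat) (PX : probability (M.-tuple R) R)
    (B sbar sigma lam : R) (f0 g gs : M.-tuple R -> R) :
  0 < B -> 0 < sigma <= sbar -> lam = (16 * sbar ^+ 2 + 20 * B ^+ 2)^-1 ->
  measurable_fun setT f0 -> measurable_fun setT g -> measurable_fun setT gs ->
  (\forall x \ae PX, `|f0 x| <= B) -> (\forall x \ae PX, `|g x| <= B) ->
  (\forall x \ae PX, `|gs x| <= B) ->
  (\int[PX]_x \int[gauss_law sigma]_y
     (expR (lam * ((f0 x + y - gs x) ^+ 2 - (f0 x + y - g x) ^+ 2)))%:E <=
   (expR (lam * (2 * sqnorm PX (f0 \- gs) - sqnorm PX (f0 \- g) / 2)))%:E)%E.
Proof.
move=> B0 ss lamE mf0 mg mgs f0B gB gsB.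
have lam0 : 0 <= lam.
  by rewrite lamE invr_ge0 addr_ge0// mulr_ge0// sqr_ge0.
pose E x := expR (lam * ((f0 x - gs x) ^+ 2 - (f0 x - g x) ^+ 2) +
                  (2 * lam * (g x - gs x)) ^+ 2 * sigma ^+ 2 / 2).
have mE : measurable_fun setT E.
  apply: measurableT_comp => //; apply: measurable_funD.
    apply: measurable_funM => //; apply: measurable_funB;
      by apply: measurable_funX; exact: measurable_funB.
  apply: measurable_funM => //; apply: measurable_funM => //.
  apply: measurable_funX; apply: measurable_funM => //.
  exact: measurable_funB.
have m1 : measurable_fun setT (f0 \- gs) by exact: measurable_funB.
have m2 : measurable_fun setT (f0 \- g) by exact: measurable_funB.
rewrite (_ : (\int[PX]_x _ = \int[PX]_x (E x)%:E)%E); last first.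
  apply: eq_integral => x _.
  transitivity (\int[gauss_law sigma]_y
     ((expR (lam * ((f0 x - gs x) ^+ 2 - (f0 x - g x) ^+ 2)))%:E *
      (expR (2 * lam * (g x - gs x) * y))%:E))%E.
    apply: eq_integral => y _; rewrite -EFinM -expRD; congr (expR _)%:E.
    by ring.
  rewrite ge0_integralZl_EFin ?expR_ge0//; last first.
    by apply/measurable_EFinP/measurableT_comp => //; exact: measurable_funM.
  rewrite gauss_mgf//; last by case/andP: ss => h _; rewrite gt_eqF.
  by rewrite -EFinM -expRD.
have U : (\int[PX]_x ((lam / 2) * (f0 \- g) x ^+ 2)%:E =
          (lam / 2 * sqnorm PX (f0 \- g))%:E)%E.
  under eq_integral do rewrite EFinM.
  rewrite ge0_integralZl_EFin ?divr_ge0//; first last.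
  - exact: measurable_sqr.
  - by move=> x _; rewrite lee_fin sqr_ge0.
  by rewrite -[X in (_ * X)%E]/(sqint PX (f0 \- g)) (sqintE m2 (ae_bounded_sub f0B gB)).
have V : (\int[PX]_x (1 + 2 * lam * (f0 \- gs) x ^+ 2)%:E =
          (1 + 2 * lam * sqnorm PX (f0 \- gs))%:E)%E.
  under eq_integral do rewrite EFinD EFinM.
  rewrite ge0_integralD//; first last.
  - apply/measurable_EFinP/measurable_funM => //; exact: measurable_funX.
  - by move=> x _; rewrite -EFinM lee_fin; apply: mulr_ge0; [exact: mulr_ge0|exact: sqr_ge0].
  rewrite integral_cst// [X in (_ * X + _)%E]probability_setT mule1.
  rewrite ge0_integralZl_EFin ?mulr_ge0//; first last.
  - exact: measurable_sqr.
  - by move=> x _; rewrite lee_fin sqr_ge0.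
  by rewrite -[X in (_ + _ * X)%E]/(sqint PX (f0 \- gs)) (sqintE m1 (ae_bounded_sub f0B gsB)).
apply: (@le_trans _ _ ((1 + 2 * lam * sqnorm PX (f0 \- gs)) -
    lam / 2 * sqnorm PX (f0 \- g))%:E); last first.
  rewrite lee_fin; apply: le_trans (expR_ge1Dx _); lra.
rewrite EFinB leeBrDr// -U -V -ge0_integralD//; first last.
- by apply/measurable_EFinP/measurable_funM => //; exact: measurable_funX.
- by move=> x _; rewrite lee_fin mulr_ge0 ?divr_ge0 ?sqr_ge0.
- exact/measurable_EFinP.
- by move=> x _; rewrite lee_fin expR_ge0.
apply: ae_ge0_le_integral => //.
- move=> x _; rewrite -EFinD lee_fin addr_ge0 ?expR_ge0//.
  by rewrite mulr_ge0 ?divr_ge0 ?sqr_ge0.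
- apply/measurable_EFinP; apply: measurable_funD => //.
  by apply: measurable_funM => //; exact: measurable_funX.
- move=> x _; rewrite lee_fin; apply: addr_ge0 => //.
  by apply: mulr_ge0; [exact: mulr_ge0|exact: sqr_ge0].
- apply/measurable_EFinP; apply: measurable_funD => //.
  by apply: measurable_funM => //; exact: measurable_funX.
move: f0B gB gsB; apply: filterS3 => x h1 h2 h3 _.
by rewrite -EFinD lee_fin; exact: (contrast_exponent_le B0 ss h1 h2 h3 lamE).
Qed.

Section LeastSquares.
Context {R : realType} (n M : nat) {I : finType}
  (g : I -> M.-tuple R -> R) (mg : forall i, measurable_fun setT (g i)).
Let D := n.-tuple (M.-tuple R * R).

Definition rss (i : I) (d : D) : R :=
  \sum_(k < n) ((tnth d k).2 - g i (tnth d k).1) ^+ 2.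

(* Ties are broken by the enumeration of I, so that the selected index is
   unique and selection is a measurable function of the data. *)
Definition selects (i : I) : set D := [set d | forall j,
  rss i d < rss j d \/ rss i d <= rss j d /\ (enum_rank i <= enum_rank j)%N].

Lemma measurable_rss i : measurable_fun setT (rss i).
Proof.
apply: measurable_sum => k; apply: measurable_funX; apply: measurable_funB.
  apply: (measurableT_comp (@measurable_snd _ _ (M.-tuple R : measurableType _) R)).
  exact: measurable_tnth.
apply: (measurableT_comp (mg i)).
apply: (measurableT_comp (@measurable_fst _ _ (M.-tuple R : measurableType _) R)).
exact: measurable_tnth.
Qed.

Lemma measurable_selects i : measurable (selects i).
Proof.
rewrite (_ : selects i = \bigcap_(j in [set` [set: I]%SET])
  [set d | (rss i d < rss j d) ||
           (rss i d <= rss j d) && (enum_rank i <= enum_rank j)%N]); last first.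
  apply/seteqP; split=> d /= H j.
    by move=> _ /=; case: (H j) => [->//|[-> ->]]; rewrite orbT.
  by have /= := H j; rewrite inE => /(_ isT) /orP[->|/andP[-> ->]]; [left|right].
apply: fin_bigcap_measurable; first exact: finite_finset.
move=> j _; rewrite -[X in measurable X]setTI.
have m1 : measurable_fun setT (fun d => rss i d < rss j d).
  by apply: measurable_fun_ltr; exact: measurable_rss.
have m2 : measurable_fun setT (fun d => rss i d <= rss j d).
  by apply: measurable_fun_ler; exact: measurable_rss.
have m3 : measurable_fun [set: D] (fun d => (rss i d < rss j d) ||
           (rss i d <= rss j d) && (enum_rank i <= enum_rank j)%N).
  apply: measurable_or => //; apply: measurable_and => //.
by apply: (m3 measurableT [set true]).
Qed.

Lemma selects_ex (i0 : I) (d : D) : exists i, selects i d.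
Proof.
case: (@Order.TotalTheory.arg_minP _ _ _ i0 xpredT (fun i => rss i d) isT).
move=> i1 _ h1.
case: (@arg_minnP _ i1 (fun i => rss i d <= rss i1 d) (fun i => enum_rank i)
  (lexx _)) => i h2 h3; exists i => j.
have [lt|le] := ltP (rss i d) (rss j d); [by left|right].
have ij : rss i d <= rss j d by apply: (le_trans h2); exact: h1.
by split => //; apply: h3; exact: le_trans h2.
Qed.

Lemma selects_uniq i j d : selects i d -> selects j d -> i = j.
Proof.
move=> /(_ j) [ij|[ij rij]] /(_ i) [ji|[ji rji]].
- by have := lt_trans ij ji; rewrite ltxx.
- by have := lt_le_trans ij ji; rewrite ltxx.
- by have := le_lt_trans ij ji; rewrite ltxx.
- by apply/enum_rank_inj/val_inj/eqP; rewrite eqn_leq rij.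
Qed.

Lemma selects_rss i j d : selects i d -> rss i d <= rss j d.
Proof. by move=> /(_ j)[/ltW|[]]. Qed.

Definition ls_fit (p : D * M.-tuple R) : R :=
  \sum_i \1_(selects i) p.1 * g i p.2.

Lemma measurable_ls_fit : measurable_fun setT ls_fit.
Proof.
apply: measurable_sum => i; apply: measurable_funM.
  apply: measurableT_comp => //.
  by apply: measurable_indic; exact: measurable_selects.
exact: (measurableT_comp (mg i)).
Qed.

Definition ls_estimator : estimator R n M :=
  HB.pack ls_fit (isMeasurableFun.Build _ _ _ _ _ measurable_ls_fit).

Lemma ls_fitE i d x : selects i d -> ls_fit (d, x) = g i x.
Proof.
move=> si; rewrite /ls_fit (bigD1 i)//= big1 => [|j ji].
  by rewrite indicE mem_set// mul1r addr0.
rewrite indicE memNset ?mul0r// => sj.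
by move/eqP: ji; apply; exact: selects_uniq sj si.
Qed.

End LeastSquares.

Section LeastSquaresRisk.
Context {R : realType} (n M : nat) {I : finType}
  (g : I -> M.-tuple R -> R) (mg : forall i, measurable_fun setT (g i)).
Context (PX : probability (M.-tuple R) R) (B sbar lam : R).
Hypothesis n_gt0 : (0 < n)%N.
Hypothesis B_gt0 : 0 < B.
Hypothesis lamE : lam = (16 * sbar ^+ 2 + 20 * B ^+ 2)^-1.
Hypothesis gB : forall i, \forall x \ae PX, `|g i x| <= B.
Context (sigma : R) (S : sample n PX sigma) (f0 : M.-tuple R -> R).
Hypothesis sigma_sbar : 0 < sigma <= sbar.
Hypothesis mf0 : measurable_fun setT f0.
Variable s : I.
Hypothesis f0B : \forall x \ae PX, `|f0 x| <= B.

Let q i := sqnorm PX (f0 \- g i).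

Let mdata : measurable_fun setT (data (S := S) f0).
Proof. exact: measurable_data. Qed.

Let msel i : measurable (data (S := S) f0 @^-1` selects g i).
Proof.
rewrite -[X in measurable X]setTI; apply: mdata => //.
exact: measurable_selects.
Qed.

Let p i := fine (sprob S (data (S := S) f0 @^-1` selects g i)).

Let pE i : sprob S (data (S := S) f0 @^-1` selects g i) = (p i)%:E.
Proof. by rewrite /p fineK//; apply: fin_num_measure. Qed.

Lemma ls_risk_eq : risk S (ls_estimator n mg) f0 = (\sum_i p i * q i)%:E.
Proof.
rewrite /risk.
transitivity (\int[sprob S]_w
    \sum_i ((q i)%:E * (\1_(data (S := S) f0 @^-1` selects g i) w)%:E))%E.
  apply: eq_integral => w _; rewrite fnorm2_sqr.
  have [i si] := selects_ex g s (data (S := S) f0 w).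
  rewrite (bigD1 i)//= big1 ?adde0 => [|j ji]; last first.
    rewrite indicE memNset ?mule0// => sj.
    by move/eqP: ji; apply; exact: selects_uniq sj si.
  rewrite indicE mem_set// mule1 -(sqintE _ (ae_bounded_sub f0B (gB i))).
    apply: eq_integral => x _; rewrite (@ls_fitE _ _ _ _ g i)//.
    by rewrite -sqrrN opprB.
  exact: measurable_funB.
rewrite ge0_integral_sum//; last 2 first.
- move=> i; apply: measurable_funeM; apply/measurable_EFinP.
  exact: measurable_indic.
- by move=> i w _; rewrite mule_ge0// lee_fin ?sqnorm_ge0// indicE.
rewrite -sumEFin; apply: eq_bigr => i _.
rewrite ge0_integralZl_EFin ?sqnorm_ge0//.
- by rewrite integral_indic// setIT [X in (_ * X)%E](pE i) -EFinM mulrC.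
- by apply/measurable_EFinP; exact: measurable_indic.
Qed.

Let lam_gt0 : 0 < lam.
Proof.
case/andP: sigma_sbar => s0 ss.
by rewrite lamE invr_gt0 addr_gt0// mulr_gt0// exprn_gt0// (lt_le_trans s0).
Qed.

Let sum_p : \sum_i p i = 1.
Proof.
apply/EFin_inj; rewrite -sumEFin.
transitivity (\sum_i \int[sprob S]_w (\1_(data (S := S) f0 @^-1` selects g i) w)%:E)%E.
  by apply: eq_bigr => i _; rewrite integral_indic// setIT [RHS](pE i).
rewrite -ge0_integral_sum//; last first.
  by move=> i; apply/measurable_EFinP; exact: measurable_indic.
rewrite -(@probability_setT _ _ _ (sprob S)) -[RHS]mul1e -integral_cst//.
apply: eq_integral => w _; have [i si] := selects_ex g s (data (S := S) f0 w).
rewrite (bigD1 i)//= big1 ?adde0 => [|j ji]; last first.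
  rewrite indicE memNset// => sj.
  by move/eqP: ji; apply; exact: selects_uniq sj si.
by rewrite indicE mem_set.
Qed.

(* If i is selected, its empirical contrast with s is nonnegative; Markov's
   inequality for the exponential of the contrast. *)
Let p_le i : p i <= expR (n%:R * (lam * (2 * q s - q i / 2))).
Proof.
pose phi (z : M.-tuple R * R) :=
  expR (lam * ((z.2 - g s z.1) ^+ 2 - (z.2 - g i z.1) ^+ 2)).
have mz j : measurable_fun [set: M.-tuple R * R]
    (fun z : M.-tuple R * R => (z.2 - g j z.1) ^+ 2).
  apply: measurable_funX; apply: measurable_funB => //.
  exact: (measurableT_comp (mg j)).
have mphi : measurable_fun setT phi.
  apply: measurableT_comp => //; apply: measurable_funM => //.
  exact: measurable_funB.
have phi0 z : 0 <= phi z by exact: expR_ge0.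
pose eE := (\int[PX]_x \int[gauss_law sigma]_y (phi (x, f0 x + y)%R)%:E)%E.
have e_le : (eE <= (expR (lam * (2 * q s - q i / 2)))%:E)%E.
  exact: (contrast_mgf B_gt0 sigma_sbar lamE mf0 (mg i) (mg s) f0B (gB i) (gB s)).
have e_ge0 : (0 <= eE)%E.
  by apply: integral_ge0 => x _; apply: integral_ge0 => y _; rewrite lee_fin.
have eEE : eE = (fine eE)%:E.
  by rewrite fineK// ge0_fin_numE// (le_lt_trans e_le)// ltry.
have := @integral_prod_data _ _ _ _ _ S f0 (fun=> phi) (fun=> fine eE) mf0
  (fun=> mphi) (fun=> phi0) (fun=> eEE).
rewrite prodr_const card_ord => E.
rewrite -lee_fin -pE expRM_natl.
apply: (@le_trans _ _ ((fine eE) ^+ n)%:E); last first.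
  rewrite lee_fin lerXn2r// ?nnegrE ?expR_ge0 ?fine_ge0//.
  by rewrite -lee_fin -eEE.
have -> : (sprob S (data (S := S) f0 @^-1` selects g i) =
    \int[sprob S]_w (\1_(data (S := S) f0 @^-1` selects g i) w)%:E)%E.
  by rewrite integral_indic// setIT.
rewrite -E.
apply: ge0_le_integral => //.
- by apply/measurable_EFinP; exact: measurable_indic.
- apply/measurable_EFinP; apply: measurable_prod => k _.
  apply: (measurableT_comp mphi).
  exact: (measurableT_comp (measurable_tnth k)).
move=> w _; rewrite lee_fin indicE.
have [/set_mem si|] := boolP (_ \in _); last by rewrite prodr_ge0.
rewrite /phi -expR_sum -expR0 ler_expR -mulr_sumr mulr_ge0 ?(ltW lam_gt0)//.
by rewrite sumrB subr_ge0; exact: (selects_rss s si).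
Qed.

(** The risk is the mean of |f0 - g_i|^2 under the selection probabilities,
    each of which is exponentially small in that quantity. *)
Lemma ls_risk_le : (risk S (ls_estimator n mg) f0 <=
  (8 * q s + 4 / (n%:R * lam) *
     ln (\sum_i expR (- (n%:R * lam / 4 * q i))))%:E)%E.
Proof.
rewrite ls_risk_eq lee_fin.
have nl0 : 0 < n%:R * lam by rewrite mulr_gt0 ?ltr0n.
pose x i := n%:R * lam / 4 * q i - n%:R * lam * q s.
have h := @weighted_mean_le_ln_sum _ _ p x _ sum_p.
have p0 i : 0 <= p i by exact: fine_ge0.
have {h} := h p0; have pl i : p i <= expR (- (2 * x i)).
  by apply: (le_trans (p_le i)); rewrite ler_expR /x; lra.
move=> /(_ pl).
have -> : \sum_i p i * x i =
    n%:R * lam / 4 * \sum_i p i * q i - n%:R * lam * q s.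
  rewrite /x; under eq_bigr do rewrite mulrBr (mulrCA (p _)).
  by rewrite sumrB -mulr_sumr -mulr_suml sum_p mul1r.
have -> : \sum_i expR (- x i) =
    expR (n%:R * lam * q s) * \sum_i expR (- (n%:R * lam / 4 * q i)).
  rewrite mulr_sumr; apply: eq_bigr => i _; rewrite -expRD; congr expR.
  by rewrite /x; ring.
set T := \sum_i expR _.
have T0 : 0 < T.
  rewrite /T (bigD1 s)//=; apply: ltr_pwDl; first exact: expR_gt0.
  by apply: sumr_ge0 => i _; exact: expR_ge0.
rewrite lnM ?posrE ?expR_gt0// expRK => h.
have e4 : 0 < 4 / (n%:R * lam) by rewrite divr_gt0.
rewrite -(ler_pM2l (x := n%:R * lam / 4)) ?divr_gt0//.
have -> : n%:R * lam / 4 * (8 * q s + 4 / (n%:R * lam) * ln T) =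
   2 * (n%:R * lam * q s) + ln T.
  by set y := n%:R * lam in nl0 *; field; rewrite gt_eqF.
lra.
Qed.

Lemma ls_risk_bounded : (risk S (ls_estimator n mg) f0 <= (4 * B ^+ 2)%:E)%E.
Proof.
rewrite ls_risk_eq lee_fin -[leRHS]mul1r -[X in _ <= X * _]sum_p mulr_suml.
apply: ler_sum => i _; rewrite ler_wpM2l ?fine_ge0//.
have -> : 4 * B ^+ 2 = (B + B) ^+ 2 by ring.
apply: sqnorm_le; first exact: measurable_funB.
exact: ae_bounded_sub.
Qed.

End LeastSquaresRisk.

(** * The net of sparse coefficient vectors *)

Section Counting.
Context {R : realType}.

(** Weights of product form are summed coordinatewise, in the spirit of a
    Chernoff bound. *)
Lemma sum_ffun_le_expR (I J : finType) (A : {pred {ffun I -> J}})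
    (F : {ffun I -> J} -> R) (w : I -> J -> R) (a : R) :
  (forall i j, 0 <= w i j) ->
  (forall c, c \in A -> F c <= \prod_i w i (c i)) ->
  (forall i, \sum_j w i j <= 1 + a) ->
  \sum_(c in A) F c <= expR (#|I|%:R * a).
Proof.
move=> w0 FA wa.
apply: (@le_trans _ _ (\sum_(c : {ffun I -> J}) \prod_i w i (c i))).
  rewrite [leRHS](bigID [in A])/= -[leLHS]addr0; apply: lerD.
    exact: ler_sum.
  by apply: sumr_ge0 => c _; exact: prodr_ge0.
rewrite -bigA_distr_bigA expRM_natl -prodr_const.
apply: ler_prod => i _; rewrite sumr_ge0//=.
by apply: (le_trans (wa i)); exact: expR_ge1Dx.
Qed.

(** The exponent (z - y) + (y - z), with truncated subtractions, is the
    distance of z and y. *)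
Lemma sum_geometric_dist (r : R) (y N : nat) : 0 < r < 1 ->
  \sum_(z < N) r ^+ ((z - y) + (y - z)) <= 2 / (1 - r).
Proof.
move=> /andP[r0 r1]; have r1' : 0 < 1 - r by rewrite subr_gt0.
have rm m : 0 < r ^+ m by rewrite exprn_gt0.
suff h : (1 - r) * \sum_(z < N) r ^+ ((z - y) + (y - z)) <=
    if (N <= y)%N then r ^+ (y - N).+1 else 2 - r ^+ (N - y).
  rewrite ler_pdivlMr// mulrC; apply: (le_trans h).
  case: ifP => _; last by have := rm (N - y)%N; lra.
  apply: (@le_trans _ _ 1); last lra.
  by rewrite exprn_ile1// ltW.
elim: N => [|N IH]; first by rewrite big_ord0 mulr0 ltW.
rewrite big_ord_recr/= mulrDr; apply: (le_trans (lerD IH (lexx _))).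
have [Ny|Ny] := leqP N y; last first.
  rewrite ltnNge (ltnW Ny)/= subSn ?(ltnW Ny)// exprS.
  have -> : (y - N = 0)%N by apply/eqP; rewrite subn_eq0 ltnW.
  by rewrite addn0; lra.
have -> : (N - y = 0)%N by apply/eqP; rewrite subn_eq0.
rewrite add0n; have [lt|] := ltnP N y.
  by rewrite subnSK// exprS; lra.
move=> yN; have -> : N = y by apply/eqP; rewrite eqn_leq Ny.
by rewrite subnn subSn// subnn expr1 expr0; lra.
Qed.

End Counting.

Section SparseNorm.
Context {R : realType} {M : nat} (PX : probability (M.-tuple R) R).
Implicit Types theta : 'rV[R]_M.

Lemma l0norm_leM theta : (l0norm theta <= M)%N.
Proof. by rewrite -[leqRHS]card_ord; exact: max_card. Qed.

Lemma l0normB theta theta' :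
  (l0norm (theta - theta')%R <= l0norm theta + l0norm theta')%N.
Proof.
apply: leq_trans (leq_card_setU _ _); apply: subset_leq_card.
apply/fintype.subsetP => j.
rewrite !inE !mxE; apply: contraR; rewrite negb_or !negbK => /andP[/eqP-> /eqP->].
by rewrite subr0.
Qed.

Lemma SRC_sqnorm (alo ahi : R) (g : nat) theta : 0 < alo -> 0 < ahi ->
  SRC PX alo ahi g -> (l0norm theta <= 2 * g)%N ->
  alo ^+ 2 * \sum_j theta ord0 j ^+ 2 <= sqnorm PX (flin theta) <=
  ahi ^+ 2 * \sum_j theta ord0 j ^+ 2.
Proof.
move=> alo0 ahi0 src l0; have := src theta.
rewrite leq_min l0 l0norm_leM => /(_ isT) /andP[].
have := fnorm2_sqr PX (flin theta); rewrite -lqnorm2_sqr /sqnorm.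
have l20 := lqnorm_ge0 2 theta.
case: (fnorm2 PX (flin theta)) => [r| |]//= <-.
rewrite !lee_fin => h1 h2.
have r0 : 0 <= r by apply: le_trans h1; rewrite mulr_ge0// ltW.
have sq2 a b : 0 <= a -> a <= b -> a ^+ 2 <= b ^+ 2 :> R.
  by move=> a0 ab; rewrite lerXn2r// nnegrE (le_trans a0).
rewrite -!exprMn; apply/andP; split; apply: sq2 => //.
by rewrite mulr_ge0// ltW.
Qed.

End SparseNorm.

Section SparseNet.
Context {R : realType} (n M k : nat) (PX : probability (M.-tuple R) R).
Context (L alo ahi : R).
Hypothesis n_gt0 : (0 < n)%N.
Hypothesis k_gt0 : (0 < k)%N.
Hypothesis k_leM : (k <= M)%N.
Hypothesis L_gt0 : 0 < L.
Hypothesis alo_gt0 : 0 < alo.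
Hypothesis ahi_gt0 : 0 < ahi.
Hypothesis src : SRC PX alo ahi k.

(* dl is the mesh; H bounds every coordinate of a sparse vector whose function
   is bounded by L, and Z is the number of meshes in [-H, H]. *)
Let dl : R := (Num.sqrt n%:R)^-1.
Let H : R := L / alo.
Let Z : nat := Num.trunc (2 * H / dl).

Definition sparse_ball : set 'rV[R]_M :=
  [set theta | (l0norm theta <= k)%N /\ (fnormoo PX (flin theta) <= L%:E)%E].

Definition cell (theta : 'rV[R]_M) : {ffun 'I_M -> 'I_Z.+1} :=
  [ffun j => inord (Num.trunc ((theta ord0 j + H) / dl))].

Definition occupied : {pred {ffun 'I_M -> 'I_Z.+1}} :=
  fun c => `[< exists2 theta, sparse_ball theta & cell theta = c >].

Definition cell_rep (c : {ffun 'I_M -> 'I_Z.+1}) : 'rV[R]_M :=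
  xget 0 [set theta | sparse_ball theta /\ cell theta = c].

Lemma cell_repP c : c \in occupied ->
  sparse_ball (cell_rep c) /\ cell (cell_rep c) = c.
Proof.
move=> /asboolP[theta h1 h2]; rewrite /cell_rep; case: xgetP => [t _ //|].
by move=> /(_ theta) h; exfalso; apply: h.
Qed.

Lemma cell_occupied theta : sparse_ball theta -> cell theta \in occupied.
Proof. by move=> h; apply/asboolP; exists theta. Qed.

Let n0 : 0 < n%:R :> R. Proof. by rewrite ltr0n. Qed.

Let dl_gt0 : 0 < dl. Proof. by rewrite invr_gt0 sqrtr_gt0. Qed.

Let dl_sqr : n%:R * dl ^+ 2 = 1.
Proof. by rewrite exprVn sqr_sqrtr ?ler0n// mulfV// gt_eqF. Qed.

Lemma sparse_ball_coord theta j : sparse_ball theta -> `|theta ord0 j| <= H.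
Proof.
move=> [l0 /fnormoo_leP fB].
have /andP[h _] := SRC_sqnorm alo_gt0 ahi_gt0 src (leq_trans l0 (leq_pmull k (ltn0Sn 1))).
have := le_trans h (sqnorm_le (measurable_flin theta) fB).
rewrite (bigD1 j)//= mulrDr => h2.
have r0 : 0 <= alo ^+ 2 * \sum_(i < M | i != j) theta ord0 i ^+ 2.
  by rewrite mulr_ge0 ?sqr_ge0// sumr_ge0// => i _; exact: sqr_ge0.
rewrite /H ler_pdivlMr// mulrC.
rewrite -(@ler_pXn2r _ 2)// ?nnegrE ?mulr_ge0 ?(ltW alo_gt0) ?(ltW L_gt0)//.
by rewrite exprMn real_normK ?num_real//; lra.
Qed.

Lemma cellE theta j : sparse_ball theta ->
  (cell theta j)%:R * dl <= theta ord0 j + H < ((cell theta j)%:R + 1) * dl.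
Proof.
move=> th; have := sparse_ball_coord j th; rewrite ler_norml => /andP[h1 h2].
have p0 : 0 <= (theta ord0 j + H) / dl.
  by rewrite divr_ge0 ?(ltW dl_gt0)//; lra.
rewrite /cell ffunE inordK.
  have /andP[] := Num.Theory.truncn_itv p0.
  by rewrite ler_pdivlMr// ltr_pdivrMr// -natr1 => -> ->.
rewrite ltnS; apply: le_truncn; apply: ler_wpM2r; last lra.
by rewrite invr_ge0 ltW.
Qed.

Lemma sparse_ball_l0B theta theta' : sparse_ball theta -> sparse_ball theta' ->
  (l0norm (theta - theta')%R <= 2 * k)%N.
Proof.
move=> [h _] [h' _]; apply: (leq_trans (l0normB _ _)).
by rewrite mul2n -addnn leq_add.
Qed.

Lemma sqnorm_flinB theta theta' :
  sqnorm PX (flin theta \- flin theta') = sqnorm PX (flin (theta - theta')).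
Proof. by congr sqnorm; apply/funext => x /=; rewrite flinB. Qed.

(** Two parameters in the same cell differ by at most the mesh in each of their
    at most 2k nonzero coordinates. *)
Lemma cell_approx theta theta' : sparse_ball theta -> sparse_ball theta' ->
  cell theta = cell theta' ->
  sqnorm PX (flin theta \- flin theta') <= ahi ^+ 2 * (2 * k%:R / n%:R).
Proof.
move=> th th' E; have l0 := sparse_ball_l0B th th'.
rewrite sqnorm_flinB.
have /andP[_ h] := SRC_sqnorm alo_gt0 ahi_gt0 src l0.
apply: (le_trans h); rewrite ler_pM2l ?exprn_gt0//.
have dn : dl ^+ 2 = n%:R^-1.
  by apply: (mulfI (lt0r_neq0 n0)); rewrite dl_sqr mulfV// gt_eqF.
rewrite -dn.
apply: (@le_trans _ _
    (\sum_(j in [set j | (theta - theta') ord0 j != 0]%SET) dl ^+ 2)).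
  rewrite [leRHS]big_mkcond/=; apply: ler_sum => j _; rewrite inE.
  case: eqP => [->|_] /=; first by rewrite expr0n.
  have := cellE j th; have := cellE j th'; rewrite E => /andP[h1 h2] /andP[h3 h4].
  rewrite !mxE -real_normK ?num_real//.
  rewrite lerXn2r// ?nnegrE ?(ltW dl_gt0)// ler_norml; lra.
rewrite sumr_const -[leLHS]mulr_natl ler_wpM2r ?sqr_ge0//.
by rewrite -natrM ler_nat.
Qed.

(** In units of the mesh, cells at distance d >= 1 force the coordinates to be
    more than d - 1 apart, and (d - 1)^2 >= d - 2. *)
Lemma cell_dist theta theta' j : sparse_ball theta -> sparse_ball theta' ->
  ((cell theta j - cell theta' j) + (cell theta' j - cell theta j))%N%:R - 2 <=
  n%:R * (theta' ord0 j - theta ord0 j) ^+ 2.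
Proof.
move=> th th'; have /andP[h1 h2] := cellE j th; have /andP[h3 h4] := cellE j th'.
set z := cell theta j in h1 h2 *; set y := cell theta' j in h3 h4 *.
set d := theta' ord0 j - theta ord0 j.
pose D := d / dl.
have dE : d = D * dl by rewrite /D divfK ?gt_eqF.
have -> : n%:R * d ^+ 2 = D ^+ 2 by rewrite dE exprMn mulrCA dl_sqr mulr1.
have D1 : D < y%:R - z%:R + 1.
  by rewrite /D ltr_pdivrMr// /d; lra.
have D2 : y%:R - z%:R - 1 < D.
  by rewrite /D ltr_pdivlMr// /d; lra.
clearbody D.
have [zy|yz] := leqP z y.
  rewrite (_ : (z - y = 0)%N) ?add0n; last by apply/eqP; rewrite subn_eq0.
  rewrite natrB//; have [E|] := eqVneq (y - z)%N 0%N.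
    by rewrite -natrB// E; have := sqr_ge0 D; lra.
  rewrite -lt0n => h; have : 1 <= (y - z)%N%:R :> R by rewrite ler1n.
  by rewrite natrB// => h'; have := sqr_ge0 (D - 1); rewrite sqrrB1; lra.
rewrite (_ : (y - z = 0)%N) ?addn0; last by apply/eqP; rewrite subn_eq0 ltnW.
have : 1 <= (z - y)%N%:R :> R by rewrite ler1n subn_gt0.
rewrite natrB ?(ltnW yz)// => h'.
by have := sqr_ge0 (D + 1); rewrite sqrrD1; lra.
Qed.

Definition cell_const (kap : R) : R :=
  expR (2 * (kap * alo ^+ 2)) * (2 / (1 - expR (- (kap * alo ^+ 2)))).

(** Every coordinate is charged k / M for being nonzero, which costs
    (M / k)^k in total, and then decays geometrically with the distance of the
    cells; summed over a coordinate, the weights are 1 + O(k / M). *)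
Lemma sum_cells (kap : R) theta : 0 < kap -> sparse_ball theta ->
  \sum_(c in occupied)
     expR (- (n%:R * kap * sqnorm PX (flin theta \- flin (cell_rep c)))) <=
  expR (k%:R * (ln (M%:R / k%:R) + cell_const kap)).
Proof.
move=> kap0 th.
have k0 : 0 < k%:R :> R by rewrite ltr0n.
have M0 : 0 < M%:R :> R by rewrite ltr0n (leq_trans k_gt0).
pose q : R := k%:R / M%:R.
have q0 : 0 < q by rewrite divr_gt0.
have q1 : q <= 1 by rewrite ler_pdivrMr// mul1r ler_nat.
pose beta := kap * alo ^+ 2.
have beta0 : 0 < beta by rewrite mulr_gt0// exprn_gt0.
pose r := expR (- beta).
have r01 : 0 < r < 1 by rewrite expR_gt0 expR_lt1 oppr_lt0.
pose y := cell theta.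
pose z0 : 'I_Z.+1 := inord (Num.trunc ((0 + H) / dl)).
pose w (j : 'I_M) (z : 'I_Z.+1) : R := if z == z0 then 1
  else q * expR (2 * beta) * r ^+ ((z - y j) + (y j - z)).
have w0 j z : 0 <= w j z.
  rewrite /w; case: eqP => // _; rewrite !mulr_ge0 ?expR_ge0 ?(ltW q0)//.
  by rewrite exprn_ge0// expR_ge0.
have main : \sum_(c in occupied) q ^+ k *
     expR (- (n%:R * kap * sqnorm PX (flin theta \- flin (cell_rep c)))) <=
   expR (#|'I_M|%:R * (q * cell_const kap)).
  apply: (@sum_ffun_le_expR _ _ _ _ _ w) => //.
  - move=> c /cell_repP[rb rc]; set rep := cell_rep c in rb rc *.
    have /andP[h _] := SRC_sqnorm alo_gt0 ahi_gt0 src (sparse_ball_l0B th rb).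
    rewrite sqnorm_flinB.
    apply: (@le_trans _ _ (q ^+ l0norm rep *
       expR (- (n%:R * beta * \sum_j (theta - rep) ord0 j ^+ 2)))).
      apply: ler_pM; rewrite ?exprn_ge0 ?expR_ge0 ?(ltW q0)//.
        by apply: ler_wiXn2l => //; [exact: ltW|exact: rb.1].
      rewrite ler_expR lerN2 /beta -!mulrA ler_pM2l// ler_pM2l//.
      by rewrite mulrA.
    rewrite /l0norm -prodr_const big_mkcond/= mulr_sumr -sumrN expR_sum.
    rewrite -big_split/=; apply: ler_prod => j _.
    apply/andP; split.
      by rewrite mulr_ge0 ?expR_ge0//; case: ifP => // _; exact: ltW.
    rewrite inE /w -[in X in _ <= X]rc.
    have e1 : expR (- (n%:R * beta * (theta - rep) ord0 j ^+ 2)) <= 1.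
      rewrite expR_le1 oppr_le0; apply: mulr_ge0; last exact: sqr_ge0.
      by apply: mulr_ge0; [exact: ler0n|exact: ltW].
    case: (cell rep j =P z0) => [_|zz].
      case: ifP => _; last by rewrite mul1r.
      by rewrite mulr_ile1 ?expR_ge0 ?(ltW q0).
    have -> /= : rep ord0 j != 0.
      apply/eqP => rj; apply: zz; rewrite /cell ffunE rj; done.
    rewrite -[leRHS]mulrA ler_pM2l// /r -expRM_natl -expRD ler_expR.
    have := cell_dist j rb th; rewrite -/y !mxE => h2.
    have -> : n%:R * beta * (theta ord0 j - rep ord0 j) ^+ 2 =
      beta * (n%:R * (theta ord0 j - rep ord0 j) ^+ 2) by ring.
    have := ler_wpM2l (ltW beta0) h2; lra.
  - move=> j; rewrite (bigD1 z0)//= {1}/w eqxx lerD2l.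
    apply: (@le_trans _ _ (\sum_(z < Z.+1)
        q * expR (2 * beta) * r ^+ ((z - y j) + (y j - z)))).
      rewrite [leRHS](bigD1 z0)//= -[leLHS]add0r; apply: lerD.
        rewrite !mulr_ge0 ?expR_ge0 ?(ltW q0)//.
        by rewrite exprn_ge0// expR_ge0.
      by apply: ler_sum => z /negbTE zz; rewrite /w zz.
    rewrite -mulr_sumr /cell_const -mulrA ler_pM2l// -/beta -/r.
    by rewrite ler_pM2l ?expR_gt0//; exact: sum_geometric_dist.
move: main; rewrite -mulr_sumr card_ord => main.
have qM : M%:R * (q * cell_const kap) = k%:R * cell_const kap.
  by rewrite mulrA /q [M%:R * _]mulrC divfK ?gt_eqF.
rewrite qM in main.
rewrite mulrDr expRD.
have -> : expR (k%:R * ln (M%:R / k%:R)) = (q ^+ k)^-1.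
  by rewrite expRM_natl lnK ?posrE ?divr_gt0// -exprVn /q invf_div.
rewrite [leRHS]mulrC ler_pdivlMr ?exprn_gt0// [leLHS]mulrC; exact: main.
Qed.

End SparseNet.

Lemma le_Cmin1 (R : realType) (x A B r : R) : 0 <= A -> 0 <= B ->
  x <= A * r -> x <= B -> 0 <= r -> x <= (A + B) * Num.min 1 r.
Proof.
move=> A0 B0 xA xB r0; rewrite minEle; case: ifP => h.
  by rewrite mulr1; apply: (le_trans xB); lra.
apply: (le_trans xA); rewrite mulrDl lerDl mulr_ge0//.
Qed.

Lemma ln_ratio_ge0 (R : realType) (k M : nat) : (0 < k <= M)%N ->
  0 <= ln (M%:R / k%:R : R).
Proof.
move=> /andP[k0 kM]; apply: ln_ge0.
by rewrite ler_pdivlMr ?ltr0n// mul1r ler_nat.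
Qed.

Lemma l0_rate_ge0 (R : realType) (n M k : nat) : (0 < k <= M)%N ->
  0 <= @l0_rate R n M k.
Proof.
move=> kM; rewrite /l0_rate divr_ge0// mulr_ge0//.
by have := ln_ratio_ge0 R kM; lra.
Qed.

(** The number 1 in the rate comes from the trivial bound 4 L^2 on the loss. *)
Lemma sparse_upper (R : realType) (L sbar alo ahi : R) :
  0 < L -> 0 < sbar -> 0 < alo -> 0 < ahi ->
  exists2 C, 0 < C &
  forall (n M k : nat) (PX : probability (M.-tuple R) R),
    (0 < n)%N -> (0 < k <= M)%N -> SRC PX alo ahi k ->
  exists e : estimator R n M, forall (sigma : R) (S : sample n PX sigma),
    0 < sigma <= sbar ->
    (max_risk S (F0 PX k L) e <= (C * rate_0 n M k)%:E)%E.
Proof.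
move=> L0 sbar0 alo0 ahi0.
pose lam : R := (16 * sbar ^+ 2 + 20 * L ^+ 2)^-1.
have lam0 : 0 < lam by rewrite invr_gt0 addr_gt0// mulr_gt0// exprn_gt0.
pose cc := cell_const alo (lam / 4).
have cc0 : 0 <= cc.
  rewrite /cc /cell_const mulr_ge0 ?expR_ge0// divr_ge0// subr_ge0 expR_le1.
  by rewrite oppr_le0 mulr_ge0 ?sqr_ge0// divr_ge0// ltW.
pose C1 := 16 * ahi ^+ 2 + 4 / lam * (1 + cc).
have C10 : 0 < C1.
  rewrite /C1 addr_gt0//; first by rewrite mulr_gt0// exprn_gt0.
  by rewrite mulr_gt0 ?divr_gt0//; lra.
exists (C1 + 4 * L ^+ 2); first by rewrite addr_gt0// mulr_gt0// exprn_gt0.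
move=> n M k PX n0 kM src; have /andP[k0 kM'] := kM.
pose J : finType := {c | c \in @occupied R n M k PX L alo}.
pose g (c : J) := flin (@cell_rep R n M k PX L alo (val c)).
have mg c : measurable_fun setT (g c) by exact: measurable_flin.
have gB c : \forall x \ae PX, `|g c x| <= L.
  by apply/fnormoo_leP; have [[_]] := cell_repP (valP c).
exists (ls_estimator n mg) => sigma S ss.
apply: ge_ereal_sup => _ /= [_ [theta thP <-] <-].
have thb : sparse_ball k PX L theta by [].
have mf := measurable_flin theta.
have /fnormoo_leP fB := thP.2.
pose s : J := Sub (cell n L alo theta) (cell_occupied n alo thb).
have bdd : (risk S (ls_estimator n mg) (flin theta) <= (4 * L ^+ 2)%:E)%E.
  exact: (ls_risk_bounded mg gB S mf s fB).
have risk_le := ls_risk_le mg n0 L0 (erefl lam) gB S ss mf s fB.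
have n0' : 0 < n%:R :> R by rewrite ltr0n.
have rate0 := l0_rate_ge0 R n kM.
have ln0 := ln_ratio_ge0 R kM.
case E : (risk S (ls_estimator n mg) (flin theta)) => [x| |]//; last first.
  by rewrite leNye.
  by move: bdd; rewrite E leye_eq.
move: bdd risk_le; rewrite E !lee_fin => bdd risk_le.
apply: le_Cmin1 => //; [exact: ltW|by rewrite mulr_ge0// sqr_ge0|].
apply: (le_trans risk_le).
have [repb repE] := cell_repP (valP s).
have h1 : sqnorm PX (flin theta \- g s) <= ahi ^+ 2 * (2 * k%:R / n%:R).
  by apply: (cell_approx (n := n) (k := k) (L := L) (alo := alo)).
have sumE : \sum_(i : J) expR (- (n%:R * lam / 4 * sqnorm PX (flin theta \- g i))) <=
    expR (k%:R * (ln (M%:R / k%:R) + cc)).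
  have l4 : 0 < lam / 4 by rewrite divr_gt0.
  have sc : \sum_(c in @occupied R n M k PX L alo) expR (- (n%:R * (lam / 4) *
      sqnorm PX (flin theta \- flin (@cell_rep R n M k PX L alo c)))) <=
      expR (k%:R * (ln (M%:R / k%:R) + cc)).
    by apply: (sum_cells (ahi := ahi)).
  rewrite (big_sub (@occupied R n M k PX L alo) (fun c => expR (- (n%:R * (lam / 4) *
    sqnorm PX (flin theta \- flin (@cell_rep R n M k PX L alo c)))))) in sc.
  apply: le_trans sc; apply: ler_sum => i _.
  by rewrite [n%:R * (lam / 4)]mulrA.
have lnE : ln (\sum_(i : J) expR (- (n%:R * lam / 4 * sqnorm PX (flin theta \- g i))))
    <= k%:R * (ln (M%:R / k%:R) + cc).
  rewrite -[leRHS]expRK ler_ln ?posrE ?expR_gt0//.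
  rewrite (bigD1 s)//=; apply: ltr_pwDl; first exact: expR_gt0.
  by apply: sumr_ge0 => i _; exact: expR_ge0.
have nl : 0 < 4 / (n%:R * lam) by rewrite divr_gt0// mulr_gt0.
have h2 := ler_wpM2l (ltW nl) lnE.
apply: (@le_trans _ _ (8 * (ahi ^+ 2 * (2 * k%:R / n%:R)) +
    4 / (n%:R * lam) * (k%:R * (ln (M%:R / k%:R) + cc)))).
  by rewrite lerD// ler_pM2l.
set l := ln (M%:R / k%:R) in ln0 *.
have kn0 : 0 <= k%:R / n%:R :> R by rewrite divr_ge0.
have -> : 8 * (ahi ^+ 2 * (2 * k%:R / n%:R)) = 16 * ahi ^+ 2 * 1 * (k%:R / n%:R).
  by ring.
have -> : 4 / (n%:R * lam) * (k%:R * (l + cc)) =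
    4 / lam * (l + cc) * (k%:R / n%:R).
  by field; rewrite !gt_eqF.
have -> : C1 * @l0_rate R n M k = C1 * (1 + l) * (k%:R / n%:R).
  by rewrite /l0_rate -/l; ring.
rewrite -mulrDl ler_wpM2r//.
have -> : C1 * (1 + l) = 16 * ahi ^+ 2 * (1 + l) + 4 / lam * ((1 + cc) * (1 + l)).
  by rewrite /C1; ring.
apply: lerD; apply: ler_wpM2l.
- by rewrite mulr_ge0// sqr_ge0.
- by rewrite lerDl.
- by rewrite divr_ge0// ltW.
rewrite -subr_ge0.
have -> : (1 + cc) * (1 + l) - (l + cc) = 1 + cc * l by ring.
by rewrite addr_ge0// mulr_ge0.
Qed.

(** * The net of an lq-ball *)

Section Rounding.
Context {R : realType} {M : nat} (PX : probability (M.-tuple R) R).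

(** Bias-variance decomposition for a two-point perturbation of mean zero. *)
Lemma sqnorm_mix (f h : M.-tuple R -> R) (Bf Bh p x1 x2 : R) :
  measurable_fun setT f -> measurable_fun setT h ->
  (\forall x \ae PX, `|f x| <= Bf) -> (\forall x \ae PX, `|h x| <= Bh) ->
  0 <= p <= 1 -> (1 - p) * x1 + p * x2 = 0 ->
  (1 - p) * sqnorm PX (fun x => f x + x1 * h x) +
    p * sqnorm PX (fun x => f x + x2 * h x) =
  sqnorm PX f + ((1 - p) * x1 ^+ 2 + p * x2 ^+ 2) * sqnorm PX h.
Proof.
move=> mf mh fB hB /andP[p0 p1] mean.
have p1' : 0 <= 1 - p by rewrite subr_ge0.
have mfh a : measurable_fun setT (fun x => f x + a * h x).
  by apply: measurable_funD => //; exact: measurable_funM.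
have fhB a : \forall x \ae PX, `|f x + a * h x| <= Bf + `|a| * Bh.
  move: fB hB; apply: filterS2 => x h1 h2.
  apply: (le_trans (ler_normD _ _)); rewrite lerD// normrM.
  exact: ler_wpM2l.
set w := (1 - p) * x1 ^+ 2 + p * x2 ^+ 2.
have w0 : 0 <= w by rewrite addr_ge0// mulr_ge0// sqr_ge0.
have comb (a b : R) (f1 f2 : M.-tuple R -> R) B1 B2 :
    0 <= a -> 0 <= b -> measurable_fun setT f1 -> measurable_fun setT f2 ->
    (\forall x \ae PX, `|f1 x| <= B1) -> (\forall x \ae PX, `|f2 x| <= B2) ->
    (a * sqnorm PX f1 + b * sqnorm PX f2)%:E =
    (\int[PX]_x (a * f1 x ^+ 2 + b * f2 x ^+ 2)%:E)%E.
  move=> a0 b0 m1 m2 b1 b2.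
  rewrite EFinD !EFinM -(sqintE m1 b1) -(sqintE m2 b2) /sqint.
  rewrite -!ge0_integralZl_EFin//; try exact: measurable_sqr;
    try by move=> x _; rewrite lee_fin sqr_ge0.
  rewrite -ge0_integralD//.
  - by move=> x _; rewrite -EFinM lee_fin mulr_ge0 ?sqr_ge0.
  - by apply: measurable_funeM; exact: measurable_sqr.
  - by move=> x _; rewrite -EFinM lee_fin mulr_ge0 ?sqr_ge0.
  - by apply: measurable_funeM; exact: measurable_sqr.
apply/EFin_inj; rewrite (comb _ _ _ _ _ _ p1' p0 (mfh x1) (mfh x2) (fhB x1) (fhB x2)).
rewrite -[sqnorm PX f]mul1r (comb _ _ _ _ _ _ ler01 w0 mf mh fB hB).
apply: eq_integral => x _; congr (_%:E); rewrite /w.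
have -> : (1 - p) * (f x + x1 * h x) ^+ 2 + p * (f x + x2 * h x) ^+ 2 =
  f x ^+ 2 + 2 * f x * h x * ((1 - p) * x1 + p * x2) +
  ((1 - p) * x1 ^+ 2 + p * x2 ^+ 2) * h x ^+ 2 by ring.
by rewrite mean mulr0 addr0 mul1r.
Qed.

End Rounding.

Section SignedIntegers.
Context {R : realType} (Z : nat).

(** Code for the integers of absolute value at most Z + 1; the code is
    injective, so that sums over codes are sums over integers. *)
Definition zcode : finType := option (bool * 'I_Z.+1).

Definition zval (o : zcode) : R :=
  if o is Some (b, z) then (-1) ^+ b * z.+1%:R else 0.

Definition zenc (b : bool) (m : nat) : zcode :=
  if m is m'.+1 then Some (b, inord m') else None.

Lemma zval_enc b m : (m <= Z.+1)%N -> zval (zenc b m) = (-1) ^+ b * m%:R.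
Proof.
case: m => [|m] mZ; first by rewrite /= mulr0.
by rewrite /= inordK.
Qed.

Lemma norm_zval_enc b m : (m <= Z.+1)%N -> `|zval (zenc b m)| = m%:R.
Proof. by move=> mZ; rewrite zval_enc// normrMsign ger0_norm. Qed.

(** Unbiased rounding of tau to a neighbouring integer.  The variance p (1 - p)
    is at most |tau| when |tau| < 1 and at most 1 otherwise, hence at most
    |tau|^q; similarly, rounding at most doubles |tau|^q on average. *)
Lemma round_scalar (q tau : R) : 0 < q <= 1 -> (Num.trunc `|tau| <= Z)%N ->
  exists p (o1 o2 : zcode), [/\ 0 <= p <= 1,
    (1 - p) * (tau - zval o1) + p * (tau - zval o2) = 0,
    (1 - p) * (tau - zval o1) ^+ 2 + p * (tau - zval o2) ^+ 2 <= `|tau| `^ q &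
    (1 - p) * `|zval o1| `^ q + p * `|zval o2| `^ q <= 2 * `|tau| `^ q].
Proof.
move=> /andP[q0 q1]; set a := `|tau|; set m := Num.trunc a => mZ.
have a0 : 0 <= a by exact: normr_ge0.
have /andP[ma am] := Num.Theory.truncn_itv a0.
rewrite -/m -natr1 in ma am.
set b := tau < 0.
have tauE : tau = (-1) ^+ b * a.
  exact: numEsign.
pose p := a - m%:R.
have sgn2 : ((-1) ^+ b) ^+ 2 = 1 :> R by rewrite sqrr_sign.
have v1 : zval (zenc b m) = (-1) ^+ b * m%:R.
  by apply: zval_enc; exact: leqW.
have v2 : zval (zenc b m.+1) = (-1) ^+ b * (m%:R + 1).
  by rewrite zval_enc// -natr1.
exists p, (zenc b m), (zenc b m.+1).
have p01 : 0 <= p <= 1 by rewrite /p; lra.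
split => //.
- by rewrite v1 v2 tauE -!mulrBr /p; ring.
- have -> : (1 - p) * (tau - zval (zenc b m)) ^+ 2 +
     p * (tau - zval (zenc b m.+1)) ^+ 2 = p * (1 - p).
    by rewrite v1 v2 tauE -!mulrBr !exprMn sgn2 /p; ring.
  have [m0|m0] := posnP m.
    have pa : p = a by rewrite /p m0 subr0.
    have [a00|a00] := eqVneq a 0; first by rewrite pa a00 mul0r powR_ge0.
    have agt : 0 < a by rewrite lt_neqAle eq_sym a00.
    have a1 : a <= 1 by move: am; rewrite m0; lra.
    apply: (@le_trans _ _ a); last by apply: ger1_powR => //; rewrite agt.
    by rewrite pa; have := mulr_ge0 a0 a0; lra.
  have m1 : 1 <= m%:R :> R by rewrite ler1n.
  apply: (@le_trans _ _ 1); first by have := sqr_ge0 p; case/andP: p01; nra.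
  have -> : 1 = 1 `^ q :> R by rewrite powR1.
  by apply: ge0_ler_powR; rewrite ?nnegrE//; [exact: ltW|lra].
- rewrite (norm_zval_enc _ (leqW mZ)) (@norm_zval_enc _ m.+1)//.
  have [m0|m0] := posnP m.
    rewrite m0 powR0 ?gt_eqF// mulr0 add0r powR1 mulr1.
    have pa : p = a by rewrite /p m0 subr0.
    have [a00|a00] := eqVneq a 0.
      by rewrite pa a00 mulr_ge0// powR_ge0.
    have agt : 0 < a by rewrite lt_neqAle eq_sym a00.
    have a1 : a <= 1 by move: am; rewrite m0; lra.
    have : a <= a `^ q by apply: ger1_powR => //; rewrite agt.
    by rewrite pa; lra.
  have m1 : 1 <= m%:R :> R by rewrite ler1n.
  have h1 : m%:R `^ q <= a `^ q.
    by apply: ge0_ler_powR; rewrite ?nnegrE//; exact: ltW.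
  have h2 : m.+1%:R `^ q <= 2 * a `^ q.
    apply: (@le_trans _ _ (2 `^ q * a `^ q)).
      rewrite -powRM//; apply: ge0_ler_powR; rewrite ?nnegrE ?mulr_ge0//.
        exact: ltW.
      by rewrite -natr1; lra.
    rewrite ler_wpM2r ?powR_ge0// -[leRHS](@powRr1 _ 2)//.
    by apply: ler_powR => //; lra.
  case/andP: p01 => p0 p1; have p1' : 0 <= 1 - p by lra.
  have := ler_wpM2l p1' h1; have := ler_wpM2l p0 h2.
  by have := mulr_ge0 p1' (powR_ge0 a q); lra.
Qed.

Lemma sum_inv_sqr (N : nat) : \sum_(z < N) (z.+1%:R ^+ 2)^-1 <= 2 :> R.
Proof.
have h : \sum_(z < N.+1) (z.+1%:R ^+ 2)^-1 <= 2 - N.+1%:R^-1 :> R.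
  elim: N => [|N IH]; first by rewrite big_ord_recr big_ord0/= add0r; lra.
  rewrite big_ord_recr/=; apply: (le_trans (lerD IH (lexx _))).
  rewrite -[N.+2%:R]natr1; set x : R := N.+1%:R.
  have x0 : 0 < x by rewrite ltr0n.
  have x1 : 0 < x + 1 by rewrite addr_gt0.
  rewrite -subr_ge0.
  have -> : 2 - (x + 1)^-1 - (2 - x^-1 + ((x + 1) ^+ 2)^-1) =
    (x * (x + 1) ^+ 2)^-1 by field; rewrite !gt_eqF.
  by rewrite invr_ge0 mulr_ge0 ?sqr_ge0// ltW.
apply: (@le_trans _ _ (\sum_(z < N.+1) (z.+1%:R ^+ 2)^-1)).
  by rewrite big_ord_recr/= lerDl invr_ge0 sqr_ge0.
by apply: (le_trans h); rewrite gerBl invr_ge0.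
Qed.

(** The weight of a nonzero integer z is at most exp(-a) / z^2, because
    ln z <= |z|^q / q. *)
Lemma sum_zcode_weight (q a : R) : 0 < q -> 0 <= a ->
  \sum_(o : zcode) expR (- ((a + 2 / q) * `|zval o| `^ q)) <= 1 + 4 * expR (- a).
Proof.
move=> q0 a0; rewrite (bigD1 None)//=; apply: lerD.
  by rewrite expR_le1 oppr_le0 mulr_ge0 ?powR_ge0// addr_ge0// divr_ge0// ltW.
rewrite (reindex_omap Some id)/=; last by case.
under eq_bigl do rewrite eqxx.
pose G (b : bool) (z : 'I_Z.+1) : R :=
  expR (- ((a + 2 / q) * `|(-1) ^+ b * z.+1%:R| `^ q)).
rewrite (eq_bigr (fun o => G o.1 o.2)); last by case.
rewrite -(pair_bigA _ G) /G /=.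
have H (b : bool) : \sum_(z < Z.+1) expR (- ((a + 2 / q) *
    `|(-1) ^+ b * z.+1%:R| `^ q)) <= 2 * expR (- a).
  apply: (@le_trans _ _ (\sum_(z < Z.+1) expR (- a) * (z.+1%:R ^+ 2)^-1)).
    apply: ler_sum => z _; rewrite normrMsign ger0_norm//.
    set x : R := z.+1%:R.
    have x1 : 1 <= x by rewrite ler1n.
    have x0 : 0 < x by lra.
    have xq1 : 1 <= x `^ q.
      have -> : 1 = 1 `^ q :> R by rewrite powR1.
      by apply: ge0_ler_powR; rewrite ?nnegrE//; exact: ltW.
    have lnx : q * ln x <= x `^ q.
      by rewrite -ln_powR; apply/ltW/ln_sublinear; exact: powR_gt0.
    have -> : (x ^+ 2)^-1 = expR (- (2 / q) * (q * ln x)).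
      have -> : - (2 / q) * (q * ln x) = - (2%:R * ln x) by field; rewrite gt_eqF.
      by rewrite expRN expRM_natl lnK.
    rewrite -expRD ler_expR.
    have q2 : 0 <= 2 / q by rewrite divr_ge0// ltW.
    have := ler_wpM2l q2 lnx; have := ler_wpM2l a0 xq1.
    by rewrite mulr1; lra.
  by rewrite -mulr_sumr mulrC ler_wpM2r ?expR_ge0// sum_inv_sqr.
by rewrite big_bool/=; have := H true; have := H false; lra.
Qed.

End SignedIntegers.
Arguments zval {R Z} o.
Arguments round_scalar {R Z q tau}.

Section RoundVector.
Context {R : realType} {M Z : nat} (PX : probability (M.-tuple R) R).
Context (L0 q dl : R) (theta : 'rV[R]_M).
Hypothesis L0_gt0 : 0 < L0.
Hypothesis q01 : 0 < q <= 1.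
Hypothesis dl_gt0 : 0 < dl.
Hypothesis bf : bounded_features PX L0.
Hypothesis theta_Z : forall j, (Num.trunc `|theta ord0 j / dl| <= Z)%N.

Let err (c : {ffun 'I_M -> zcode Z}) (s : seq 'I_M) : 'rV[R]_M :=
  \row_j (if j \in s then theta ord0 j - dl * zval (c j) else 0).

Let B := L0 ^+ 2 * dl ^+ 2.

(** The coordinates are rounded one after the other. Rounding a coordinate up
    or down with the probabilities that keep its mean adds, on average, its
    variance to the squared error, as the cross term vanishes; so one of the
    two choices does not increase the potential by more than the average. *)
Lemma round_seq (s : seq 'I_M) : uniq s ->
  exists c : {ffun 'I_M -> zcode Z},
    sqnorm PX (flin (err c s)) + B * \sum_(j <- s) `|zval (c j)| `^ q <=
    3 * B * \sum_(j <- s) `|theta ord0 j / dl| `^ q.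
Proof.
elim: s => [_|j s IH].
  exists [ffun=> None]; rewrite !big_nil !mulr0 addr0.
  rewrite (_ : flin _ = cst 0) /sqnorm /sqint.
    by under eq_integral do rewrite expr0n /=; rewrite integral0.
  apply/funext => x; rewrite (_ : err _ _ = 0) ?flin0//.
  by apply/rowP => i; rewrite !mxE.
move=> /= /andP[js us]; have [c hc] := IH us.
have [pr [u1 [u2 [p01 mean var pen]]]] := round_scalar q01 (theta_Z j).
set tau := theta ord0 j / dl in mean var pen.
pose upd o : {ffun 'I_M -> zcode Z} := [ffun i => if i == j then o else c i].
have B0 : 0 < B by rewrite mulr_gt0// exprn_gt0.
pose x (o : zcode Z) : R := dl * (tau - zval o).
have errE (o : zcode Z) : flin (err (upd o) (j :: s)) =
    (fun y => flin (err c s) y + x o * tnth y j).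
  apply/funext => y; rewrite /flin (bigD1 j)//= [in RHS](bigD1 j)//= !mxE.
  rewrite mem_head (negbTE js) mul0r add0r addrC; congr (_ + _).
    apply: eq_bigr => i ij; rewrite !mxE in_cons (negbTE ij)/= /upd ffunE.
    by rewrite (negbTE ij).
  rewrite /upd ffunE eqxx /x /tau; congr (_ * _).
  by rewrite mulrBr mulrCA mulfV ?gt_eqF// mulr1.
have sumE (o : zcode Z) : \sum_(i <- j :: s) `|zval (upd o i)| `^ q =
    `|zval o| `^ q + \sum_(i <- s) `|zval (c i)| `^ q.
  rewrite big_cons /upd ffunE eqxx; congr (_ + _).
  apply: eq_big_seq => i si; rewrite ffunE.
  by case: eqP => // ij; move: js; rewrite -ij si.
pose Phi (o : zcode Z) := sqnorm PX (flin (err (upd o) (j :: s))) +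
  B * \sum_(i <- j :: s) `|zval (upd o i)| `^ q.
suff : exists o, Phi o <= 3 * B * \sum_(i <- j :: s) `|theta ord0 i / dl| `^ q.
  by move=> [w ho]; exists (upd w).
have mtj : measurable_fun setT (fun y : M.-tuple R => tnth y j).
  exact: measurable_tnth.
have /fnormoo_leP tB := bf j.
have sq1 : sqnorm PX (fun y => tnth y j) <= L0 ^+ 2 by exact: sqnorm_le.
have mean' : (1 - pr) * x u1 + pr * x u2 = 0.
  by rewrite /x !(mulrCA _ dl) -mulrDr mean mulr0.
have mix := sqnorm_mix (measurable_flin (err c s)) mtj
  (ae_bounded_flin _ bf) tB p01 mean'.
have var' : (1 - pr) * x u1 ^+ 2 + pr * x u2 ^+ 2 <= dl ^+ 2 * `|tau| `^ q.
  by rewrite /x !exprMn !(mulrCA _ (dl ^+ 2)) -mulrDr ler_pM2l ?exprn_gt0.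
have avg : (1 - pr) * Phi u1 + pr * Phi u2 <=
    3 * B * \sum_(i <- j :: s) `|theta ord0 i / dl| `^ q.
  rewrite /Phi !errE !sumE big_cons -/tau.
  set s1 := sqnorm PX (fun y => _ + x u1 * _) in mix *.
  set s2 := sqnorm PX (fun y => _ + x u2 * _) in mix *.
  set v := (1 - pr) * x u1 ^+ 2 + pr * x u2 ^+ 2 in mix var'.
  have v0 : 0 <= v.
    by rewrite /v; case/andP: p01 => p0 p1; rewrite addr_ge0// mulr_ge0 ?sqr_ge0// subr_ge0.
  have h1 : v * sqnorm PX (fun y => tnth y j) <= B * `|tau| `^ q.
    rewrite /B [L0 ^+ 2 * _]mulrC -mulrA [L0 ^+ 2 * _]mulrC mulrA.
    by apply: ler_pM => //; exact: sqnorm_ge0.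
  have h2 := ler_wpM2l (ltW B0) pen.
  set S := \sum_(i <- s) _ in hc *; set T := \sum_(i <- s) _ in hc *.
  set z1 := `|zval u1| `^ q in h2 *; set z2 := `|zval u2| `^ q in h2 *.
  set W := v * _ in mix h1.
  have -> : (1 - pr) * (s1 + B * (z1 + S)) + pr * (s2 + B * (z2 + S)) =
    ((1 - pr) * s1 + pr * s2) + B * ((1 - pr) * z1 + pr * z2) + B * S by ring.
  rewrite mix; move: hc h1 h2; clear -err B L0_gt0 q01 dl_gt0 bf theta_Z; lra.
have [h|h] := leP (Phi u1) (3 * B * \sum_(i <- j :: s) `|theta ord0 i / dl| `^ q).
  by exists u1.
exists u2; rewrite leNgt; apply/negP => h'.
case/andP: p01 => p0 p1.
move: avg; rewrite leNgt => /negP; apply.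
set T := 3 * B * _ in h h' *.
have [->|pn0] := eqVneq pr 0; first by rewrite subr0 mul1r mul0r addr0.
have pp : 0 < pr by rewrite lt_neqAle eq_sym pn0.
have e1 : (1 - pr) * T <= (1 - pr) * Phi u1 by rewrite ler_wpM2l ?subr_ge0// ltW.
have e2 : pr * T < pr * Phi u2 by rewrite ltr_pM2l.
move: e1 e2; clear -err B L0_gt0 q01 dl_gt0 bf theta_Z; lra.
Qed.

Definition zvec (c : {ffun 'I_M -> zcode Z}) : 'rV[R]_M :=
  \row_j (dl * zval (c j)).

Lemma round_vector (K : R) : \sum_j `|theta ord0 j / dl| `^ q <= K ->
  exists c : {ffun 'I_M -> zcode Z},
    sqnorm PX (flin theta \- flin (zvec c)) <= 3 * B * K /\
    \sum_j `|zval (c j) : R| `^ q <= 3 * K.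
Proof.
move=> hK; have [c hc] := round_seq (index_enum_uniq 'I_M).
exists c.
have B0 : 0 < B by rewrite mulr_gt0// exprn_gt0.
have S0 : 0 <= \sum_j `|zval (c j) : R| `^ q.
  by apply: sumr_ge0 => j _; exact: powR_ge0.
have E : flin (err c (index_enum 'I_M)) = flin theta \- flin (zvec c).
  apply/funext => x /=; rewrite -flinB; congr (flin _ x).
  by apply/rowP => j; rewrite !mxE mem_index_enum.
move: hc; rewrite E => hc.
have hB : 3 * B * \sum_j `|theta ord0 j / dl| `^ q <= 3 * B * K.
  by rewrite ler_pM2l// mulr_gt0.
split.
  have := mulr_ge0 (ltW B0) S0; move: hc hB; clear -err B L0_gt0 q01 dl_gt0 bf theta_Z; lra.
rewrite -(ler_pM2l B0).
have := sqnorm_ge0 PX (flin theta \- flin (zvec c)).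
move: hc hB; clear -err B L0_gt0 q01 dl_gt0 bf theta_Z; lra.
Qed.

End RoundVector.

(** Markov's inequality for the weights exp (- (s + 2 / q) |z|^q), with
    exp s = 1 + M / K chosen so that M coordinates contribute O(K). *)
Lemma card_zcode_le (R : realType) (M Z : nat) (q K : R) : 0 < q -> 0 < K ->
  #|[pred c : {ffun 'I_M -> zcode Z} | \sum_j `|zval (c j) : R| `^ q <= 3 * K]|%:R
  <= expR (K * (3 * ln (1 + M%:R / K) + 6 / q + 4)).
Proof.
move=> q0 K0.
set A := [pred c | _].
have MK0 : 0 <= M%:R / K by rewrite divr_ge0// ltW.
have MK1 : 0 < 1 + M%:R / K by lra.
pose s := ln (1 + M%:R / K).
have s0 : 0 <= s by apply: ln_ge0; lra.
pose a := s + 2 / q.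
have q2 : 0 <= 2 / q by rewrite divr_ge0// ltW.
have a0 : 0 <= a by rewrite addr_ge0.
have : \sum_(c in A) expR (- (3 * K * a)) <=
    expR (#|'I_M|%:R * (4 * expR (- s))).
  apply: (@sum_ffun_le_expR _ _ _ _ _
    (fun _ o => expR (- (a * `|zval o| `^ q)))).
  - by move=> i j; exact: expR_ge0.
  - move=> c; rewrite inE => h; rewrite -expR_sum ler_expR sumrN lerN2.
    by rewrite -mulr_sumr [leRHS]mulrC ler_wpM2l.
  - by move=> _; exact: sum_zcode_weight.
rewrite sumr_const card_ord -[X in X <= _ -> _]mulr_natl => h.
have e0 := expR_gt0 (3 * K * a).
rewrite -(ler_pM2r (expR_gt0 (- (3 * K * a)))).
apply: (le_trans h); rewrite -expRD ler_expR expRN lnK ?posrE//.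
have : M%:R * (1 + M%:R / K)^-1 <= K.
  rewrite ler_pdivrMr// mulrDr mulr1 mulrCA mulfV ?gt_eqF// mulr1.
  by rewrite lerDr ltW.
have -> : K * (3 * ln (1 + M%:R / K) + 6 / q + 4) - 3 * K * a = 4 * K.
  by rewrite /a -/s; field; rewrite gt_eqF.
move=> h2; rewrite mulrCA; by rewrite ler_pM2l.
Qed.

(** As the features are bounded, this comparison of norms bounds the functions
    of an lq-ball. *)
Lemma lnorm1_le (R : realType) (M : nat) (q : R) (a : 'I_M -> R) :
  0 < q <= 1 -> (forall j, 0 <= a j) ->
  \sum_j a j <= (\sum_j a j `^ q) `^ q^-1.
Proof.
move=> /andP[q0 q1] a0; set S := \sum_j a j `^ q.
have S0 : 0 <= S by apply: sumr_ge0 => j _; exact: powR_ge0.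
have aS j : a j <= S `^ q^-1.
  rewrite -[leLHS]powRr1// -(mulfV (lt0r_neq0 q0)) powRrM.
  apply: ge0_ler_powR; rewrite ?invr_ge0 ?nnegrE ?powR_ge0 ?(ltW q0)//.
  by rewrite /S (bigD1 j)//= lerDl sumr_ge0// => i _; exact: powR_ge0.
have [SE|Sn0] := eqVneq S 0.
  rewrite big1 ?powR_ge0// => j _; apply/eqP; rewrite eq_le a0 andbT.
  by apply: (le_trans (aS j)); rewrite SE powR0// invr_eq0 gt_eqF.
have Sgt : 0 < S by rewrite lt_neqAle eq_sym Sn0.
apply: (@le_trans _ _ (\sum_j a j `^ q * (S `^ q^-1) `^ (1 - q))).
  apply: ler_sum => j _.
  have aE : a j `^ q * a j `^ (1 - q) = a j.
    have [->|an0] := eqVneq (a j) 0; first by rewrite powR0 ?gt_eqF// mul0r.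
    rewrite -powRD ?an0 ?implybT//.
    by rewrite (_ : q + (1 - q) = 1) ?powRr1//; ring.
  rewrite -[leLHS]aE; apply: ler_wpM2l; first exact: powR_ge0.
  by apply: ge0_ler_powR; rewrite ?nnegrE ?powR_ge0 ?subr_ge0.
rewrite -mulr_suml -/S -powRrM.
rewrite -[X in X * _ <= _]powRr1// -powRD ?Sn0 ?implybT//.
by rewrite (_ : 1 + q^-1 * (1 - q) = q^-1)//; field; rewrite gt_eqF.
Qed.

Definition lq_level {R : realType} (q : R) (n M : nat) : R :=
  1 + ln (1 + M%:R / n%:R `^ (q / 2)).

(** The rate lq_rate without its dependence on t and sigma: it has the same
    order wherever lq_rate is meaningful, and is defined everywhere. *)
Definition lq_order {R : realType} (q : R) (n M : nat) : R :=
  (lq_level q n M / n%:R) `^ (1 - q / 2).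

Lemma lq_level_ge1 (R : realType) (q : R) (n M : nat) : 1 <= lq_level q n M.
Proof.
by rewrite /lq_level lerDl ln_ge0// lerDl divr_ge0// powR_ge0.
Qed.

(** With mesh dl and K = (t / dl)^q, the approximation error is of order
    dl^2 K and the complexity term of order K (1 + ln (1 + M / K)) / n; the
    choice dl^2 = lq_level / n makes them equal. *)
Lemma lq_upper (R : realType) (q t L0 sbar : R) :
  0 < q <= 1 -> 0 < t -> 0 < L0 -> 0 < sbar ->
  exists2 C, 0 < C &
  forall (n M : nat) (PX : probability (M.-tuple R) R),
    (0 < n)%N -> bounded_features PX L0 ->
  exists e : estimator R n M,
  forall (L sigma : R) (S : sample n PX sigma), 0 < sigma <= sbar ->
    (max_risk S (Fq PX q t L) e <= (C * Num.min 1 (lq_order q n M))%:E)%E.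
Proof.
move=> q01 t0 L00 sbar0; have /andP[q0 q1] := q01.
have tq0 : 0 < t `^ q by exact: powR_gt0.
pose B : R := L0 * t * 3 `^ q^-1.
have B0 : 0 < B by rewrite !mulr_gt0// powR_gt0.
pose lam : R := (16 * sbar ^+ 2 + 20 * B ^+ 2)^-1.
have lam0 : 0 < lam by rewrite invr_gt0 addr_gt0// mulr_gt0// exprn_gt0.
pose C0 : R := 3 * (ln (1 + (t `^ q)^-1) + 2) + 6 / q + 4.
have lnt : 0 <= ln (1 + (t `^ q)^-1).
  by apply: ln_ge0; rewrite lerDl invr_ge0 ltW.
have q6 : 0 < 6 / q by rewrite divr_gt0.
have C00 : 0 < C0 by rewrite /C0; move: lnt q6; clear; lra.
pose C1 := t `^ q * (24 * L0 ^+ 2 + 4 / lam * C0).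
have C10 : 0 < C1.
  by rewrite mulr_gt0// addr_gt0// mulr_gt0 ?divr_gt0// exprn_gt0.
exists (C1 + 4 * B ^+ 2); first by rewrite addr_gt0// mulr_gt0// exprn_gt0.
move=> n M PX n0 bf.
have n0' : 0 < n%:R :> R by rewrite ltr0n.
set l := lq_level q n M.
have l1 : 1 <= l by exact: lq_level_ge1.
have l0 : 0 < l by apply: lt_le_trans l1.
pose dl : R := Num.sqrt (l / n%:R).
have dl0 : 0 < dl by rewrite sqrtr_gt0 divr_gt0.
have dl2 : dl ^+ 2 = l / n%:R by rewrite sqr_sqrtr// divr_ge0// ltW.
have dlq : dl `^ q = (l / n%:R) `^ (q / 2).
  rewrite -dl2 -powR_mulrn ?(ltW dl0)// -powRrM; congr (_ `^ _).
  by field.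
have dlq0 : 0 < dl `^ q by exact: powR_gt0.
have orderE : lq_order q n M = dl ^+ 2 / dl `^ q.
  rewrite /lq_order -/l dlq dl2 powRB ?powRr1 ?divr_ge0 ?(ltW l0)//.
  by rewrite implybE mulf_neq0 ?orbT// ?invr_eq0 gt_eqF.
pose K : R := (t / dl) `^ q.
have KE : K = t `^ q / dl `^ q.
  by rewrite /K powRM ?invr_ge0 ?(ltW dl0) ?(ltW t0)// -powR_inv1 ?(ltW dl0)//
     -powRrM mulN1r powRN.
have K0 : 0 < K by rewrite KE divr_gt0.
pose Z := Num.trunc (t / dl).
pose A : {pred {ffun 'I_M -> zcode Z}} :=
  [pred c : {ffun 'I_M -> zcode Z} | \sum_j `|zval (c j) : R| `^ q <= 3 * K].
pose J : finType := {c | c \in A}.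
pose g (c : J) := flin (zvec dl (val c)).
have mg c : measurable_fun setT (g c) by exact: measurable_flin.
have gB c : \forall x \ae PX, `|g c x| <= B.
  apply: filterS (ae_bounded_flin (zvec dl (val c)) bf) => x hx.
  apply: (le_trans hx); rewrite /B -mulrA ler_pM2l//.
  have -> : \sum_j `|zvec dl (val c) ord0 j| = dl * \sum_j `|zval (val c j) : R|.
    rewrite mulr_sumr; apply: eq_bigr => j _.
    by rewrite mxE normrM (gtr0_norm dl0).
  have cA : \sum_j `|zval (val c j) : R| `^ q <= 3 * K by have := valP c.
  apply: (@le_trans _ _ (dl * (3 * K) `^ q^-1)).
    rewrite ler_pM2l//; apply: (le_trans (lnorm1_le q01 (fun=> normr_ge0 _))).
    apply: ge0_ler_powR; rewrite ?invr_ge0 ?nnegrE ?(ltW q0)//.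
    - by apply: sumr_ge0 => j _; exact: powR_ge0.
    - by rewrite mulr_ge0// ltW.
  have tdl0 : 0 <= t / dl by rewrite divr_ge0// ltW.
  have -> : (3 * K) `^ q^-1 = 3 `^ q^-1 * (t / dl).
    by rewrite powRM ?(ltW K0)// /K -powRrM mulfV ?gt_eqF// powRr1.
  by rewrite mulrCA [dl * _]mulrC divfK ?gt_eqF// mulrC.
exists (ls_estimator n mg) => L sigma S ss.
apply: ge_ereal_sup => _ /= [_ [theta thP <-] <-].
have mf := measurable_flin theta.
have hq : \sum_j `|theta ord0 j| `^ q <= t `^ q.
  by rewrite -lqnorm_leP ?(ltW t0)//; exact: thP.1.
have fB : \forall x \ae PX, `|flin theta x| <= B.
  apply: filterS (ae_bounded_flin theta bf) => x hx.
  apply: (le_trans hx); rewrite /B -mulrA ler_pM2l//.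
  apply: (le_trans (lnorm1_le q01 (fun=> normr_ge0 _))).
  apply: (@le_trans _ _ t).
    exact: thP.1.
  rewrite ler_peMr ?(ltW t0)//.
  rewrite -[leLHS](powRr0 (3 : R)); apply: ler_powR; first by rewrite ler1n.
  by rewrite invr_ge0 ltW.
have thj j : `|theta ord0 j| <= t.
  have h : `|theta ord0 j| `^ q <= t `^ q.
    apply: le_trans hq; rewrite (bigD1 j)//= lerDl.
    by apply: sumr_ge0 => i _; exact: powR_ge0.
  rewrite -[leLHS]powRr1// -[leRHS]powRr1 ?(ltW t0)// -(mulfV (lt0r_neq0 q0)) !powRrM.
  by apply: ge0_ler_powR; rewrite ?nnegrE ?powR_ge0 ?invr_ge0 ?(ltW q0).
have thn j : `|theta ord0 j / dl| = `|theta ord0 j| / dl.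
  by rewrite normrM normfV (gtr0_norm dl0).
have thZ j : (Num.trunc `|theta ord0 j / dl| <= Z)%N.
  by apply: le_truncn; rewrite thn ler_pM2r ?invr_gt0.
have thK : \sum_j `|theta ord0 j / dl| `^ q <= K.
  rewrite KE (eq_bigr (fun j => `|theta ord0 j| `^ q / dl `^ q)).
    by rewrite -mulr_suml ler_pM2r ?invr_gt0.
  move=> j _; rewrite thn powRM ?invr_ge0 ?(ltW dl0)//.
  by rewrite -powR_inv1 ?(ltW dl0)// -powRrM mulN1r powRN.
have [c [capp cA]] := round_vector L00 q01 dl0 bf thZ thK.
pose s : J := Sub c cA.
have bdd : (risk S (ls_estimator n mg) (flin theta) <= (4 * B ^+ 2)%:E)%E.
  exact: (ls_risk_bounded mg gB S mf s fB).
have risk_le := ls_risk_le mg n0 B0 (erefl lam) gB S ss mf s fB.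
case E : (risk S (ls_estimator n mg) (flin theta)) => [x| |]//; last first.
  by rewrite leNye.
  by move: bdd; rewrite E leye_eq.
move: bdd risk_le; rewrite E !lee_fin => bdd risk_le.
have order0 : 0 <= lq_order q n M by exact: powR_ge0.
apply: le_Cmin1 => //; [exact: ltW|by rewrite mulr_ge0// sqr_ge0|].
apply: (le_trans risk_le).
have nl : 0 < 4 / (n%:R * lam) by rewrite divr_gt0// mulr_gt0.
have lnS : ln (\sum_(i : J) expR (- (n%:R * lam / 4 * sqnorm PX (flin theta \- g i))))
    <= K * (3 * ln (1 + M%:R / K) + 6 / q + 4).
  rewrite -[leRHS]expRK ler_ln ?posrE ?expR_gt0//.
    apply: le_trans (card_zcode_le M Z q0 K0).
    apply: (@le_trans _ _ (\sum_(i : J) 1)).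
      apply: ler_sum => i _; rewrite expR_le1 oppr_le0 mulr_ge0 ?sqnorm_ge0//.
      by rewrite divr_ge0// mulr_ge0// ltW.
    by rewrite -(big_sub A (fun=> 1)) sumr_const.
  rewrite (bigD1 s)//=; apply: ltr_pwDl; first exact: expR_gt0.
  by apply: sumr_ge0 => i _; exact: expR_ge0.
have lnK_le : ln (1 + M%:R / K) <= (ln (1 + (t `^ q)^-1) + 2) * l.
  pose u : R := M%:R / n%:R `^ (q / 2).
  have u0 : 0 <= u by rewrite divr_ge0// powR_ge0.
  have lE : l = 1 + ln (1 + u) by [].
  have lq : l `^ (q / 2) <= l.
    by apply: ler1_powR => //; move: q1; clear; lra.
  have MKE : M%:R / K = (t `^ q)^-1 * u * l `^ (q / 2).
    rewrite KE dlq powRM ?invr_ge0 ?(ltW l0)// -(powR_inv1 (ltW n0')) -powRrM.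
    rewrite mulN1r powRN /u; field.
    by rewrite !gt_eqF// powR_gt0.
  have a0 : 0 <= (t `^ q)^-1 by rewrite invr_ge0 ltW.
  apply: (@le_trans _ _ (ln ((1 + (t `^ q)^-1) * (1 + u) * l))).
    rewrite ler_ln ?posrE.
    - rewrite MKE; apply: (@le_trans _ _ (1 + (t `^ q)^-1 * u * l)).
        by rewrite lerD2l ler_wpM2l// mulr_ge0.
      rewrite -subr_ge0.
      have -> : (1 + (t `^ q)^-1) * (1 + u) * l - (1 + (t `^ q)^-1 * u * l) =
         (l - 1) + (t `^ q)^-1 * l + u * l by ring.
      apply: addr_ge0; last by rewrite mulr_ge0// ltW.
      by apply: addr_ge0; [rewrite subr_ge0|rewrite mulr_ge0// ltW].
    - by rewrite ltr_pwDl// divr_ge0// ltW.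
    - by apply: mulr_gt0 => //; apply: mulr_gt0; rewrite ltr_pwDl.
  have p1 : 0 < 1 + (t `^ q)^-1 by rewrite ltr_pwDl.
  have p2 : 0 < 1 + u by rewrite ltr_pwDl.
  rewrite !lnM ?posrE ?mulr_gt0//.
  have ll : ln l <= l by apply/ltW/ln_sublinear.
  have luE : ln (1 + u) = l - 1 by rewrite lE addrAC subrr add0r.
  rewrite luE; have := ler_wpM2l lnt l1; move: ll l1; clear; lra.
have dK : dl ^+ 2 * K = t `^ q * lq_order q n M.
  by rewrite orderE KE; ring.
have h2 := ler_wpM2l (ltW nl) lnS.
apply: (@le_trans _ _ (8 * (3 * (L0 ^+ 2 * dl ^+ 2) * K) +
   4 / (n%:R * lam) * (K * (3 * ln (1 + M%:R / K) + 6 / q + 4)))).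
  by apply: lerD; [rewrite ler_pM2l|exact: h2].
have h3 : 3 * ln (1 + M%:R / K) + 6 / q + 4 <= C0 * l.
  have : 6 / q <= 6 / q * l by rewrite ler_peMr// ltW.
  move: lnK_le l1; rewrite /C0; clear; nra.
have nK : K / n%:R = dl ^+ 2 * K / l.
  by rewrite dl2; field; rewrite !gt_eqF.
have -> : 4 / (n%:R * lam) * (K * (3 * ln (1 + M%:R / K) + 6 / q + 4)) =
  4 / lam * (3 * ln (1 + M%:R / K) + 6 / q + 4) * (K / n%:R).
  by field; rewrite !gt_eqF.
have X0 : 0 <= dl ^+ 2 * K by rewrite mulr_ge0 ?sqr_ge0// ltW.
have h4 : 4 / lam * (3 * ln (1 + M%:R / K) + 6 / q + 4) * (K / n%:R) <=
   4 / lam * C0 * (dl ^+ 2 * K).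
  rewrite nK -[leLHS]mulrA -[leRHS]mulrA.
  apply: ler_wpM2l; first by rewrite divr_ge0// ltW.
  have -> : C0 * (dl ^+ 2 * K) = C0 * l * (dl ^+ 2 * K / l).
    by field; rewrite gt_eqF.
  by apply: ler_wpM2r => //; rewrite divr_ge0// ltW.
apply: (le_trans (lerD (lexx _) h4)).
rewrite le_eqVlt; apply/orP; left; apply/eqP.
have -> : C1 * lq_order q n M = (24 * L0 ^+ 2 + 4 / lam * C0) * (dl ^+ 2 * K).
  by rewrite dK /C1; ring.
by ring.
Qed.

(** * Lower bounds by a change of measure *)

Section LikelihoodMoments.
Context {R : realType} {M : nat} (PX : probability (M.-tuple R) R).
Context (sigma : R) (f : M.-tuple R -> R).
Hypothesis sigma_neq0 : sigma != 0.
Hypothesis mf : measurable_fun setT f.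

Lemma integral_lik_ratio :
  (\int[PX]_x \int[gauss_law sigma]_y
     (lik_ratio sigma f (x, (cst 0 x + y)%R))%:E = 1)%E.
Proof.
transitivity (\int[PX]_x (cst 1%E x : \bar R))%E; last first.
  by rewrite integral_cst// [X in (_ * X)%E]probability_setT mule1.
apply: eq_integral => x _ /=.
have := @integral_gauss_shift R sigma (f x) (cst 1) sigma_neq0
  (measurable_cst _) (fun=> ler01).
rewrite -[X in X = _ -> _]/(\int[gauss_law sigma]_y (cst 1%:E y))%E.
rewrite integral_cst// [X in (_ * X)%E]probability_setT mule1 => E.
rewrite [RHS]E; apply: eq_integral => y _.
by rewrite /lik_ratio /= add0r mul1r.
Qed.

Lemma integral_lik_ratio_sqr :
  (\int[PX]_x \int[gauss_law sigma]_y
     (lik_ratio sigma f (x, (cst 0 x + y)%R) ^+ 2)%:E =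
   \int[PX]_x (expR (f x ^+ 2 / sigma ^+ 2))%:E)%E.
Proof.
apply: eq_integral => x _ /=.
have := @integral_gauss_shift R sigma (2 * f x) (cst (expR (f x ^+ 2 / sigma ^+ 2)))
  sigma_neq0 (measurable_cst _) (fun=> expR_ge0 _).
rewrite -[X in X = _ -> _]/(\int[gauss_law sigma]_y (cst (expR (f x ^+ 2 / sigma ^+ 2))%:E y))%E.
rewrite integral_cst// [X in (_ * X)%E]probability_setT mule1 => E.
rewrite [RHS]E; apply: eq_integral => y _.
rewrite /lik_ratio /= add0r -expRM_natl -expRD; congr (expR _)%:E.
by field.
Qed.

Definition chi2_const (s0 B : R) : R := expR (B ^+ 2 / s0 ^+ 2) / s0 ^+ 2.

(** exp z <= 1 + z exp z, so that the chi-square distance is controlled by the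
    L2-norm of f; boundedness of f is used for the factor exp z. *)
Lemma lik_ratio_sqr_le (s0 B : R) : 0 < s0 <= sigma ->
  (\forall x \ae PX, `|f x| <= B) ->
  (\int[PX]_x (expR (f x ^+ 2 / sigma ^+ 2))%:E <=
   (expR (chi2_const s0 B * sqnorm PX f))%:E)%E.
Proof.
move=> /andP[s00 s0s] fB.
set kap := chi2_const s0 B.
have kap0 : 0 <= kap by rewrite divr_ge0 ?expR_ge0// sqr_ge0.
apply: (@le_trans _ _ (1 + kap * sqnorm PX f)%:E); last first.
  by rewrite lee_fin; exact: expR_ge1Dx.
have -> : ((1 + kap * sqnorm PX f)%:E =
    \int[PX]_x (1 + kap * f x ^+ 2)%:E)%E.
  transitivity (\int[PX]_x (1%:E + kap%:E * (f x ^+ 2)%:E))%E; last first.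
    by apply: eq_integral => x _; rewrite EFinD EFinM.
  rewrite ge0_integralD//.
  - rewrite integral_cst// [X in (_ * X + _)%E]probability_setT mule1.
    rewrite ge0_integralZl_EFin//; first last.
    + exact: measurable_sqr.
    + by move=> x _; rewrite lee_fin sqr_ge0.
    by rewrite -[X in (_ + _ * X)%E]/(sqint PX f) (sqintE mf fB).
  - by move=> x _; rewrite -EFinM lee_fin mulr_ge0 ?sqr_ge0.
  - by apply: measurable_funeM; exact: measurable_sqr.
apply: ae_ge0_le_integral => //.
- apply/measurable_EFinP; apply: measurableT_comp => //.
  by apply: measurable_funM => //; exact: measurable_funX.
- by move=> x _; rewrite lee_fin; apply: addr_ge0 => //; apply: mulr_ge0 => //; exact: sqr_ge0.
- apply/measurable_EFinP; apply: measurable_funD => //.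
  by apply: measurable_funM => //; exact: measurable_funX.
apply: filterS fB => x fxB _; rewrite lee_fin.
set u := f x ^+ 2 / sigma ^+ 2.
have u0 : 0 <= u by rewrite divr_ge0// sqr_ge0.
have s02 : 0 < s0 ^+ 2 by rewrite exprn_gt0.
have us : u <= f x ^+ 2 / s0 ^+ 2.
  rewrite ler_wpM2l ?sqr_ge0// lef_pV2 ?posrE ?exprn_gt0 ?(lt_le_trans s00)//.
  by rewrite lerXn2r// nnegrE ltW// (lt_le_trans s00).
have uB : u <= B ^+ 2 / s0 ^+ 2.
  apply: (le_trans us); rewrite ler_pM2r ?invr_gt0//.
  rewrite -real_normK ?num_real// lerXn2r// nnegrE.
  by apply: le_trans fxB.
have eu : expR u <= 1 + u * expR u.
  have := expR_ge1Dx (- u); rewrite expRN => h.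
  have := ler_wpM2r (expR_ge0 u) h.
  rewrite mulVf ?gt_eqF ?expR_gt0// mulrDl mul1r mulNr; lra.
apply: (le_trans eu); rewrite lerD2l /kap /chi2_const.
have -> : expR (B ^+ 2 / s0 ^+ 2) / s0 ^+ 2 * f x ^+ 2 =
  f x ^+ 2 / s0 ^+ 2 * expR (B ^+ 2 / s0 ^+ 2) by ring.
by apply: ler_pM; rewrite ?expR_ge0// ler_expR.
Qed.

End LikelihoodMoments.

Section Fano.
Context {R : realType} (n M : nat) (PX : probability (M.-tuple R) R).
Context (sigma s0 B : R) (S : sample n PX sigma).
Context (W : finType) (f : W -> M.-tuple R -> R).
Hypothesis s0_sigma : 0 < s0 <= sigma.
Hypothesis mf : forall w, measurable_fun setT (f w).
Hypothesis fB : forall w, \forall x \ae PX, `|f w x| <= B.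
Variable fhat : estimator R n M.
Variable s : R.
Hypothesis s_gt0 : 0 < s.
Let D := n.-tuple (M.-tuple R * R).

Let sigma_neq0 : sigma != 0.
Proof. by case/andP: s0_sigma => h1 h2; rewrite gt_eqF// (lt_le_trans h1). Qed.

Let loss (w : W) (d : D) : \bar R := sqint PX (fun x => fhat (d, x) - f w x).

Let measurable_loss w : measurable_fun setT (loss w).
Proof.
have m0 : measurable_fun [set: D * M.-tuple R]
    (fun p : D * M.-tuple R => ((fhat p - f w p.2) ^+ 2)%:E).
  apply/measurable_EFinP; apply: measurable_funX; apply: measurable_funB.
    exact: measurable_funP.
  exact: (measurableT_comp (mf w)).
have p0 (p : D * M.-tuple R) : (0 <= ((fhat p - f w p.2) ^+ 2)%:E)%E.
  by rewrite lee_fin sqr_ge0.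
exact: (@measurable_fun_fubini_tonelli_F _ _ _ _ _ PX _ m0 p0).
Qed.

Let close w : set D := [set d | (loss w d < (s ^+ 2)%:E)%E].

Let measurable_close w : measurable (close w).
Proof.
have := measurable_fun_lte (measurable_loss w) (measurable_cst (s ^+ 2)%:E).
by move=> /(_ measurableT [set true] I); rewrite setTI.
Qed.

(* Two signals that are both close to the estimate are close to each other, so
   few events close w occur simultaneously. *)
Let close_sep w w' d : close w d -> close w' d ->
  sqnorm PX (f w \- f w') < 4 * s ^+ 2.
Proof.
move=> h h'; have mww : measurable_fun setT (f w \- f w').
  exact: measurable_funB.
have mg v : measurable_fun setT (fun x => fhat (d, x) - f v x).
  apply: measurable_funB => //.
  by apply: (measurableT_comp (measurable_funP fhat)); exact: pair1_measurable.
rewrite -lte_fin -(sqintE mww (ae_bounded_sub (fB w) (fB w'))).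
apply: (@le_lt_trans _ _ (2%:E * loss w d + 2%:E * loss w' d)%E).
  rewrite /loss /sqint -!ge0_integralZl_EFin//; first last.
  - exact: measurable_sqr.
  - by move=> x _; rewrite lee_fin sqr_ge0.
  - exact: measurable_sqr.
  - by move=> x _; rewrite lee_fin sqr_ge0.
  rewrite -ge0_integralD//; first last.
  - by apply: measurable_funeM; exact: measurable_sqr.
  - by move=> x _; rewrite -EFinM lee_fin mulr_ge0 ?sqr_ge0.
  - by apply: measurable_funeM; exact: measurable_sqr.
  - by move=> x _; rewrite -EFinM lee_fin mulr_ge0 ?sqr_ge0.
  apply: ge0_le_integral => //.
  - by move=> x _; rewrite lee_fin sqr_ge0.
  - exact: measurable_sqr.
  - by apply: emeasurable_funD; apply: measurable_funeM; exact: measurable_sqr.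
  - move=> x _; rewrite -!EFinM -EFinD lee_fin /=.
    have -> : f w x - f w' x = (fhat (d, x) - f w' x) - (fhat (d, x) - f w x).
      by ring.
    move: (fhat (d, x) - f w' x) (fhat (d, x) - f w x) => b a.
    rewrite -subr_ge0.
    have -> : 2 * a ^+ 2 + 2 * b ^+ 2 - (b - a) ^+ 2 = (a + b) ^+ 2 by ring.
    exact: sqr_ge0.
have -> : (4 * s ^+ 2)%:E = (2%:E * (s ^+ 2)%:E + 2%:E * (s ^+ 2)%:E)%E.
  by rewrite -!EFinM -EFinD; congr (_%:E); ring.
by apply: lteD; rewrite lte_pmul2l.
Qed.

Let mdata (g : M.-tuple R -> R) : measurable_fun setT g ->
  measurable_fun setT (data (S := S) g).
Proof. exact: measurable_data. Qed.

Let mpre (g : M.-tuple R -> R) w : measurable_fun setT g ->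
  measurable (data (S := S) g @^-1` close w).
Proof.
move=> mg; rewrite -[X in measurable X]setTI.
by apply: (mdata mg) => //; exact: measurable_close.
Qed.

Let p w := fine (sprob S (data (S := S) (f w) @^-1` close w)).

Let r w := fine (sprob S (data (S := S) (cst 0%R) @^-1` close w)).

Let pE w : sprob S (data (S := S) (f w) @^-1` close w) = (p w)%:E.
Proof. by rewrite /p fineK//; apply: fin_num_measure; exact: mpre. Qed.

Let rE w : sprob S (data (S := S) (cst 0%R) @^-1` close w) = (r w)%:E.
Proof. by rewrite /r fineK//; apply: fin_num_measure; exact: mpre. Qed.

Let risk_ge w : ((s ^+ 2 * (1 - p w))%:E <= risk S fhat (f w))%E.
Proof.
rewrite /risk.
have mc : measurable (~` (data (S := S) (f w) @^-1` close w)).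
  by apply: measurableC; exact: mpre.
have cE : sprob S (~` (data (S := S) (f w) @^-1` close w)) = (1 - p w)%:E.
  by rewrite probability_setC ?pE ?EFinB//; exact: mpre.
have -> : ((s ^+ 2 * (1 - p w))%:E = \int[sprob S]_x
    ((s ^+ 2)%:E * (\1_(~` (data (S := S) (f w) @^-1` close w)) x)%:E))%E.
  rewrite ge0_integralZl_EFin ?sqr_ge0//; last first.
    by apply/measurable_EFinP; exact: measurable_indic.
  rewrite integral_indic// setIT EFinM; congr (_ * _)%E.
  exact: esym cE.
apply: ge0_le_integral => //.
- by move=> x _; rewrite mule_ge0// ?lee_fin ?sqr_ge0// indicE.
- apply: measurable_funeM; apply/measurable_EFinP; exact: measurable_indic.
- under eq_fun do rewrite fnorm2_sqr.
  exact: (measurableT_comp (measurable_loss w) (mdata (mf w))).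
move=> x _; rewrite fnorm2_sqr indicE.
have [/set_mem/= h|_] := boolP (_ \in _); last by rewrite mule0 sqint_ge0.
by rewrite mule1 leNgt; apply/negP.
Qed.

Let Lam w (d : D) := \prod_(i < n) lik_ratio sigma (f w) (tnth d i).

Let integral_Lam w :
  (\int[sprob S]_x (Lam w (data (S := S) (cst 0%R) x))%:E = 1)%E.
Proof.
rewrite (@integral_prod_data _ _ _ _ _ S (cst 0) (fun=> lik_ratio sigma (f w))
  (fun=> 1)) ?prodr_const ?expr1n//.
- by move=> _; exact: measurable_lik_ratio.
- by move=> _ z; exact: expR_ge0.
- by move=> _; exact: integral_lik_ratio.
Qed.

Let integral_Lam_sqr w :
  (\int[sprob S]_x (Lam w (data (S := S) (cst 0%R) x) ^+ 2)%:E <=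
   (expR (n%:R * (chi2_const s0 B * sqnorm PX (f w))))%:E)%E.
Proof.
have le2 := lik_ratio_sqr_le (mf w) s0_sigma (fB w).
set e := (\int[PX]_x (expR (f w x ^+ 2 / sigma ^+ 2))%:E)%E in le2.
have e0 : (0 <= e)%E.
  by apply: integral_ge0 => x _; rewrite lee_fin expR_ge0.
have eE : e = (fine e)%:E.
  by rewrite fineK// ge0_fin_numE// (le_lt_trans le2)// ltry.
have := @integral_prod_data _ _ _ _ _ S (cst 0)
  (fun=> fun z => lik_ratio sigma (f w) z ^+ 2) (fun=> fine e).
rewrite prodr_const card_ord => E.
under eq_integral do rewrite /Lam -prodrXl.
rewrite E//.
- rewrite lee_fin expRM_natl lerXn2r// ?nnegrE ?expR_ge0 ?fine_ge0//.
  by rewrite -lee_fin -eE.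
- by move=> _; apply: measurable_funX; exact: measurable_lik_ratio.
- by move=> _ z; exact: sqr_ge0.
- by move=> _; rewrite integral_lik_ratio_sqr.
Qed.

Let mLam w : measurable_fun setT (fun x => Lam w (data (S := S) (cst 0%R) x)).
Proof.
have mL : measurable_fun setT (Lam w).
  apply: measurable_prod => i _.
  apply: (measurableT_comp (measurable_lik_ratio sigma (mf w))).
  exact: measurable_tnth.
by apply: (measurableT_comp mL); exact: mdata.
Qed.

(** Passing from the law under f w to the law under the zero function costs,
    for the event that f w is recovered, a multiple of the chi-square distance;
    the parameter a comes from the arithmetic-geometric mean inequality. *)
Let prob_close_le w a V : 0 < a ->
  expR (n%:R * (chi2_const s0 B * sqnorm PX (f w))) <= V ->
  p w <= (1 + (2 * a)^-1) * r w + a / 2 * (V - 1).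
Proof.
move=> a0 hV.
pose d0 := data (S := S) (cst 0%R).
have Lam0 x : 0 <= Lam w (d0 x) by apply: prodr_ge0 => i _; exact: expR_ge0.
have mI : measurable_fun setT (fun x => \1_(close w) (d0 x) : R).
  apply: measurableT_comp; last exact: mdata.
  by apply: measurable_indic; exact: measurable_close.
have I0 x : 0 <= \1_(close w) (d0 x) :> R by rewrite indicE.
have pI : (\int[sprob S]_x (\1_(close w) (d0 x) * Lam w (d0 x))%:E = (p w)%:E)%E.
  rewrite -pE (change_of_measure S sigma_neq0 (mf w))//; exact: measurable_close.
have rI : (\int[sprob S]_x (\1_(close w) (d0 x))%:E = (r w)%:E)%E.
  rewrite -rE; transitivity (\int[sprob S]_x (\1_(d0 @^-1` close w) x)%:E)%E => //.
  by rewrite integral_indic ?setIT//; exact: mpre.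
set b := 1 + (2 * a)^-1.
have b0 : 0 <= b by rewrite addr_ge0// invr_ge0 mulr_ge0// ltW.
have a20 : 0 <= a / 2 by rewrite divr_ge0// ltW.
have key : ((p w + a)%:E <= (b * r w + a / 2 * (V + 1))%:E)%E.
  apply: (@le_trans _ _ (\int[sprob S]_x ((\1_(close w) (d0 x) * Lam w (d0 x)) +
      a * Lam w (d0 x))%:E)%E).
    under eq_integral do rewrite EFinD.
    rewrite ge0_integralD//; first last.
    - by apply/measurable_EFinP; apply: measurable_funM => //; exact: mLam.
    - by move=> x _; rewrite lee_fin mulr_ge0// ltW.
    - by apply/measurable_EFinP; apply: measurable_funM => //; exact: mLam.
    - by move=> x _; rewrite lee_fin mulr_ge0.
    rewrite pI; under [X in (_ <= _ + X)%E]eq_integral do rewrite EFinM.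
    rewrite ge0_integralZl_EFin ?(ltW a0)//; first last.
    - by apply/measurable_EFinP; exact: mLam.
    - by move=> x _; rewrite lee_fin.
    by rewrite integral_Lam mule1 EFinD.
  apply: (@le_trans _ _ (\int[sprob S]_x (b * \1_(close w) (d0 x) +
      a / 2 * (Lam w (d0 x) ^+ 2 + 1))%:E)%E).
    apply: ge0_le_integral => //.
    - by move=> x _; rewrite lee_fin addr_ge0// mulr_ge0// ltW.
    - apply/measurable_EFinP; apply: measurable_funD; apply: measurable_funM => //;
        exact: mLam.
    - apply/measurable_EFinP; apply: measurable_funD; apply: measurable_funM => //.
      by apply: measurable_funD => //; apply: measurable_funX; exact: mLam.
    move=> x _; rewrite lee_fin /b; set l := Lam w _.
    rewrite -subr_ge0 indicE; case: (_ \in _).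
      change (true%:R : R) with (1 : R).
      have -> : (1 + (2 * a)^-1) * 1 + a / 2 * (l ^+ 2 + 1) -
          (1 * l + a * l) = (2 * a)^-1 * (a * (l - 1) - 1) ^+ 2.
        by field; rewrite gt_eqF.
      by rewrite mulr_ge0 ?sqr_ge0// invr_ge0 mulr_ge0// ltW.
    change (false%:R : R) with (0 : R).
    have -> : (1 + (2 * a)^-1) * 0 + a / 2 * (l ^+ 2 + 1) -
        (0 * l + a * l) = a / 2 * (l - 1) ^+ 2.
      by field; rewrite gt_eqF.
    by rewrite mulr_ge0 ?sqr_ge0.
  under eq_integral do rewrite EFinD.
  rewrite ge0_integralD//; first last.
  - apply/measurable_EFinP; apply: measurable_funM => //.
    by apply: measurable_funD => //; apply: measurable_funX; exact: mLam.
  - by move=> x _; rewrite lee_fin mulr_ge0// addr_ge0// sqr_ge0.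
  - by apply/measurable_EFinP; exact: measurable_funM.
  - by move=> x _; rewrite lee_fin mulr_ge0.
  rewrite EFinD; apply: leeD.
    under eq_integral do rewrite EFinM.
    rewrite ge0_integralZl_EFin//; first last.
      exact/measurable_EFinP.
    by rewrite rI EFinM.
  under eq_integral do rewrite EFinM.
  rewrite ge0_integralZl_EFin//; first last.
  - apply/measurable_EFinP; apply: measurable_funD => //.
    by apply: measurable_funX; exact: mLam.
  - by move=> x _; rewrite lee_fin addr_ge0// sqr_ge0.
  rewrite [X in (_ <= X)%E]EFinM; apply: lee_wpmul2l; first by rewrite lee_fin.
  under eq_integral do rewrite EFinD.
  rewrite ge0_integralD//; first last.
  - by apply/measurable_EFinP; apply: measurable_funX; exact: mLam.
  - by move=> x _; rewrite lee_fin sqr_ge0.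
  rewrite integral_cst// [X in (_ + _ * X)%E]probability_setT mule1 EFinD leeD2r//.
  apply: (le_trans (integral_Lam_sqr w)); by rewrite lee_fin.
move: key; rewrite lee_fin -lerBrDr => /le_trans; apply.
by rewrite le_eqVlt; apply/orP; left; apply/eqP; field.
Qed.

Let sum_r_le (m : R) :
  (forall w, #|[set w' | (sqnorm PX (f w \- f w') < 4 * s ^+ 2)%R]%SET|%:R <= m) ->
  0 <= m -> \sum_w r w <= m.
Proof.
move=> hm m0; rewrite -lee_fin -sumEFin.
pose d0 := data (S := S) (cst 0%R).
have mI w : measurable_fun setT (fun x => (\1_(close w) (d0 x))%:E : \bar R).
  apply/measurable_EFinP; apply: measurableT_comp; last exact: mdata.
  by apply: measurable_indic; exact: measurable_close.
have -> : (\sum_w (r w)%:E =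
    \int[sprob S]_x \sum_w (\1_(close w) (d0 x))%:E)%E.
  rewrite ge0_integral_sum//.
  apply: eq_bigr => w _; rewrite -rE.
  transitivity (\int[sprob S]_x (\1_(d0 @^-1` close w) x)%:E)%E => //.
  by rewrite integral_indic ?setIT//; exact: mpre.
rewrite -[leRHS]mule1 -(@probability_setT _ _ _ (sprob S)) -integral_cst//.
apply: ge0_le_integral => //.
- by move=> x _; apply: sume_ge0 => w _; rewrite lee_fin indicE.
- exact: emeasurable_sum.
move=> x _ /=; rewrite sumEFin lee_fin.
have [[w0 hw0]|/forallNP none] := pselect (exists w, close w (d0 x)); last first.
  by rewrite big1// => w _; rewrite indicE memNset.
apply: (@le_trans _ _ (#|[set w' | (sqnorm PX (f w0 \- f w') < 4 * s ^+ 2)%R]%SET|%:R)).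
  rewrite -sum1_card natr_sum [leRHS]big_mkcond/=; apply: ler_sum => w _.
  rewrite indicE; have [/set_mem hw|_] := boolP (d0 x \in close w).
    by rewrite inE (close_sep hw0 hw).
  by case: ifP.
exact: hm.
Qed.

(** If every signal were recovered with probability above 24 / 25, averaging
    over the signals would bound 24 / 25 by
    (1 + 1 / (2 a)) x + (a / 2) (V - 1), with x the fraction of signals close
    to a given one; for a = 25 x this is at most 23 / 25 + 1 / 50 + 1 / 50. *)
Lemma fano_risk (m x V : R) : (0 < #|W|)%N ->
  (forall w, #|[set w' | (sqnorm PX (f w \- f w') < 4 * s ^+ 2)%R]%SET|%:R <= m) ->
  m / #|W|%:R <= x -> 0 < x <= 23 / 25 -> (V - 1) * x <= 625^-1 ->
  (forall w, expR (n%:R * (chi2_const s0 B * sqnorm PX (f w))) <= V) ->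
  exists w, ((s ^+ 2 / 25)%:E <= risk S fhat (f w))%E.
Proof.
move=> W0 hm mx /andP[x0 x1] Vx hV.
have N0 : 0 < #|W|%:R :> R by rewrite ltr0n.
apply: contrapT => /forallNP none.
have p_gt w : 24 / 25 < p w.
  have := none w => /negP; rewrite -ltNge => h.
  have := le_lt_trans (risk_ge w) h; rewrite lte_fin ltr_pM2l ?exprn_gt0//.
  by move=> h2; lra.
pose a := 25 * x.
have a0 : 0 < a by rewrite mulr_gt0.
have p_le w := prob_close_le a0 (hV w).
have m0 : 0 <= m.
  have [w0 _] : exists w0 : W, w0 \in W by apply/card_gt0P.
  by apply: le_trans (hm w0).
have sumr := sum_r_le hm m0.
have h1 : #|W|%:R * (24 / 25) < \sum_w p w.
  have [w0 _] : exists w0 : W, w0 \in W by apply/card_gt0P.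
  rewrite -[#|W|]/(#|W|) mulr_natl -sumr_const.
  apply: ltr_sum; last by move=> w _; exact: p_gt.
  by apply/hasP; exists w0 => //; rewrite mem_index_enum.
have h2 : \sum_w p w <= (1 + (2 * a)^-1) * m + #|W|%:R * (a / 2 * (V - 1)).
  apply: (@le_trans _ _ (\sum_w ((1 + (2 * a)^-1) * r w + a / 2 * (V - 1)))).
    exact: ler_sum.
  rewrite big_split/= -mulr_sumr sumr_const -[X in _ + X <= _]mulr_natl lerD2r.
  by rewrite ler_wpM2l// addr_ge0// invr_ge0 mulr_ge0// ltW.
have h3 : (1 + (2 * a)^-1) * m <= (1 + (2 * a)^-1) * (#|W|%:R * x).
  apply: ler_wpM2l; first by rewrite addr_ge0// invr_ge0 mulr_ge0// ltW.
  by rewrite mulrC -ler_pdivrMr.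
have h4 : (1 + (2 * a)^-1) * x + a / 2 * (V - 1) <= 24 / 25.
  have -> : (1 + (2 * a)^-1) * x + a / 2 * (V - 1) =
      x + 50^-1 + 25 / 2 * ((V - 1) * x).
    by rewrite /a; field; rewrite gt_eqF.
  by lra.
have h5 := ler_wpM2l (ltW N0) h4.
have := lt_le_trans h1 (le_trans h2 (lerD h3 (lexx _))).
move: h5; rewrite mulrDr => h5.
have -> : (1 + (2 * a)^-1) * (#|W|%:R * x) = #|W|%:R * ((1 + (2 * a)^-1) * x) by ring.
by rewrite ltNge h5.
Qed.

End Fano.

(** * Codes with one feature per block *)

Section BlockCode.
Context {R : realType} (M k b : nat) (a : R).
Hypothesis b_gt0 : (0 < b)%N.
Hypothesis kbM : (k * b <= M)%N.
Hypothesis a_gt0 : 0 < a.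

Lemma block_idx_subproof (l : 'I_k) (c : 'I_b) : (l * b + c < M)%N.
Proof.
apply: leq_trans kbM; apply: (@leq_trans (l * b + b)).
  by rewrite ltn_add2l.
by rewrite -mulSnr leq_mul2r ltn_ord orbT.
Qed.

Definition block_idx (l : 'I_k) (c : 'I_b) : 'I_M :=
  Ordinal (block_idx_subproof l c).

Lemma block_idx_inj l c l' c' : block_idx l c = block_idx l' c' ->
  l = l' /\ c = c'.
Proof.
move=> [] /eqP; rewrite (mulnC l) (mulnC l') => /eqP E.
have El : (l = l' :> nat).
  have := congr1 (divn ^~ b) E.
  by rewrite ![(b * _)%N]mulnC !divnMDl// !divn_small// !addn0.
split; apply: val_inj => //=.
by move: E; rewrite El => /addnI.
Qed.

Definition block_vec (w : {ffun 'I_k -> 'I_b}) : 'rV[R]_M :=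
  \row_j (if [exists l, block_idx l (w l) == j] then a else 0).

Lemma block_vec_norm (w : {ffun 'I_k -> 'I_b}) j : `|block_vec w ord0 j| <= a.
Proof. by rewrite mxE; case: ifP => _; rewrite ?normr0 ?gtr0_norm// ltW. Qed.

Lemma block_vec_l0 (w : {ffun 'I_k -> 'I_b}) : (l0norm (block_vec w) <= k)%N.
Proof.
rewrite -[leqRHS]card_ord -cardsT.
apply: leq_trans (leq_imset_card (fun l => block_idx l (w l)) _).
apply: subset_leq_card; apply/fintype.subsetP => j; rewrite inE mxE.
case: existsP => [[l /eqP <-] _|]; last by rewrite eqxx.
by apply: imset_f; rewrite inE.
Qed.

Lemma block_vec_dist (w w' : {ffun 'I_k -> 'I_b}) :
  a ^+ 2 * #|[set l | w l != w' l]%SET|%:R <=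
  \sum_j (block_vec w - block_vec w') ord0 j ^+ 2.
Proof.
set A := [set l | _]%SET.
have inj : {in A &, injective (fun l => block_idx l (w l))}.
  by move=> l l' _ _ /block_idx_inj[].
apply: (@le_trans _ _ (\sum_(j in [set block_idx l (w l) | l in A]%SET)
    (block_vec w - block_vec w') ord0 j ^+ 2)).
  rewrite big_imset//= mulr_natr -sumr_const; apply: ler_sum => l.
  rewrite inE => wl; rewrite !mxE.
  case: existsP => [_|]; last by move=> H; exfalso; apply: H; exists l.
  case: existsP => [[l' /eqP/block_idx_inj[ll]]|_]; last by rewrite subr0.
  by rewrite ll => E; rewrite E eqxx in wl.
rewrite [leLHS]big_mkcond/=; apply: ler_sum => j _.
by case: ifP => _ //; exact: sqr_ge0.
Qed.

Lemma sum_sqr_le_l0norm (theta : 'rV[R]_M) : (forall j, `|theta ord0 j| <= a) ->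
  \sum_j theta ord0 j ^+ 2 <= a ^+ 2 * (l0norm theta)%:R.
Proof.
move=> h; rewrite mulr_natr -sumr_const [leRHS]big_mkcond/=.
apply: ler_sum => j _; rewrite inE; case: eqP => [->|_]/=.
  by rewrite expr0n.
by rewrite -real_normK ?num_real// lerXn2r// nnegrE ltW.
Qed.

Lemma sum_norm_le_l0norm (theta : 'rV[R]_M) : (forall j, `|theta ord0 j| <= a) ->
  \sum_j `|theta ord0 j| <= a * (l0norm theta)%:R.
Proof.
move=> h; rewrite mulr_natr -sumr_const [leRHS]big_mkcond/=.
apply: ler_sum => j _; rewrite inE; case: eqP => [->|_]//=.
by rewrite normr0.
Qed.

End BlockCode.

(** Exponential tilting: a word within distance k / 8 has weight at least
    beta^(-k) under the product weight that charges 1 / b for each change,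
    where beta^8 = b. *)
Lemma card_hamming_ball (R : realType) (k b : nat) (beta : R)
    (w : {ffun 'I_k -> 'I_b}) : (1 < b)%N -> 1 <= beta -> beta ^+ 8 = b%:R ->
  #|[set w' : {ffun 'I_k -> 'I_b} |
      (8 * #|[set l | w l != w' l]%SET| <= k)%N]%SET|%:R <= beta ^+ (7 * k).
Proof.
move=> b1 be1 be8.
have b2 : 2 <= b%:R :> R by rewrite ler_nat.
have b0 : 0 < b%:R :> R by lra.
have be0 : 0 < beta by lra.
pose phi (l : 'I_k) (c : 'I_b) : R := if w l == c then 1 else b%:R^-1.
have phi0 l c : 0 <= phi l c by rewrite /phi; case: ifP => _ //; rewrite invr_ge0.
rewrite -sum1_card natr_sum.
apply: (@le_trans _ _ (\sum_(w' : {ffun 'I_k -> 'I_b}) beta ^+ k * \prod_l phi l (w' l))).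
  rewrite [leLHS]big_mkcond/=; apply: ler_sum => w' _; rewrite inE.
  case: ifP => [h|_]; last first.
    by rewrite mulr_ge0 ?exprn_ge0 ?prodr_ge0// ltW.
  have -> : \prod_l phi l (w' l) = (beta ^+ (8 * #|[set l | w l != w' l]%SET|))^-1.
    rewrite /phi exprM be8 -exprVn -prodr_const [RHS]big_mkcond/=.
    by apply: eq_bigr => l _; rewrite inE; case: eqP.
  rewrite ler_pdivlMr ?exprn_gt0// mul1r.
  exact: ler_weXn2l.
rewrite -mulr_sumr -bigA_distr_bigA mulSnr addnC exprD ler_pM2l ?exprn_gt0//.
apply: (@le_trans _ _ (\prod_(l < k) beta ^+ 6)); last first.
  by rewrite prodr_const card_ord -exprM.
apply: ler_prod => l _; rewrite sumr_ge0//=.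
rewrite (bigD1 (w l))//= /phi eqxx.
rewrite (eq_bigr (fun=> b%:R^-1)); last by move=> c; rewrite eq_sym => /negbTE ->.
rewrite sumr_const cardC1 card_ord -[X in _ + X]mulr_natl.
rewrite -subn1 natrB ?(ltnW b1)// mulrBl mulfV ?gt_eqF// mul1r.
have i0 : 0 <= b%:R^-1 :> R by rewrite invr_ge0 ltW.
have i1 : b%:R^-1 <= 1 :> R by rewrite invf_le1//; lra.
rewrite -(@ler_pXn2r _ 4)// ?nnegrE ?exprn_ge0 ?(ltW be0)//; last by lra.
rewrite -exprM -[(6 * 4)%N]/(8 * 3)%N exprM be8.
have [->|b3] : b = 2%N \/ (3 <= b)%N.
- by move: b1; rewrite leq_eqVlt => /orP[/eqP <-|]; [left|right].
- by lra.
have b3' : 3 <= b%:R :> R by rewrite ler_nat.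
apply: (@le_trans _ _ (2 ^+ 4)).
  by rewrite lerXn2r// ?nnegrE; lra.
apply: (@le_trans _ _ (3 ^+ 3)); first by lra.
by rewrite lerXn2r// ?nnegrE; lra.
Qed.

Lemma expR_div_le (R : realType) (N : nat) (u : R) : (0 < N)%N -> 0 <= u ->
  expR (u / N%:R) <= 1 + (expR u - 1) / N%:R.
Proof.
move=> N0 u0; have N0' : 0 < N%:R :> R by rewrite ltr0n.
set v := expR (u / N%:R).
have v1 : 1 <= v by rewrite -expR0 ler_expR divr_ge0// ltW.
have bern m : 1 + m%:R * (v - 1) <= v ^+ m.
  elim: m => [|m IH]; first by rewrite mul0r addr0 expr0.
  rewrite exprS; apply: (@le_trans _ _ (v * (1 + m%:R * (v - 1)))); last first.
    by rewrite ler_pM2l//; lra.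
  rewrite -natr1; have m0 : 0 <= m%:R :> R by [].
  rewrite -subr_ge0.
  have -> : v * (1 + m%:R * (v - 1)) - (1 + (m%:R + 1) * (v - 1)) =
    m%:R * (v - 1) ^+ 2 by ring.
  by rewrite mulr_ge0// sqr_ge0.
rewrite -lerBlDl ler_pdivlMr// mulrC lerBrDl.
have -> : expR u = v ^+ N by rewrite /v -expRM_natl mulrC divfK// gt_eqF.
exact: bern.
Qed.

Lemma ln2_ge (R : realType) : 2^-1 <= ln 2 :> R.
Proof.
rewrite -ler_expR lnK ?posrE//.
have := @expR_ge1Dx R (- 2^-1); rewrite expRN => h.
have e0 := expR_gt0 (2^-1 : R).
have : 2^-1 <= (expR 2^-1)^-1 :> R by apply: le_trans h; lra.
by rewrite lef_pV2// posrE.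
Qed.

(** At most M / 2 blocks, so that a block has at least two features and the
    code has more than one word per block. *)
Lemma block_sizes (k M : nat) : (0 < k <= M)%N -> (2 <= M)%N ->
  let k' := minn k M./2 in let b := (M %/ k')%N in
  [/\ (0 < k')%N, (k' <= k)%N, (k <= 3 * k')%N, (1 < b)%N & (k' * b <= M)%N].
Proof.
move=> kM M2 k' b.
have k'0 : (0 < k')%N by rewrite /k'; lia.
split=> //; rewrite /k'; first [lia|idtac].
by rewrite leq_divRL//; rewrite /k'; lia.
Qed.

Lemma ln_block (R : realType) (k M : nat) : (0 < k <= M)%N -> (2 <= M)%N ->
  1 + ln (M%:R / k%:R) <= 4 * ln (M %/ minn k M./2)%:R :> R.
Proof.
move=> kM M2; have [] := block_sizes kM M2.
set k' := minn _ _; set b := (M %/ k')%N => k'0 k'k _ b1 _.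
have b2 : 2 <= b%:R :> R by rewrite ler_nat.
have /andP[k0 _] := kM.
have k0' : 0 < k%:R :> R by rewrite ltr0n.
have l2 : 2^-1 <= ln b%:R :> R.
  by apply: le_trans (ln2_ge R) _; rewrite ler_ln ?posrE//; lra.
suff : ln (M%:R / k%:R) <= 2 * ln b%:R :> R by lra.
rewrite [leRHS]mulr_natl -lnXn; last by lra.
rewrite ler_ln ?posrE ?exprn_gt0 ?divr_gt0 ?ltr0n//; try lra; try lia.
rewrite ler_pdivrMr//; apply: (@le_trans _ _ ((b.+1%:R * k'%:R))).
  by rewrite -natrM ler_nat ltnW// -ltn_divLR.
apply: ler_pM => //; rewrite ?ler_nat//.
by rewrite -natrX ler_nat; nia.
Qed.

(** Signals with one coordinate of size a in each of about k blocks of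
    features are separated by a multiple of k a^2, and their chi-square distance
    from the zero signal is below a small multiple of the inverse of the
    fraction of close words as long as n a^2 is at most a small multiple of the
    logarithm of the block length. *)
Lemma minimax_lower (R : realType) (L0 L s0 alo ahi : R) : 0 < L0 -> 0 < L ->
  0 < s0 -> 0 < alo -> 0 < ahi ->
  exists c1 c2 : R, [/\ 0 < c1, 0 < c2 &
    forall (n M k : nat) (PX : probability (M.-tuple R) R) (sigma : R)
      (S : sample n PX sigma) (a : R) (G : set (M.-tuple R -> R)),
    (0 < n)%N -> (0 < k <= M)%N -> (2 <= M)%N -> s0 <= sigma ->
    bounded_features PX L0 -> SRC PX alo ahi k -> 0 < a ->
    n%:R * a ^+ 2 <= c1 * (1 + ln (M%:R / k%:R)) ->
    k%:R * a * L0 <= L ->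
    (forall theta, (l0norm theta <= k)%N ->
      (forall j, `|theta ord0 j| <= a) -> G (flin theta)) ->
    ((c2 * (k%:R * a ^+ 2))%:E <= minimax_risk S G)%E].
Proof.
move=> L00 L_0 s00 alo0 ahi0.
pose kap := chi2_const s0 L.
have kap0 : 0 < kap by rewrite divr_gt0 ?expR_gt0// exprn_gt0.
have ahi2 : 0 < ahi ^+ 2 by rewrite exprn_gt0.
have alo2 : 0 < alo ^+ 2 by rewrite exprn_gt0.
have k1 : 0 < kap * ahi ^+ 2 by rewrite mulr_gt0.
have p625 : 0 < 625 :> R by rewrite ltr0n.
have c0 : 0 < (625 * (32 * (kap * ahi ^+ 2)))^-1.
  by rewrite invr_gt0 (mulr_gt0 p625 (mulr_gt0 _ k1)).
exists (625 * (32 * (kap * ahi ^+ 2)))^-1, (alo ^+ 2 / 2400).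
split; [exact: c0|by rewrite (divr_gt0 alo2) ?ltr0n|].
move=> n M k PX sigma S a G n0 kM M2 s0s bf src a0 na kaL hG.
have [] := block_sizes kM M2.
have := @ln_block R k M kM M2.
set k' := minn _ _; set b := (M %/ k')%N => lnb k'0 k'k k3 b1 kbM.
have b2 : 2 <= b%:R :> R by rewrite ler_nat.
have b0 : 0 < b%:R :> R by lra.
have k'0R : 0 < k'%:R :> R by rewrite ltr0n.
have k'kR : k'%:R <= k%:R :> R by rewrite ler_nat.
have k3R : k%:R <= 3 * k'%:R :> R by rewrite -natrM ler_nat.
have a20 : 0 < a ^+ 2 by rewrite exprn_gt0.
pose beta : R := expR (ln b%:R / 8).
have be0 : 0 < beta by exact: expR_gt0.
have be8 : beta ^+ 8 = b%:R.
  by rewrite -expRM_natl mulrC divfK// lnK// posrE.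
have lnb0 : 0 <= ln b%:R :> R by rewrite ln_ge0//; lra.
have be1 : 1 <= beta by rewrite -expR0 ler_expR divr_ge0.
have be2 : 25 / 23 <= beta.
  have : (25 / 23) ^+ 8 <= beta ^+ 8 by rewrite be8; apply: le_trans b2; lra.
  have q0 : 25 / 23 \is @Num.nneg R by rewrite nnegrE; lra.
  by rewrite (@ler_pXn2r _ 8 isT _ _ q0 (ltW be0)).
pose W := {ffun 'I_k' -> 'I_b} : finType.
pose th (w : W) := block_vec a kbM w.
pose f (w : W) : M.-tuple R -> R := flin (th w).
have th_a w j : `|th w ord0 j| <= a := block_vec_norm kbM a0 w j.
have th_0 w : (l0norm (th w) <= k')%N := block_vec_l0 a kbM w.
have th_0k w : (l0norm (th w) <= k)%N := leq_trans (th_0 w) k'k.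
have fB w : \forall x \ae PX, `|f w x| <= L.
  have := ae_bounded_flin (th w) bf; apply: filterS => x h.
  apply: le_trans h _; apply: le_trans kaL; rewrite mulrC ler_pM2r//.
  apply: le_trans (sum_norm_le_l0norm (th_a w)) _.
  by rewrite mulrC ler_pM2r// ler_nat.
have mf w : measurable_fun setT (f w) := measurable_flin _.
apply: le_ereal_inf_tmp => _ [fhat _ <-].
pose s : R := alo * a * Num.sqrt (k'%:R / 32).
have s_gt0 : 0 < s by rewrite !mulr_gt0// sqrtr_gt0 divr_gt0.
have s2 : s ^+ 2 = alo ^+ 2 * a ^+ 2 * k'%:R / 32.
  by rewrite !exprMn sqr_sqrtr ?mulrA// divr_ge0// ltW.
have N_E : #|W|%:R = beta ^+ (8 * k') :> R.
  by rewrite card_ffun !card_ord natrX -be8 exprM.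
have [|||||||w hw] := @fano_risk R n M PX sigma s0 L S W f _ mf fB fhat s s_gt0
   (beta ^+ (7 * k')) (beta ^- k') (1 + beta ^+ k' / 625).
- by rewrite s00.
- by rewrite card_ffun !card_ord expn_gt0 ltnW.
- move=> w; apply: le_trans (card_hamming_ball w b1 be1 be8).
  rewrite ler_nat; apply: subset_leq_card; apply/fintype.subsetP => w'.
  rewrite !inE => close.
  have := block_vec_dist a (ltnW b1) kbM w w'.
  have : (l0norm (th w - th w') <= 2 * k)%N.
    apply: leq_trans (l0normB _ _) _.
    by rewrite mul2n -addnn leq_add.
  move=> /(SRC_sqnorm alo0 ahi0 src)/andP[lo _] dist.
  have : alo ^+ 2 * (a ^+ 2 * #|[set l | w l != w' l]%SET|%:R) <
      4 * (alo ^+ 2 * a ^+ 2 * k'%:R / 32).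
    rewrite -s2; apply: le_lt_trans close.
    have -> : f w \- f w' = flin (th w - th w').
      by apply/funext => x /=; rewrite flinB.
    by apply: le_trans lo; rewrite ler_pM2l.
  have -> : 4 * (alo ^+ 2 * a ^+ 2 * k'%:R / 32) =
     alo ^+ 2 * (a ^+ 2 * (k'%:R / 8)) by field.
  rewrite !ltr_pM2l// ltr_pdivlMr// -natrM ltr_nat mulnC.
  exact: ltnW.
- rewrite N_E -[(8 * k')%N]/(k' + 7 * k')%N exprD invfM mulrCA mulfV ?mulr1//.
  by rewrite gt_eqF// exprn_gt0.
- rewrite invr_gt0 exprn_gt0//=.
  have h : 25 / 23 <= beta ^+ k' by apply: le_trans be2 (ler_eXnr k'0 be1).
  have p0 : 0 < 25 / 23 :> R by lra.
  by rewrite -(invf_div 25 23) lef_pV2 ?posrE ?exprn_gt0.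
- rewrite addrAC subrr add0r mulrAC mulfV ?mul1r//.
  by rewrite gt_eqF// exprn_gt0.
- move=> w.
  have -> : beta ^+ k' = expR (k'%:R * (ln b%:R / 8)) by rewrite expRM_natl.
  set u := k'%:R * _.
  have u0 : 0 <= u by rewrite mulr_ge0 ?divr_ge0.
  have h := @expR_div_le R 625 u isT u0.
  apply: (@le_trans _ _ (expR (u / 625))); last first.
    by apply: le_trans h _; rewrite mulrBl; lra.
  rewrite ler_expR -/kap.
  have : (l0norm (th w) <= 2 * k)%N.
    by apply: leq_trans (th_0k w) _; rewrite mul2n -addnn leq_addr.
  move=> /(SRC_sqnorm alo0 ahi0 src)/andP[_ up].
  have up2 : sqnorm PX (f w) <= ahi ^+ 2 * (a ^+ 2 * k'%:R).
    apply: le_trans up _; rewrite ler_pM2l//.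
    apply: le_trans (sum_sqr_le_l0norm a0 (th_a w)) _.
    by rewrite ler_pM2l// ler_nat.
  apply: (@le_trans _ _ (n%:R * (kap * (ahi ^+ 2 * (a ^+ 2 * k'%:R))))).
    by rewrite ler_pM2l ?ltr0n// ler_pM2l.
  have -> : n%:R * (kap * (ahi ^+ 2 * (a ^+ 2 * k'%:R))) =
    (n%:R * a ^+ 2) * (kap * ahi ^+ 2 * k'%:R) by ring.
  apply: (@le_trans _ _ ((625 * (32 * (kap * ahi ^+ 2)))^-1 * (4 * ln b%:R) *
      (kap * ahi ^+ 2 * k'%:R))).
    rewrite (ler_pM2r (mulr_gt0 k1 k'0R)).
    apply: le_trans na _.
    by rewrite (ler_pM2l c0).
  rewrite le_eqVlt; apply/orP; left; apply/eqP; rewrite /u.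
  by field; rewrite !gt_eqF.
have Gw : G (f w) by exact: hG.
apply: (@le_trans _ _ (risk S fhat (f w))); last first.
  by apply: ereal_sup_ubound; exists (f w).
apply: le_trans hw; rewrite lee_fin s2.
have -> : alo ^+ 2 / 2400 * (k%:R * a ^+ 2) =
  alo ^+ 2 * a ^+ 2 * (k%:R / 3) / 32 / 25 by field.
rewrite !ler_pM2r ?invr_gt0// ler_pM2l ?mulr_gt0//.
by rewrite ler_pdivrMr// mulrC.
Qed.

(** * The effective dimension and the rates *)

Lemma powR_le (R : realType) (r a b : R) : 0 <= r -> 0 <= a -> a <= b ->
  a `^ r <= b `^ r.
Proof.
by move=> r0 a0 ab; apply: ge0_ler_powR => //; rewrite nnegrE ?(le_trans a0 ab).
Qed.

Lemma powR_le1D (R : realType) (p v : R) : 0 <= p <= 1 -> 0 <= v ->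
  v `^ p <= 1 + v.
Proof.
move=> /andP[p0 p1] v0; have [v1|v1] := lerP v 1.
  apply: (@le_trans _ _ (1 `^ p)); first exact: powR_le.
  by rewrite powR1 lerDl.
by apply: le_trans (ler1_powR (ltW v1) p1) _; rewrite lerDr.
Qed.

Lemma ln1D_le (R : realType) (z : R) : 0 < z -> 1 + ln z <= z.
Proof.
move=> z0; have z1 : -1 < z - 1 by lra.
by have := le_ln1Dx z1; rewrite (_ : 1 + (z - 1) = z); [lra|ring].
Qed.

Lemma powRB_gt0 (R : realType) (a r s : R) : 0 < a ->
  a `^ (r - s) = a `^ r / a `^ s.
Proof. by move=> a0; rewrite powRB// (gt_eqF a0) implybT. Qed.

Lemma le_mul_powR1B (R : realType) (m e r C : R) : 0 < m ->
  r * m `^ e <= C * m -> r <= C * m `^ (1 - e).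
Proof.
move=> m0 h.
by rewrite (powRB_gt0 _ _ m0) (powRr1 (ltW m0)) mulrA ler_pdivlMr ?powR_gt0.
Qed.

Lemma abs_ceilP (R : realType) (x : R) : 0 < x ->
  [/\ (0 < `|Num.ceil x|)%N, x <= `|Num.ceil x|%:R & `|Num.ceil x|%:R < x + 1].
Proof.
move=> x0; have c0 : 0 < Num.ceil x by rewrite ceil_gt0.
have /andP[c1 c2] := ceil_itv x.
have -> : `|Num.ceil x|%:R = (Num.ceil x)%:~R :> R by rewrite natr_absz gtr0_norm.
split=> //; first by rewrite absz_gt0 gt_eqF.
by move: c1; rewrite intrB; lra.
Qed.

Section SignalToNoise.
Context {R : realType} (q t s0 sbar sigma : R) (n M : nat).
Hypotheses (q01 : 0 < q <= 1) (t_gt0 : 0 < t) (s0_gt0 : 0 < s0).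
Hypothesis sigma_bd : s0 <= sigma <= sbar.
Hypotheses (n2 : (2 <= n)%N) (M2 : (2 <= M)%N).

Definition snr_bound (s : R) : R := t ^+ 2 / s ^+ 2.

Let x := snr n q t sigma.
Let m := m_low n M q t sigma.
Let Ah := snr_bound s0.
Let Bl := snr_bound sbar `^ (q / 2).
Let Bh := snr_bound s0 `^ (q / 2).
Let e := 2 / q.

Let q_gt0 : 0 < q. Proof. by case/andP: q01. Qed.
Let q_le1 : q <= 1. Proof. by case/andP: q01. Qed.
Let q2_ge0 : 0 <= q / 2. Proof. by rewrite divr_ge0 ?(ltW q_gt0). Qed.
Let e_ge1 : 1 <= e.
Proof. by rewrite /e ler_pdivlMr// mul1r; have := q_le1; lra. Qed.
Let n_gt0 : 0 < n%:R :> R. Proof. by rewrite ltr0n; case: n n2. Qed.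
Let M_gt0 : 0 < M%:R :> R. Proof. by rewrite ltr0n; case: M M2. Qed.
Let sigma_gt0 : 0 < sigma.
Proof. by case/andP: sigma_bd => h _; exact: lt_le_trans h. Qed.
Let sbar_gt0 : 0 < sbar.
Proof. by case/andP: sigma_bd => _; exact: lt_le_trans. Qed.

Lemma snr_bound_gt0 (s : R) : 0 < s -> 0 < snr_bound s.
Proof. by move=> s_gt0; rewrite divr_gt0 ?exprn_gt0. Qed.

Let Ah_gt0 : 0 < Ah. Proof. exact: snr_bound_gt0. Qed.
Let Bl_gt0 : 0 < Bl. Proof. by rewrite powR_gt0// snr_bound_gt0. Qed.
Let Bh_gt0 : 0 < Bh. Proof. by rewrite powR_gt0// snr_bound_gt0. Qed.

Let snr_bound_le (s s' : R) : 0 < s -> s <= s' -> snr_bound s' <= snr_bound s.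
Proof.
move=> s_gt0 ss'; have s'_gt0 := lt_le_trans s_gt0 ss'.
rewrite ler_pM2l ?exprn_gt0// lef_pV2 ?posrE ?exprn_gt0//.
by rewrite lerXn2r// nnegrE ltW.
Qed.

Let snrE : x = (snr_bound sigma * n%:R) `^ (q / 2).
Proof. by rewrite /x /snr /snr_bound; congr (_ `^ _); ring. Qed.

Lemma snr_gt0 : 0 < x.
Proof. by rewrite snrE powR_gt0// mulr_gt0// snr_bound_gt0. Qed.

Let snr_powE : x `^ e = snr_bound sigma * n%:R.
Proof.
rewrite snrE -powRrM.
have -> : q / 2 * e = 1 by rewrite /e; field; rewrite gt_eqF.
by rewrite powRr1// ltW// mulr_gt0// snr_bound_gt0.
Qed.

Lemma snr_pow_le : x `^ e <= Ah * n%:R.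
Proof.
by rewrite snr_powE ler_pM2r// snr_bound_le//; case/andP: sigma_bd.
Qed.

Lemma snr_ge : Bl * n%:R `^ (q / 2) <= x.
Proof.
rewrite snrE -(powRM _ (ltW (snr_bound_gt0 sbar_gt0)) (ltW n_gt0)).
apply: powR_le => //; first by rewrite ltW// mulr_gt0// snr_bound_gt0.
by rewrite ler_pM2r// snr_bound_le//; case/andP: sigma_bd.
Qed.

Lemma snr_le : x <= Bh * n%:R `^ (q / 2).
Proof.
rewrite snrE -(powRM _ (ltW (snr_bound_gt0 s0_gt0)) (ltW n_gt0)).
apply: powR_le => //; first by rewrite ltW// mulr_gt0// snr_bound_gt0.
by rewrite ler_pM2r// snr_bound_le//; case/andP: sigma_bd.
Qed.

(** Where m^* is not truncated, the two ceilings cost at most a factor 2 each,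
    except when snr < 1; there m_* = 1, and n is bounded by a constant. *)
Lemma m_low_cases :
  [\/ m = minn M n /\ m%:R <= 2 * x,
      [/\ (1 < minn M n)%N, x < 1 & m = 1%N] |
      exists u : nat, let y := u%:R / (1 + ln (M%:R / u%:R)) `^ (q / 2) in
        [/\ (0 < m <= u)%N, (u < minn M n)%N, x <= u%:R <= 2 * x &
            y <= m%:R < y + 1]].
Proof.
have [c0 c1 c2] := abs_ceilP snr_gt0.
rewrite /m /m_low /m_up -/x -minnA; set c := `|Num.ceil x|%N in c0 c1 c2 *.
have mn2 : (2 <= minn M n)%N by rewrite leq_min M2.
have [mc|cm] := leqP (minn M n) c.
  rewrite eqxx; apply: Or31; split=> //.
  have h1 : (minn M n)%:R <= c%:R :> R by rewrite ler_nat.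
  have h2 : 2 <= (minn M n)%:R :> R by rewrite (ler_nat _ 2).
  lra.
rewrite (ltn_eqF cm).
have c0R : 0 < c%:R :> R by rewrite ltr0n.
have lnc : 0 <= ln (M%:R / c%:R) :> R.
  by apply: ln_ratio_ge0; rewrite c0 (leq_trans (ltnW cm) (geq_minl _ _)).
have l1 : 1 <= (1 + ln (M%:R / c%:R)) `^ (q / 2) :> R.
  by rewrite -[leLHS](powRr0 (1 + ln (M%:R / c%:R) : R)) ler_powR// lerDl.
set l := _ `^ _ in l1 *.
have l0 : 0 < l by lra.
have y0 : 0 < c%:R / l by rewrite divr_gt0.
have yc : c%:R / l <= c%:R by rewrite ler_pdivrMr// ler_peMr// ltW.
have [d0 d1 d2] := abs_ceilP y0.
set d := `|_|%N in d0 d1 d2 *.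
have dc : (d <= c)%N by rewrite -ltnS -(ltr_nat R) -natr1; lra.
have [x1|x1] := ltP x 1.
  apply: Or32; split=> //.
  have c1' : (c <= 1)%N by rewrite -ltnS -(ltr_nat R); lra.
  by apply/eqP; rewrite eqn_leq d0 (leq_trans dc).
apply: Or33; exists c => /=; split; rewrite ?d0 ?dc ?c1//.
- by have := c2; have := x1; lra.
- by rewrite d1.
Qed.

Lemma snr_pow_ge : snr_bound sbar * n%:R <= x `^ e.
Proof.
by rewrite snr_powE ler_pM2r// snr_bound_le//; case/andP: sigma_bd.
Qed.

Let p := 1 - q / 2.
Let p01 : 0 <= p <= 1.
Proof. by rewrite /p; have := q_le1; have := q2_ge0; lra. Qed.
Let p_ge0 : 0 <= p. Proof. by case/andP: p01. Qed.

Let inv_n_pow : n%:R^-1 `^ p = n%:R `^ (q / 2) / n%:R.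
Proof.
rewrite -[X in X `^ _](powR_inv1 (ltW n_gt0)) -powRrM.
rewrite (_ : -1 * p = q / 2 - 1); last by rewrite /p; ring.
by rewrite (powRB_gt0 _ _ n_gt0) (powRr1 (ltW n_gt0)).
Qed.

Let two_pow_e : 1 <= 2 `^ e.
Proof.
by apply: le_trans (le1r_powR _ e_ge1); lra.
Qed.

Let pow_dim_le (v : R) : 0 <= v -> v <= 2 * x ->
  v `^ e <= 2 `^ e * (Ah * n%:R).
Proof.
move=> v0 vx; apply: (@le_trans _ _ ((2 * x) `^ e)).
  by apply: powR_le => //; apply: le_trans e_ge1.
rewrite powRM ?(ltW snr_gt0)// ler_pM2l; first exact: snr_pow_le.
by apply: lt_le_trans two_pow_e.
Qed.

Lemma m_low_full_le : m = minn M n -> m%:R <= 2 * x.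
Proof.
case: m_low_cases => [[]|[mn x1 ->]|[u [/andP[_ mu] un _ _]] E]//.
  by move=> E; rewrite -E in mn.
by move: un; rewrite -E ltnNge mu.
Qed.

Let level_u (u : nat) : (0 < u < minn M n)%N -> x <= u%:R <= 2 * x ->
  1 <= 1 + ln (M%:R / u%:R) :> R /\
  1 + ln (M%:R / x) <= 2 * (1 + ln (M%:R / u%:R)).
Proof.
move=> /andP[u0 un] /andP[xu ux].
have u0R : 0 < u%:R :> R by rewrite ltr0n.
have lu : 0 <= ln (M%:R / u%:R) :> R.
  by apply: ln_ratio_ge0; rewrite u0 ltnW// (leq_trans un)// geq_minl.
split; first by rewrite lerDl.
have : ln (M%:R / x) <= ln (2 * (M%:R / u%:R)).
  rewrite ler_ln ?posrE ?mulr_gt0 ?invr_gt0 ?snr_gt0//.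
  have h : 1 <= 2 * x / u%:R by rewrite ler_pdivlMr// mul1r.
  rewrite ler_pdivrMr ?snr_gt0//.
  rewrite (_ : 2 * (M%:R / u%:R) * x = M%:R * (2 * x / u%:R)); last by ring.
  by rewrite ler_peMr// ltW.
have l2 : 1 + ln 2 <= 2 :> R by apply: ln1D_le.
by rewrite [ln (2 * _)]lnM ?posrE ?divr_gt0//; lra.
Qed.

(** By definition of m_*, m_* level >= u level^(1 - q/2), where u is at least
    snr, of order n^(q/2). *)
Lemma rate_le_l0 (r D : R) : 0 <= D -> r <= 1 ->
  (m = minn M n -> r <= D * (m%:R / n%:R)) ->
  ((m < minn M n)%N -> r <= lq_rate n M q t sigma) ->
  r <= (D + (snr_bound sbar)^-1 + 2 / Bl) * l0_rate n M m.
Proof.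
move=> D0 r1 rmin rlow.
have Al0 : 0 < snr_bound sbar by exact: snr_bound_gt0.
have iAl : 0 < (snr_bound sbar)^-1 by rewrite invr_gt0.
have iBl : 0 < 2 / Bl by rewrite divr_gt0.
have weaken C : 0 <= C -> C <= D + (snr_bound sbar)^-1 + 2 / Bl ->
    (0 < m <= M)%N -> r <= C * l0_rate n M m ->
    r <= (D + (snr_bound sbar)^-1 + 2 / Bl) * l0_rate n M m.
  move=> _ CC mM /le_trans; apply.
  by rewrite ler_wpM2r// l0_rate_ge0.
have level_ge (j : nat) : (0 < j <= M)%N -> 1 <= 1 + ln (M%:R / j%:R) :> R.
  by move=> h; rewrite lerDl ln_ratio_ge0.
case: m_low_cases => [[E _]|[mn x1 E]|[u [/andP[m0 mu] un xu /andP[ym _]]]].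
- have mM : (0 < m <= M)%N.
    by rewrite E geq_minl leq_min (ltnW n2) (ltnW M2).
  apply: (weaken D) => //; first by lra.
  apply: le_trans (rmin E) _; rewrite ler_wpM2l// ler_pM2r ?invr_gt0//.
  by rewrite ler_peMr// level_ge.
- apply: (weaken (snr_bound sbar)^-1); rewrite ?(ltW iAl)//; first by lra.
    by rewrite E (ltnW M2).
  rewrite E /l0_rate mul1r; apply: le_trans r1 _.
  have h1 : 1 <= 1 + ln (M%:R / 1%:R) :> R by rewrite level_ge// (ltnW M2).
  have h2 : snr_bound sbar * n%:R <= 1.
    apply: le_trans snr_pow_ge _.
    have := @powR_le R e x 1 (le_trans ler01 e_ge1) (ltW snr_gt0) (ltW x1).
    by rewrite powR1.
  rewrite mulrA ler_pdivlMr// mul1r mulrC ler_pdivlMr// mulrC.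
  exact: le_trans h2 h1.
have uM : (u <= M)%N by rewrite ltnW// (leq_trans un)// geq_minl.
have u0 : (0 < u)%N by rewrite (leq_trans m0).
have u0R : 0 < u%:R :> R by rewrite ltr0n.
have uu : (0 < u < minn M n)%N by rewrite u0.
have [l1 l2] := level_u uu xu.
set l := 1 + ln (M%:R / u%:R) in ym l1 l2.
have l0 : 0 < l by lra.
have mM : (0 < m <= M)%N by rewrite m0 (leq_trans mu).
apply: (weaken (2 / Bl)); rewrite ?(ltW iBl)//; first by lra.
apply: (le_trans (rlow (leq_ltn_trans mu un))).
apply: (@le_trans _ _ ((2 * l) `^ p * (n%:R^-1 `^ p))).
  have x0 := snr_gt0.
  have l2_ge0 : 0 <= 2 * l by lra.
  have ni_ge0 : 0 <= n%:R^-1 :> R by rewrite invr_ge0 ltW.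
  rewrite /lq_rate -(powRM _ l2_ge0 ni_ge0).
  have [lx|lx] := lerP 0 (1 + ln (M%:R / x)).
    by apply: powR_le => //; [rewrite divr_ge0// ltW|rewrite ler_pM2r ?invr_gt0].
  move: lx l2; have : x <= M%:R.
    by case/andP: xu => /le_trans + _; apply; rewrite ler_nat.
  move=> xM lx; exfalso; move: lx; rewrite ltNge => /negP; apply.
  by rewrite addr_ge0// ln_ge0// ler_pdivlMr// mul1r.
apply: (@le_trans _ _ ((2 * l `^ p) * (u%:R / Bl / n%:R))).
  apply: ler_pM; rewrite ?powR_ge0//.
    rewrite powRM ?(ltW l0)// ler_wpM2r ?powR_ge0//.
    by apply: ler1_powR; [lra|case/andP: p01].
  rewrite inv_n_pow ler_pM2r ?invr_gt0// ler_pdivlMr// mulrC.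
  by apply: le_trans snr_ge _; case/andP: xu.
have -> : 2 * l `^ p * (u%:R / Bl / n%:R) = 2 / Bl * (u%:R * l `^ p / n%:R).
  by ring.
rewrite ler_pM2l// ler_pM2r ?invr_gt0//.
have -> : u%:R * l `^ p = u%:R / l `^ (q / 2) * l.
  by rewrite /p (powRB_gt0 _ _ l0) (powRr1 (ltW l0)); ring.
apply: ler_pM => //; rewrite ?divr_ge0 ?powR_ge0 ?(ltW l0)// lerD2l.
have m0R : 0 < m%:R :> R by rewrite ltr0n.
rewrite ler_ln ?posrE ?divr_gt0// ler_pM2l// lef_pV2 ?posrE//.
by rewrite ler_nat.
Qed.

Let e_ge0 : 0 <= e. Proof. by apply: le_trans e_ge1. Qed.
Let pow2e_gt0 : 0 < 2 `^ e. Proof. by apply: lt_le_trans two_pow_e. Qed.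

(** m_*^(2/q) is at most of order n / level, so the power 2/q - 1 of m_* is at
    most of order (n / level)^(1 - q/2). *)
Lemma rate_le_pow (r D : R) : 0 <= D -> r <= 1 ->
  (m = minn M n -> r <= D * (m%:R / n%:R)) ->
  ((m < minn M n)%N -> r <= lq_rate n M q t sigma) ->
  r <= (D * (2 `^ e * Ah) + (1 + 2 * (2 `^ e * (2 `^ e * Ah)))) *
       m%:R `^ (1 - e).
Proof.
move=> D0 r1 rmin rlow.
set C1 := D * _; set C2 := 1 + _.
have eA0 : 0 <= 2 `^ e * Ah by rewrite mulr_ge0 ?ltW.
have C10 : 0 <= C1 by rewrite mulr_ge0.
have K0 : 0 <= 2 * (2 `^ e * (2 `^ e * Ah)).
  by rewrite mulr_ge0// mulr_ge0// ltW.
have C21 : 1 <= C2 by rewrite lerDl.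
have m_one : m = 1%N -> r <= (C1 + C2) * m%:R `^ (1 - e).
  by move=> ->; rewrite powR1 mulr1 (le_trans r1)// -[leLHS]add0r lerD.
case: m_low_cases => [[E mx]|[_ _ /m_one]//|[u [/andP[m0 mu] un xu]]].
- have m0 : 0 < m%:R :> R.
    by rewrite ltr0n E leq_min (ltnW n2) (ltnW M2).
  apply: (@le_trans _ _ (C1 * m%:R `^ (1 - e))); last first.
    by rewrite ler_wpM2r ?powR_ge0// lerDl (le_trans ler01).
  apply: le_mul_powR1B => //.
  apply: (@le_trans _ _ (D * (m%:R / n%:R) * (2 `^ e * (Ah * n%:R)))).
    apply: (@le_trans _ _ (D * (m%:R / n%:R) * m%:R `^ e)).
      by rewrite ler_wpM2r ?powR_ge0// rmin.
    apply: ler_wpM2l; first by rewrite mulr_ge0// divr_ge0 ?ltW.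
    exact: (pow_dim_le (ltW m0) mx).
  rewrite le_eqVlt; apply/orP; left; apply/eqP; rewrite /C1.
  by field; rewrite gt_eqF.
move=> /andP[ym my].
have [m1|m2] := leqP m 1; first by apply: m_one; apply/eqP; rewrite eqn_leq m1.
have m0R : 0 < m%:R :> R by rewrite ltr0n.
have u0 : (0 < u)%N by rewrite (leq_trans m0).
have u0R : 0 < u%:R :> R by rewrite ltr0n.
have uu : (0 < u < minn M n)%N by rewrite u0.
have [l1 l2] := level_u uu xu.
set l := 1 + ln (M%:R / u%:R) in ym my l1 l2.
have l0 : 0 < l by apply: lt_le_trans l1.
set lx := 1 + ln (M%:R / x) in l2.
have lx0 : 0 <= lx.
  rewrite addr_ge0// ln_ge0// ler_pdivlMr ?snr_gt0// mul1r.
  case/andP: xu => /le_trans + _; apply; rewrite ler_nat ltnW//.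
  by rewrite (leq_trans un)// geq_minl.
set y := u%:R / l `^ (q / 2) in ym my.
have y0 : 0 <= y by rewrite divr_ge0 ?powR_ge0.
have m2y : m%:R <= 2 * y.
  have : 2 <= m%:R :> R by rewrite (ler_nat _ 2).
  have := my; lra.
have bal : lx * m%:R `^ e / n%:R <= 2 * (2 `^ e * (2 `^ e * Ah)).
  rewrite ler_pdivrMr//.
  apply: (@le_trans _ _ (2 * l * (2 `^ e * (2 `^ e * (Ah * n%:R) / l)))).
    apply: ler_pM => //.
    apply: (@le_trans _ _ ((2 * y) `^ e)); first exact: powR_le.
    rewrite powRM// ler_pM2l// /y powRM ?invr_ge0 ?powR_ge0//.
    have -> : (l `^ (q / 2))^-1 `^ e = l^-1.
      rewrite -powRN -powRrM (_ : - (q / 2) * e = - 1).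
        by rewrite powR_inv1// ltW.
      by rewrite /e; field; rewrite gt_eqF.
    rewrite ler_pM2r ?invr_gt0//.
    by apply: pow_dim_le => //; case/andP: xu.
  rewrite le_eqVlt; apply/orP; left; apply/eqP.
  by field; rewrite gt_eqF.
apply: (@le_trans _ _ (C2 * m%:R `^ (1 - e))); last first.
  by rewrite ler_wpM2r ?powR_ge0// lerDr.
apply: le_mul_powR1B => //.
have -> : m%:R `^ e = m%:R `^ e `^ p * m%:R.
  rewrite -powRrM -[X in _ * X](powRr1 (ltW m0R)) -powRD ?(gt_eqF m0R) ?implybT//.
  by congr (_ `^ _); rewrite /p /e; field; rewrite gt_eqF.
rewrite mulrA ler_pM2r//.
apply: (@le_trans _ _ ((lx / n%:R) `^ p * m%:R `^ e `^ p)).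
  rewrite ler_wpM2r ?powR_ge0//.
  by apply: rlow; apply: leq_ltn_trans un.
rewrite -powRM ?powR_ge0 ?divr_ge0 ?(ltW n_gt0)//.
have -> : lx / n%:R * m%:R `^ e = lx * m%:R `^ e / n%:R by ring.
apply: le_trans (powR_le1D p01 _) _.
  by rewrite divr_ge0 ?mulr_ge0 ?powR_ge0// ltW.
by rewrite lerD2l.
Qed.

(** Below m_*, the lq-constraint is not active: k^(2/q) (1 + ln (M / k)) stays
    of order n, since the power dominates the logarithm. *)
Lemma rate_0_le_pow (k : nat) : (0 < k < m)%N ->
  rate_0 n M k <= 2 * (2 `^ e * Ah) * k%:R `^ (1 - e) :> R.
Proof.
move=> /andP[k0 km].
have k0R : 0 < k%:R :> R by rewrite ltr0n.
have eA0 : 0 <= 2 `^ e * Ah by rewrite mulr_ge0 ?ltW.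
have powE (N : R) : 0 < N -> k%:R `^ e = N `^ e * (k%:R / N) `^ e.
  move=> N0; have kN0 : 0 <= k%:R / N by rewrite divr_ge0 ?ltW.
  by rewrite -(powRM _ (ltW N0) kN0) [N * _]mulrC divfK// gt_eqF.
have pow_sub (N : R) : 0 < N -> k%:R <= N ->
    k%:R `^ e <= N `^ e * (k%:R / N).
  move=> N0 kN; rewrite (powE N N0) ler_pM2l ?powR_gt0// ge1r_powR//.
  by rewrite divr_gt0//= ler_pdivrMr// mul1r.
have of_level : k%:R `^ e * (1 + ln (M%:R / k%:R)) <=
    2 * (2 `^ e * (Ah * n%:R)) ->
    rate_0 n M k <= 2 * (2 `^ e * Ah) * k%:R `^ (1 - e) :> R.
  move=> h; apply: le_mul_powR1B => //.
  apply: (@le_trans _ _ (l0_rate n M k * k%:R `^ e)).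
    by rewrite ler_wpM2r ?powR_ge0// ge_min lexx orbT.
  have -> : l0_rate n M k * k%:R `^ e =
      k%:R `^ e * (1 + ln (M%:R / k%:R)) * (k%:R / n%:R) :> R.
    by rewrite /l0_rate; ring.
  apply: (@le_trans _ _ (2 * (2 `^ e * (Ah * n%:R)) * (k%:R / n%:R))).
    by rewrite ler_pM2r ?divr_gt0.
  rewrite le_eqVlt; apply/orP; left; apply/eqP.
  by field; rewrite gt_eqF.
case: m_low_cases => [[E mx]|[_ _ E]|[u [/andP[m0 mu] un xu /andP[_ my]]]].
- have m0 : 0 < m%:R :> R by rewrite ltr0n (leq_trans k0 (ltnW km)).
  have mE := pow_dim_le (ltW m0) mx.
  have kmR : k%:R <= m%:R :> R by rewrite ler_nat ltnW.
  have [nM|Mn] := leqP n M.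
    have En : m = n by rewrite E (minn_idPr nM).
    apply: le_mul_powR1B => //.
    apply: (@le_trans _ _ (k%:R `^ e)).
      by rewrite ler_piMl ?powR_ge0// ge_min lexx.
    apply: le_trans (pow_sub _ m0 kmR) _.
    apply: (@le_trans _ _ (2 `^ e * (Ah * n%:R) * (k%:R / m%:R))).
      by rewrite ler_wpM2r// divr_ge0// ltW.
    have -> : 2 `^ e * (Ah * n%:R) * (k%:R / m%:R) = 2 `^ e * Ah * k%:R.
      by rewrite En; field; rewrite gt_eqF.
    by rewrite ler_pM2r// ler_peMl// ler1n.
  apply: of_level.
  have EM : m = M by rewrite E (minn_idPl (ltnW Mn)).
  apply: (@le_trans _ _ (m%:R `^ e * (k%:R / m%:R) * (M%:R / k%:R))).
    apply: ler_pM => //.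
    - by rewrite addr_ge0// ln_ratio_ge0// k0 -EM ltnW.
    - exact: pow_sub.
    - by apply: ln1D_le; rewrite divr_gt0.
  have -> : m%:R `^ e * (k%:R / m%:R) * (M%:R / k%:R) = m%:R `^ e.
    by rewrite -EM; field; rewrite !gt_eqF.
  have B0 : 0 <= 2 `^ e * (Ah * n%:R) by rewrite mulrA mulr_ge0.
  by apply: le_trans mE _; rewrite ler_peMl// ler1n.
- by move: km; rewrite E ltnNge k0.
have u0 : (0 < u)%N by rewrite (leq_trans m0).
have u0R : 0 < u%:R :> R by rewrite ltr0n.
have uu : (0 < u < minn M n)%N by rewrite u0.
have [l1 l2] := level_u uu xu.
set l := 1 + ln (M%:R / u%:R) in my l1 l2.
have l0 : 0 < l by apply: lt_le_trans l1.
have lq0 : 0 < l `^ (q / 2) by rewrite powR_gt0.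
have ky : k%:R <= u%:R / l `^ (q / 2).
  have h : k%:R + 1 <= m%:R :> R by rewrite natr1 ler_nat.
  by rewrite -(lerD2r 1) (le_trans h)// ltW.
have ku : k%:R <= u%:R :> R by rewrite ler_nat (leq_trans (ltnW km)).
have uE : u%:R `^ e <= 2 `^ e * (Ah * n%:R).
  by apply: pow_dim_le (ltW u0R) _; case/andP: xu.
apply: of_level; apply: (@le_trans _ _ (2 * u%:R `^ e)); last first.
  by rewrite ler_pM2l.
have -> : 1 + ln (M%:R / k%:R) = l + ln (u%:R / k%:R).
  rewrite /l -addrA -lnM ?posrE ?divr_gt0//; congr (1 + ln _).
  by field; rewrite !gt_eqF.
have lk : ln (u%:R / k%:R) <= u%:R / k%:R :> R.
  have /ln1D_le : 0 < u%:R / k%:R :> R by rewrite divr_gt0.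
  by apply: le_trans; rewrite lerDr.
rewrite (powE _ u0R) -mulrA [leRHS]mulrC ler_pM2l ?powR_gt0//.
apply: (@le_trans _ _ (1 + 1)); last by lra.
rewrite mulrDr lerD//.
  apply: (@le_trans _ _ ((l `^ (q / 2))^-1 `^ e * l)).
    rewrite ler_pM2r//; apply: powR_le => //.
    by rewrite ler_pdivrMr// mulrC.
  rewrite -powRN -powRrM (_ : - (q / 2) * e = - 1).
    by rewrite powR_inv1 ?(ltW l0)// mulVf// gt_eqF.
  by rewrite /e; field; rewrite gt_eqF.
apply: (@le_trans _ _ (k%:R / u%:R * (u%:R / k%:R))).
  apply: ler_pM => //; first by rewrite ln_ge0// ler_pdivlMr// mul1r.
  by apply: ge1r_powR => //; rewrite divr_gt0//= ler_pdivrMr// mul1r.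
rewrite le_eqVlt; apply/orP; left; apply/eqP.
by field; rewrite !gt_eqF.
Qed.

(** snr lies between constant multiples of n^(q/2), so replacing one by the
    other in the logarithm of a ratio that is at least 1 costs a constant. *)
Lemma lq_order_le (xM : x <= M%:R) :
  lq_order q n M <= (1 + Bh) * lq_rate n M q t sigma.
Proof.
have x0 := snr_gt0.
have nq0 : 0 < n%:R `^ (q / 2) by rewrite powR_gt0.
have z1 : 1 <= M%:R / x by rewrite ler_pdivlMr// mul1r.
have z0 : 0 < M%:R / x by apply: lt_le_trans z1.
have lz : 0 <= ln (M%:R / x) by rewrite ln_ge0.
have B1 : 0 < 1 + Bh by rewrite addr_gt0.
have lev : lq_level q n M <= (1 + Bh) * (1 + ln (M%:R / x)).
  rewrite /lq_level.
  have h : 1 + M%:R / n%:R `^ (q / 2) <= (1 + Bh) * (M%:R / x).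
    rewrite mulrDl mul1r lerD//.
    rewrite mulrCA ler_pM2l// ler_pdivlMr// mulrC.
    by rewrite ler_pdivrMr// snr_le.
  have : ln (1 + M%:R / n%:R `^ (q / 2)) <= ln (1 + Bh) + ln (M%:R / x).
    have w0 : 0 <= M%:R / n%:R `^ (q / 2) by rewrite divr_ge0 ?ltW.
    have w1 : 0 < 1 + M%:R / n%:R `^ (q / 2) by rewrite ltr_wpDr.
    by rewrite -lnM ?posrE// ler_ln// posrE (lt_le_trans w1 h).
  have : 0 <= Bh * ln (M%:R / x) by rewrite mulr_ge0 ?(ltW Bh_gt0).
  have E : (1 + Bh) * (1 + ln (M%:R / x)) =
    1 + Bh + ln (M%:R / x) + Bh * ln (M%:R / x) by ring.
  by have := ln1D_le B1; rewrite E; lra.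
apply: (@le_trans _ _ ((1 + Bh) `^ p * lq_rate n M q t sigma)); last first.
  rewrite ler_wpM2r ?powR_ge0// ler1_powR// ?lerDl ?(ltW Bh_gt0)//.
  by case/andP: p01.
have r0 : 0 <= (1 + ln (M%:R / x)) / n%:R.
  by rewrite divr_ge0 ?(ltW n_gt0)// addr_ge0.
rewrite /lq_rate -(powRM _ (ltW B1) r0); apply: powR_le => //.
  by rewrite divr_ge0 ?(ltW n_gt0)// (le_trans ler01)// lq_level_ge1.
by rewrite mulrA ler_pM2r ?invr_gt0.
Qed.

Let pow_level_le (v w : R) : 0 <= w -> w <= v -> 1 <= v ->
  Bl * n%:R `^ (q / 2) <= M%:R -> (w / n%:R) `^ p <= v / Bl * (M%:R / n%:R).
Proof.
move=> w0 wv v1 BM; have ni0 : 0 <= n%:R^-1 :> R by rewrite invr_ge0 ltW.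
have -> : v / Bl * (M%:R / n%:R) = v * (M%:R / Bl / n%:R) by ring.
rewrite powRM// inv_n_pow; apply: ler_pM => //.
- exact: powR_ge0.
- apply: (@le_trans _ _ (v `^ p)); first exact: (powR_le p_ge0 w0 wv).
  by apply: ler1_powR => //; case/andP: p01.
- by rewrite ler_pM2r ?invr_gt0// ler_pdivlMr// mulrC.
Qed.

Lemma lq_order_le_M : M%:R <= 2 * x -> Bl * n%:R `^ (q / 2) <= M%:R ->
  lq_order q n M <= (1 + 2 * Bh) / Bl * (M%:R / n%:R).
Proof.
move=> Mx BM; have nq0 : 0 < n%:R `^ (q / 2) by rewrite powR_gt0.
apply: pow_level_le => //.
- by apply: le_trans ler01 _; exact: lq_level_ge1.
- rewrite /lq_level lerD2l.
  apply: (@le_trans _ _ (M%:R / n%:R `^ (q / 2))).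
    by apply: le_ln1Dx; apply: lt_le_trans (ltrN10 R) _; rewrite divr_ge0 ?ltW.
  rewrite ler_pdivrMr// (le_trans Mx)// -mulrA ler_pM2l//.
  exact: snr_le.
- by rewrite lerDl mulr_ge0 ?(ltW Bh_gt0).
Qed.

Lemma lq_rate_le_M : M%:R <= 2 * x -> x <= M%:R ->
  lq_rate n M q t sigma <= 2 / Bl * (M%:R / n%:R).
Proof.
move=> Mx xM; have x0 := snr_gt0.
have z1 : 1 <= M%:R / x by rewrite ler_pdivlMr// mul1r.
apply: pow_level_le => //.
- by rewrite addr_ge0// ln_ge0.
- have z0 : 0 < M%:R / x by apply: lt_le_trans z1.
  by apply: le_trans (ln1D_le z0) _; rewrite ler_pdivrMr.
- by lra.
- exact: le_trans snr_ge xM.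
Qed.

Lemma m_low_bounds : (0 < m <= minn M n)%N.
Proof.
have mn2 : (1 < minn M n)%N by rewrite leq_min M2.
case: m_low_cases => [[-> _]|[_ _ ->]|[u [/andP[m0 mu] un _ _]]].
- by rewrite leqnn (ltnW mn2).
- exact: ltnW.
- by rewrite m0 (leq_trans mu (ltnW un)).
Qed.

Lemma m_low_full : M%:R < x -> m = minn M n.
Proof.
move=> Mx.
case: m_low_cases => [[-> _]//|[_ x1 _]|[u [_ un /andP[xu _] _]]]; exfalso.
  by have := lt_trans Mx x1; rewrite ltrn1; case: M M2.
have := lt_le_trans Mx xu; rewrite ltr_nat ltnNge.
by rewrite (leq_trans (ltnW un) (geq_minl _ _)).
Qed.

Lemma snr_le_features : (m < minn M n)%N -> x <= M%:R.
Proof. by rewrite leNgt => mn; apply/negP => /m_low_full E; rewrite E ltnn in mn. Qed.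

Lemma rate_q_full : m = minn M n -> rate_q n M q t sigma = m%:R / n%:R.
Proof.
move=> E; rewrite /rate_q -/m; case: eqP => [->|/eqP mn].
  by rewrite minxx divff// gt_eqF.
have Mn : (M < n)%N.
  by rewrite ltnNge; apply/negP => /minn_idPr nM; rewrite E nM eqxx in mn.
have EM : m = M by rewrite E (minn_idPl (ltnW Mn)).
rewrite EM eqxx Mn/=; apply/min_idPr.
by rewrite ler_pdivrMr// mul1r ler_nat ltnW.
Qed.

Lemma rate_q_low : (m < minn M n)%N ->
  rate_q n M q t sigma = Num.min 1 (lq_rate n M q t sigma).
Proof.
rewrite leq_min => /andP[mM mn].
by rewrite /rate_q -/m (ltn_eqF mM) (ltn_eqF mn).
Qed.

End SignalToNoise.

(** * Minimax bounds over the classes *)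

Lemma linfnorm_le (R : realType) (M : nat) (r : R) (theta : 'rV[R]_M) : 0 <= r ->
  (forall j, `|theta ord0 j| <= r) -> linfnorm theta <= r.
Proof. by move=> r0 h; apply: bigmax_le => // j _; exact: h. Qed.

Lemma fnormoo_flin_le (R : realType) (M : nat) (PX : probability (M.-tuple R) R)
    (k : nat) (a L0 L : R) (theta : 'rV[R]_M) :
  bounded_features PX L0 -> 0 < L0 -> 0 < a -> k%:R * a * L0 <= L ->
  (l0norm theta <= k)%N -> (forall j, `|theta ord0 j| <= a) ->
  (fnormoo PX (flin theta) <= L%:E)%E.
Proof.
move=> bf L00 a0 kaL th0 tha; apply/fnormoo_leP.
have := ae_bounded_flin theta bf; apply: filterS => x h.
apply: le_trans h _; apply: le_trans kaL; rewrite mulrC ler_pM2r//.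
apply: le_trans (sum_norm_le_l0norm tha) _.
by rewrite mulrC ler_pM2r// ler_nat.
Qed.

Lemma sum_powR_le_l0norm (R : realType) (M : nat) (q a : R)
    (theta : 'rV[R]_M) : 0 < q -> (forall j, `|theta ord0 j| <= a) ->
  \sum_j `|theta ord0 j| `^ q <= a `^ q * (l0norm theta)%:R.
Proof.
move=> q0 h; rewrite mulr_natr -sumr_const [leRHS]big_mkcond/=.
apply: ler_sum => j _; rewrite inE; case: eqP => [->|_]/=.
  by rewrite normr0 powR0// gt_eqF.
by apply: powR_le (h j) => //; exact: ltW.
Qed.

Lemma rate_0_ge0 (R : realType) (n M k : nat) : (0 < k <= M)%N ->
  0 <= rate_0 n M k :> R.
Proof. by move=> kM; rewrite le_min ler01 l0_rate_ge0. Qed.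

(** Under the sparsity bound, the sup-norm constraints do not prevent the
    amplitude sqrt((1 + ln(M / k)) / n) from being used. *)
Lemma sparse_lower (R : realType) (L0 L s0 alo ahi K0 : R) : 0 < L0 -> 0 < L ->
  0 < s0 -> 0 < alo -> 0 < ahi -> 0 < K0 ->
  exists2 c : R, 0 < c &
    forall (n M k : nat) (PX : probability (M.-tuple R) R) (sigma : R)
      (S : sample n PX sigma),
    (0 < n)%N -> (0 < k <= M)%N -> (2 <= M)%N -> s0 <= sigma ->
    bounded_features PX L0 -> SRC PX alo ahi k -> sparsity_bound n M k K0 ->
    ((c * rate_0 n M k)%:E <= minimax_risk S (F0 PX k L `&` Finf L0))%E.
Proof.
move=> L00 L_0 s00 alo0 ahi0 K00.
have [c1 [c2 [c10 c20 low]]] := minimax_lower L00 L_0 s00 alo0 ahi0.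
pose c := Num.min c1 (Num.min (L ^+ 2 / (L0 ^+ 2 * K0)) (L0 ^+ 2 / K0)).
have c0 : 0 < c by rewrite !lt_min c10 !divr_gt0 ?mulr_gt0 ?exprn_gt0.
exists (c2 * c); first exact: mulr_gt0.
move=> n M k PX sigma S n0 kM M2 s0s bf src; rewrite /sparsity_bound => Kk.
have n0R : 0 < n%:R :> R by rewrite ltr0n.
have k1 : 1 <= k%:R :> R by rewrite ler1n; case/andP: kM.
have k0R : 0 < k%:R :> R by apply: lt_le_trans k1.
have ln0 := ln_ratio_ge0 R kM.
set l := 1 + ln _ in Kk.
have l0 : 0 < l by rewrite /l; lra.
pose a := Num.sqrt (c * l / n%:R).
have a0 : 0 < a by rewrite sqrtr_gt0 divr_gt0 ?mulr_gt0.
have a2 : a ^+ 2 = c * l / n%:R by rewrite sqr_sqrtr// divr_ge0 ?mulr_ge0 ?ltW.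
have ka2 : k%:R ^+ 2 * a ^+ 2 <= c * K0.
  rewrite a2.
  have -> : k%:R ^+ 2 * (c * l / n%:R) = c * (k%:R ^+ 2 * l / n%:R) by ring.
  by rewrite ler_pM2l.
have kaL : k%:R * a * L0 <= L.
  have kaL0 : 0 <= k%:R * a * L0 by rewrite !mulr_ge0 ?(ltW a0) ?(ltW L00).
  rewrite -(@ler_pXn2r _ 2)// ?nnegrE ?(ltW L_0)// !exprMn.
  apply: (@le_trans _ _ (c * K0 * L0 ^+ 2)).
    by rewrite ler_pM2r// exprn_gt0.
  rewrite -mulrA [K0 * _]mulrC -ler_pdivlMr ?mulr_gt0 ?exprn_gt0//.
  by rewrite !ge_min lexx !orbT.
have aL0 : a <= L0.
  rewrite -(@ler_pXn2r _ 2)// ?nnegrE ?(ltW a0) ?(ltW L00)//.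
  apply: (@le_trans _ _ (c * K0)).
    apply: le_trans ka2; rewrite ler_peMl ?sqr_ge0//.
    by rewrite exprn_ege1.
  by rewrite -ler_pdivlMr// !ge_min lexx !orbT.
have h := low n M k PX sigma S a (F0 PX k L `&` Finf L0) n0 kM M2 s0s bf src a0.
apply: le_trans (h _ kaL _).
- rewrite lee_fin -mulrA ler_pM2l// a2.
  rewrite (_ : k%:R * (c * l / n%:R) = c * l0_rate n M k); last first.
    by rewrite /l0_rate -/l; ring.
  by rewrite ler_pM2l// ge_min lexx orbT.
- rewrite a2 mulrC divfK ?gt_eqF// ler_pM2r//.
  by rewrite ge_min lexx.
move=> theta th0 tha; split; exists theta => //.
- by split=> //; exact: (fnormoo_flin_le bf L00 a0 kaL).
- apply: linfnorm_le => [|j]; first exact: ltW.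
  exact: le_trans (tha j) aL0.
Qed.

(** In an lq-ball, k coordinates of equal size fit as soon as the size is at
    most t * k^(-1/q); this limits the separation to k^(1 - 2/q). *)
Lemma lq_lower (R : realType) (q t L0 L s0 alo ahi : R) : 0 < q <= 1 -> 0 < t ->
  0 < L0 -> 0 < L -> 0 < s0 -> 0 < alo -> 0 < ahi ->
  exists2 c : R, 0 < c &
    forall (n M k : nat) (PX : probability (M.-tuple R) R) (sigma : R)
      (S : sample n PX sigma),
    (0 < n)%N -> (0 < k <= M)%N -> (2 <= M)%N -> s0 <= sigma ->
    bounded_features PX L0 -> SRC PX alo ahi k ->
    ((c * Num.min (l0_rate n M k) (k%:R `^ (1 - 2 / q)))%:E <=
     minimax_risk S (F0 PX k L `&` Fq PX q t L))%E.
Proof.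
move=> /andP[q0 q1] t0 L00 L_0 s00 alo0 ahi0.
have [c1 [c2 [c10 c20 low]]] := minimax_lower L00 L_0 s00 alo0 ahi0.
pose T := Num.min t (L / L0).
have T0 : 0 < T by rewrite lt_min t0 divr_gt0.
pose c := Num.min c1 (T ^+ 2).
have c0 : 0 < c by rewrite lt_min c10 exprn_gt0.
exists (c2 * c); first exact: mulr_gt0.
move=> n M k PX sigma S n0 kM M2 s0s bf src.
have n0R : 0 < n%:R :> R by rewrite ltr0n.
have k1 : 1 <= k%:R :> R by rewrite ler1n; case/andP: kM.
have k0R : 0 < k%:R :> R by apply: lt_le_trans k1.
have ln0 := ln_ratio_ge0 R kM.
pose l : R := 1 + ln (M%:R / k%:R).
have l0 : 0 < l by rewrite /l; lra.
pose kap : R := k%:R `^ (- q^-1).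
have kap0 : 0 < kap by rewrite powR_gt0.
have iq : 1 <= q^-1 by rewrite -[leLHS]invr1 lef_pV2 ?posrE.
pose a := Num.sqrt (Num.min (c1 * l / n%:R) ((T * kap) ^+ 2)).
have m0 : 0 < Num.min (c1 * l / n%:R) ((T * kap) ^+ 2).
  by rewrite lt_min (exprn_gt0 2 (mulr_gt0 T0 kap0)) (divr_gt0 (mulr_gt0 c10 l0)).
have a0 : 0 < a by rewrite sqrtr_gt0.
have a2 : a ^+ 2 = Num.min (c1 * l / n%:R) ((T * kap) ^+ 2).
  by rewrite sqr_sqrtr// ltW.
have aT : a <= T * kap.
  rewrite -(@ler_pXn2r _ 2)// ?nnegrE ?(ltW a0) ?(ltW (mulr_gt0 T0 kap0))//.
  by rewrite a2 ge_min lexx orbT.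
have kkap : k%:R * kap <= 1.
  rewrite /kap -[X in X * _](powRr1 (ltW k0R)) -powRD; last first.
    by rewrite (gt_eqF k0R) implybT.
  by rewrite -[leRHS](powRr0 (k%:R : R)) ler_powR//; lra.
have kaL : k%:R * a * L0 <= L.
  rewrite -ler_pdivlMr//; apply: (@le_trans _ _ (k%:R * (T * kap))).
    by rewrite ler_pM2l.
  rewrite mulrCA; apply: (@le_trans _ _ T); last by rewrite ge_min lexx orbT.
  by rewrite ler_piMr// ltW.
have h := low n M k PX sigma S a (F0 PX k L `&` Fq PX q t L)
  n0 kM M2 s0s bf src a0.
apply: le_trans (h _ kaL _).
- rewrite lee_fin -mulrA ler_pM2l//.
  have -> : k%:R `^ (1 - 2 / q) = k%:R * kap ^+ 2.
    have -> : kap ^+ 2 = k%:R `^ (- (2 / q)).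
      by rewrite -(powR_mulrn 2 (ltW kap0)) -powRrM; congr (_ `^ _); ring.
    rewrite powRD; first by rewrite (powRr1 (ltW k0R)).
    by rewrite (gt_eqF k0R) implybT.
  have E : l0_rate n M k = k%:R * (l / n%:R) by rewrite /l0_rate -/l; ring.
  rewrite E a2 -minr_pMr ?(ltW k0R)// mulrCA ler_pM2l// le_min.
  have x0 : 0 <= l / n%:R by rewrite divr_ge0 ?ltW.
  apply/andP; split.
    apply: (@le_trans _ _ (c * (l / n%:R))).
      by rewrite ler_pM2l// ge_min lexx.
    by rewrite -mulrA ler_wpM2r// ge_min lexx.
  apply: (@le_trans _ _ (c * kap ^+ 2)).
    by rewrite ler_pM2l// ge_min lexx orbT.
  by rewrite exprMn ler_wpM2r ?sqr_ge0// ge_min lexx orbT.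
- rewrite -ler_pdivlMl// a2 ge_min; apply/orP; left.
  by rewrite mulrC.
move=> theta th0 tha.
have th_oo := fnormoo_flin_le bf L00 a0 kaL th0 tha.
split; exists theta => //; split=> //.
rewrite lqnorm_leP ?(ltW t0)//.
apply: le_trans (sum_powR_le_l0norm q0 tha) _.
apply: (@le_trans _ _ ((T * kap) `^ q * k%:R)).
  apply: ler_pM; rewrite ?powR_ge0// ?ler_nat//.
  by apply: powR_le aT; rewrite ltW.
rewrite (powRM _ (ltW T0) (ltW kap0)) /kap -powRrM mulNr mulVf ?gt_eqF//.
rewrite powR_inv1 ?(ltW k0R)// divfK ?gt_eqF//.
by apply: (powR_le (ltW q0) (ltW T0)); rewrite ge_min lexx.
Qed.

Section MinimaxRisk.
Context {R : realType} {n M : nat} {PX : probability (M.-tuple R) R}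
  {sigma : R} (S : sample n PX sigma).
Implicit Types F G : set (M.-tuple R -> R).

Lemma max_risk_sub F G e : F `<=` G -> (max_risk S F e <= max_risk S G e)%E.
Proof.
move=> FG; apply: ge_ereal_sup => _ [f Ff <-].
by apply: ereal_sup_ubound; exists f => //; exact: FG.
Qed.

Lemma minimax_risk_le F e : (minimax_risk S F <= max_risk S F e)%E.
Proof. by apply: ereal_inf_lbound; exists e. Qed.

Lemma minimax_risk_sub F G : F `<=` G ->
  (minimax_risk S F <= minimax_risk S G)%E.
Proof.
move=> FG; apply: le_ereal_inf_tmp => _ [e _ <-].
exact: le_trans (minimax_risk_le F e) (max_risk_sub e FG).
Qed.

End MinimaxRisk.

Lemma F0_sub (R : realType) (M : nat) (PX : probability (M.-tuple R) R)
    (k k' : nat) (L : R) : (k <= k')%N -> F0 PX k L `<=` F0 PX k' L.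
Proof.
move=> kk' _ [theta [th0 thL] <-]; exists theta => //; split=> //.
exact: leq_trans kk'.
Qed.

Lemma Fq_sub_F0 (R : realType) (M : nat) (PX : probability (M.-tuple R) R)
    (q t L : R) : Fq PX q t L `<=` F0 PX M L.
Proof.
move=> _ [theta [_ thL] <-]; exists theta => //; split=> //.
exact: l0norm_leM.
Qed.

Lemma within_factors_intro (R : realType) (c C c' C' r : R) (v : \bar R) :
  0 <= r -> c <= c' -> C' <= C -> ((c' * r)%:E <= v)%E ->
  (v <= (C' * r)%:E)%E -> within_factors c C v r.
Proof.
move=> r0 cc CC lo up; apply/andP; split.
  by apply: le_trans lo; rewrite lee_fin ler_wpM2r.
by apply: le_trans up _; rewrite lee_fin ler_wpM2r.
Qed.

Lemma min1_le_scale (R : realType) (C a b : R) : 1 <= C -> a <= C * b ->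
  Num.min 1 a <= C * Num.min 1 b.
Proof.
move=> C1 ab; rewrite minr_pMr ?mulr1 ?le_min; last exact: le_trans C1.
by rewrite !ge_min C1 ab orbT.
Qed.

Lemma le_scale_min (R : realType) (C D r a b : R) : 0 <= C -> 0 <= D ->
  0 <= a -> 0 <= b -> r <= C * a -> r <= D * b -> r <= (C + D) * Num.min a b.
Proof.
move=> C0 D0 a0 b0 ra rb; rewrite minr_pMr ?addr_ge0// le_min.
by rewrite (le_trans ra) ?(le_trans rb)// ler_wpM2r// ?lerDl ?lerDr.
Qed.

Lemma lower_scale (R : realType) (c D r a : R) (v : \bar R) : 0 <= c -> 0 < D ->
  r <= D * a -> ((c * a)%:E <= v)%E -> ((c / D * r)%:E <= v)%E.
Proof.
move=> c0 D0 rDa; apply: le_trans; rewrite lee_fin -mulrA ler_wpM2l//.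
by rewrite ler_pdivrMl.
Qed.

(** The net of all coefficient vectors attains M / n, but relies on the
    eigenvalue condition for all of them.  It is preferred to the net of the
    lq-ball when this condition holds and the lower bound on snr given by sbar
    exceeds M, which implies that m_* is M or n. *)
Lemma lq_estimator (R : realType) (q t L L0 sbar alo ahi : R) :
  0 < q <= 1 -> 0 < t -> 0 < L -> 0 < L0 -> 0 < sbar -> 0 < alo -> 0 < ahi ->
  exists fhat : forall n M : nat,
       probability (M.-tuple R) R -> estimator R n M, forall s0 : R, 0 < s0 ->
  exists2 C : R, 0 < C &
   forall (n M : nat) (PX : probability (M.-tuple R) R) (sigma : R)
     (S : sample n PX sigma),
     (2 <= n)%N -> (2 <= M)%N -> s0 <= sigma <= sbar ->
     bounded_features PX L0 ->
     SRC PX alo ahi (m_low n M q t sigma) ->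
     (max_risk S (Fq PX q t L) (fhat n M PX)
           <= (C * rate_q n M q t sigma)%:E)%E.
Proof.
move=> q01 t0 L_0 L00 sbar0 alo0 ahi0.
have [C1 C10 sparse] := sparse_upper L_0 sbar0 alo0 ahi0.
have [C2 C20 net] := lq_upper q01 t0 L00 sbar0.
pose Bl := snr_bound t sbar `^ (q / 2).
pose full n M (PX : probability (M.-tuple R) R) :=
  SRC PX alo ahi M /\ M%:R < Bl * n%:R `^ (q / 2).
have H n M (PX : probability (M.-tuple R) R) : {e : estimator R n M |
    (0 < n)%N -> (0 < M)%N -> bounded_features PX L0 ->
    forall (sigma : R) (S : sample n PX sigma), 0 < sigma <= sbar ->
    (full n M PX -> (max_risk S (F0 PX M L) e <= (C1 * rate_0 n M M)%:E)%E) /\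
    (~ full n M PX -> (max_risk S (Fq PX q t L) e <=
                      (C2 * Num.min 1 (lq_order q n M))%:E)%E)}.
  apply: cid.
  have [n0|/negP n0] := boolP (0 < n)%N; last by exists (cst 0).
  have [M0|/negP M0] := boolP (0 < M)%N; last by exists (cst 0).
  have [bf|bf] := pselect (bounded_features PX L0); last by exists (cst 0).
  have [f|f] := pselect (full n M PX).
    have MM : (0 < M <= M)%N by rewrite M0 leqnn.
    have [e he] := sparse n M M PX n0 MM f.1.
    by exists e => _ _ _ sigma S sb; split=> // _; exact: he.
  have [e he] := net n M PX n0 bf.
  by exists e => _ _ _ sigma S sb; split=> // _; exact: he.
exists (fun n M PX => sval (H n M PX)) => s0 s00.
pose Bh := snr_bound t s0 `^ (q / 2).
have Bl0 : 0 < Bl by rewrite powR_gt0// snr_bound_gt0.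
have Bh0 : 0 < Bh by rewrite powR_gt0// snr_bound_gt0.
pose Ca := (1 + 2 * Bh) / Bl.
have Ca0 : 0 < Ca by rewrite divr_gt0// addr_gt0// mulr_gt0.
exists (C1 + C2 * (1 + Bh + Ca)).
  by rewrite addr_gt0// mulr_gt0// !addr_gt0.
move=> n M PX sigma S n2 M2 ssb bf src.
case: (H n M PX) => e /= /(_ (ltnW n2) (ltnW M2) bf sigma S).
have sb : 0 < sigma <= sbar.
  by case/andP: ssb => h ->; rewrite (lt_le_trans s00 h).
move=> /(_ sb)[hs hq].
have mb := m_low_bounds q01 t0 s00 ssb n2 M2.
set m := m_low n M q t sigma in src mb *.
have /andP[m0 _] := mb.
have n0R : 0 < n%:R :> R by rewrite ltr0n ltnW.
have M0R : 0 < M%:R :> R by rewrite ltr0n ltnW.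
have suff_q (D : R) : 0 <= D -> D <= 1 + Bh + Ca ->
    Num.min 1 (lq_order q n M) <= D * rate_q n M q t sigma ->
    0 <= rate_q n M q t sigma ->
    (max_risk S (Fq PX q t L) e <= (C2 * Num.min 1 (lq_order q n M))%:E)%E ->
    (max_risk S (Fq PX q t L) e <=
      ((C1 + C2 * (1 + Bh + Ca)) * rate_q n M q t sigma)%:E)%E.
  move=> D0 DC h r0 /le_trans; apply; rewrite lee_fin.
  apply: (@le_trans _ _ (C2 * (D * rate_q n M q t sigma))).
    by rewrite ler_pM2l.
  rewrite mulrA ler_wpM2r// (@le_trans _ _ (C2 * (1 + Bh + Ca)))//.
    by rewrite ler_pM2l.
  by rewrite lerDr ltW.
have [f|f] := pselect (full n M PX).
  have Mx : M%:R < snr n q t sigma.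
    by apply: lt_le_trans f.2 _; exact: snr_ge q01 t0 s00 ssb n2.
  have E := m_low_full q01 t0 s00 ssb n2 M2 Mx.
  rewrite (rate_q_full n2 E) -/m.
  apply: (@le_trans _ _ (C1 * rate_0 n M M)%:E).
    by apply: le_trans (hs f); apply: max_risk_sub; exact: Fq_sub_F0.
  have mn0 : 0 <= m%:R / n%:R :> R by rewrite divr_ge0.
  rewrite lee_fin; apply: (@le_trans _ _ (C1 * (m%:R / n%:R))).
    rewrite ler_pM2l// /rate_0 /l0_rate divff ?gt_eqF// ln1 addr0 mulr1.
    rewrite -/m in E; rewrite E; have [Mn|nM] := leqP M n.
      by rewrite ge_min lexx orbT.
    by rewrite divff ?gt_eqF// ge_min lexx.
  by rewrite ler_wpM2r// lerDl mulr_ge0 ?(ltW C20)// !addr_ge0 ?ltW.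
have {}hq := hq f.
have [mn|mn] := leqP (minn M n) m; last first.
  have xM := snr_le_features q01 t0 s00 ssb n2 M2 mn.
  have rE := rate_q_low mn.
  apply: (suff_q (1 + Bh)) => //; rewrite ?rE.
  - by rewrite addr_ge0 ?(ltW Bh0).
  - by rewrite lerDl ltW.
  - apply: min1_le_scale; first by rewrite lerDl ltW.
    exact: (lq_order_le q01 t0 s00 ssb n2 M2 xM).
  - by rewrite le_min ler01 powR_ge0.
have E : m = minn M n by apply/eqP; rewrite eqn_leq mn; case/andP: mb => _ ->.
have mx := m_low_full_le q01 t0 s00 ssb n2 M2 E.
rewrite -/m in mx.
have rE := rate_q_full n2 E.
have mn0 : 0 <= m%:R / n%:R :> R by rewrite divr_ge0.
have [nM|Mn] := leqP n M.
  have En : m = n by rewrite E (minn_idPr nM).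
  apply: (suff_q 1) => //; rewrite ?rE//.
  - by rewrite -addrA lerDl addr_ge0 ?ltW.
  - by rewrite -/m En divff ?gt_eqF// mulr1 ge_min lexx.
have EM : m = M by rewrite E (minn_idPl (ltnW Mn)).
have BM : Bl * n%:R `^ (q / 2) <= M%:R.
  rewrite leNgt; apply/negP => h; apply: f; split=> //.
  by rewrite -[X in SRC _ _ _ X]EM.
rewrite EM in mx.
apply: (suff_q Ca) => //; rewrite ?rE//.
- exact: ltW.
- by rewrite lerDr addr_ge0 ?(ltW Bh0).
- rewrite -/m EM ge_min; apply/orP; right.
  exact: (lq_order_le_M q01 t0 s00 ssb n2 M2 mx BM).
Qed.

(** The constant D allows for rates that exceed m_* / n by a constant factor
    when m_* is not reduced by the logarithm. *)
Lemma lq_rate_lower (R : realType) (q t L L0 s0 sbar alo ahi D : R) :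
  0 < q <= 1 -> 0 < t -> 0 < L -> 0 < L0 -> 0 < s0 -> 0 < sbar ->
  0 < alo -> 0 < ahi -> 0 <= D ->
  exists2 c : R, 0 < c &
   forall (n M : nat) (PX : probability (M.-tuple R) R) (sigma : R)
     (S : sample n PX sigma) (r : R),
     (2 <= n)%N -> (2 <= M)%N -> s0 <= sigma <= sbar ->
     bounded_features PX L0 ->
     let m := m_low n M q t sigma in
     SRC PX alo ahi m ->
     r <= 1 -> (m = minn M n -> r <= D * (m%:R / n%:R)) ->
     ((m < minn M n)%N -> r <= lq_rate n M q t sigma) ->
     ((c * r)%:E <= minimax_risk S (F0 PX m L `&` Fq PX q t L))%E.
Proof.
move=> q01 t0 L_0 L00 s00 sbar0 alo0 ahi0 D0.
have [c0 c00 low] := lq_lower q01 t0 L00 L_0 s00 alo0 ahi0.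
pose Bl := snr_bound t sbar `^ (q / 2).
pose eA := 2 `^ (2 / q) * snr_bound t s0.
pose C1 := D + (snr_bound t sbar)^-1 + 2 / Bl.
pose C2 := D * eA + (1 + 2 * (2 `^ (2 / q) * eA)).
have Al0 : 0 < snr_bound t sbar by exact: snr_bound_gt0.
have iAl0 : 0 < (snr_bound t sbar)^-1 by rewrite invr_gt0.
have Bl0 : 0 < 2 / Bl by rewrite divr_gt0// powR_gt0.
have p0 : 0 < 2 `^ (2 / q) :> R by rewrite powR_gt0.
have eA0 : 0 < eA by rewrite mulr_gt0 ?snr_bound_gt0.
have C10 : 0 < C1 by rewrite ltr_wpDl// addr_ge0// ltW.
have C20 : 0 < C2.
  rewrite ltr_wpDl//; first by rewrite mulr_ge0 ?(ltW eA0).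
  by rewrite addr_gt0// (mulr_gt0 _ (mulr_gt0 p0 eA0)).
exists (c0 / (C1 + C2)); first by rewrite divr_gt0// addr_gt0.
move=> n M PX sigma S r n2 M2 ssb bf m src r1 rfull rlow.
have /andP[m0 mM] : (0 < m <= M)%N.
  have /andP[-> h] := m_low_bounds q01 t0 s00 ssb n2 M2.
  by rewrite (leq_trans h)// geq_minl.
apply: lower_scale (low n M m PX sigma S (ltnW n2) _ M2 _ bf src).
- exact: ltW.
- exact: addr_gt0.
- apply: le_scale_min; rewrite ?(ltW C10) ?(ltW C20) ?powR_ge0//.
  + by rewrite l0_rate_ge0// m0.
  + exact: (rate_le_l0 q01 t0 s00 ssb n2 M2 D0 r1 rfull rlow).
  + exact: (rate_le_pow q01 t0 s00 ssb n2 M2 D0 r1 rfull rlow).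
- by rewrite m0.
- by case/andP: ssb.
Qed.

Lemma lq_minimax_lower (R : realType) (q t L L0 s0 sbar alo ahi : R) :
  0 < q <= 1 -> 0 < t -> 0 < L -> 0 < L0 -> 0 < s0 -> 0 < sbar ->
  0 < alo -> 0 < ahi ->
  exists2 c : R, 0 < c &
   forall (n M : nat) (PX : probability (M.-tuple R) R) (sigma : R)
     (S : sample n PX sigma),
     (2 <= n)%N -> (2 <= M)%N -> s0 <= sigma <= sbar ->
     bounded_features PX L0 ->
     SRC PX alo ahi (m_low n M q t sigma) ->
     ((c * rate_q n M q t sigma)%:E <= minimax_risk S (Fq PX q t L))%E.
Proof.
move=> q01 t0 L_0 L00 s00 sbar0 alo0 ahi0.
have [c c0 low] :=
  lq_rate_lower q01 t0 L_0 L00 s00 sbar0 alo0 ahi0 (@ler01 R).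
exists c => // n M PX sigma S n2 M2 ssb bf src.
apply: (@le_trans _ _ (minimax_risk S
    (F0 PX (m_low n M q t sigma) L `&` Fq PX q t L))); last first.
  by apply: minimax_risk_sub => f [].
apply: low => //.
- by rewrite ge_min lexx.
- by move=> E; rewrite mul1r (rate_q_full n2 E).
- by move=> /rate_q_low ->; rewrite ge_min lexx orbT.
Qed.

(** The smaller of k and m_* decides which constraint is active, for the
    estimator as for the least favourable signals. *)
Lemma l0_lq_minimax (R : realType) (q t L L0 s0 sbar alo ahi : R) :
  0 < q <= 1 -> 0 < t -> 0 < L -> 0 < L0 -> 0 < s0 -> 0 < sbar ->
  0 < alo -> 0 < ahi ->
   exists c C : R, [/\ 0 < c, 0 < C &
   forall (n M k : nat) (PX : probability (M.-tuple R) R) (sigma : R)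
     (S : sample n PX sigma),
     (2 <= n)%N -> (2 <= M)%N -> (1 <= k <= M)%N -> s0 <= sigma <= sbar ->
     bounded_features PX L0 ->
     SRC PX alo ahi (minn k (m_low n M q t sigma)) ->
     ((m_low n M q t sigma <= k)%N -> snr n q t sigma <= M%:R) ->
     within_factors c C (minimax_risk S (F0 PX k L `&` Fq PX q t L))
       (rate_0q n M k q t sigma)].
Proof.
move=> q01 t0 L_0 L00 s00 sbar0 alo0 ahi0.
pose Bl := snr_bound t sbar `^ (q / 2).
pose Bh := snr_bound t s0 `^ (q / 2).
pose eA := 2 * (2 `^ (2 / q) * snr_bound t s0).
have Bl0 : 0 < 2 / Bl by rewrite divr_gt0// powR_gt0// snr_bound_gt0.
have Bh0 : 0 < Bh by rewrite powR_gt0// snr_bound_gt0.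
have p0 : 0 < 2 `^ (2 / q) :> R by rewrite powR_gt0.
have eA0 : 0 < eA by rewrite mulr_gt0// mulr_gt0 ?snr_bound_gt0.
have D0 : 0 <= 1 + 2 / Bl by rewrite addr_ge0// ltW.
have [C1 C10 sparse] := sparse_upper L_0 sbar0 alo0 ahi0.
have [C2 C20 net] := lq_upper q01 t0 L00 sbar0.
have [c1 c10 low] := lq_rate_lower q01 t0 L_0 L00 s00 sbar0 alo0 ahi0 D0.
have [c2 c20 low2] := lq_lower q01 t0 L00 L_0 s00 alo0 ahi0.
have c3 : 0 < c2 / (1 + eA) by rewrite divr_gt0// addr_gt0.
have C3 : 0 < C2 * (1 + Bh) by rewrite mulr_gt0// addr_gt0.
exists (Num.min c1 (c2 / (1 + eA))), (C1 + C2 * (1 + Bh)); split.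
- by rewrite lt_min c10.
- exact: addr_gt0.
move=> n M k PX sigma S n2 M2 kM ssb bf.
set m := m_low n M q t sigma => src hx.
have /andP[k0 _] := kM.
have s0s : s0 <= sigma by case/andP: ssb.
have sb : 0 < sigma <= sbar.
  by case/andP: ssb => h ->; rewrite (lt_le_trans s00 h).
have n0R : 0 < n%:R :> R by rewrite ltr0n ltnW.
rewrite /rate_0q -/m; have [mk|km] := leqP m k.
  rewrite (minn_idPr mk) in src.
  have xM := hx mk.
  set r := Num.min 1 _.
  have r0 : 0 <= r by rewrite le_min ler01 powR_ge0.
  apply: (within_factors_intro (c' := c1) (C' := C2 * (1 + Bh))) => //.
  + by rewrite ge_min lexx.
  + by rewrite lerDr ltW.
  + apply: (@le_trans _ _ (minimax_risk S (F0 PX m L `&` Fq PX q t L))).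
      apply: low => //.
      * by rewrite ge_min lexx.
      * move=> E; have mx := m_low_full_le q01 t0 s00 ssb n2 M2 E.
        have mn0 : 0 <= m%:R / n%:R :> R by rewrite divr_ge0.
        rewrite -/m in E mx *; have [nM|Mn] := leqP n M.
          have En : m = n by rewrite E (minn_idPr nM).
          rewrite En divff ?gt_eqF// mulr1.
          by apply: (@le_trans _ _ 1); rewrite ?ge_min ?lexx// lerDl ltW.
        have EM : m = M by rewrite E (minn_idPl (ltnW Mn)).
        rewrite EM in mx mn0 *.
        apply: (@le_trans _ _ (2 / Bl * (M%:R / n%:R))).
          rewrite ge_min; apply/orP; right.
          exact: (lq_rate_le_M q01 t0 s00 ssb n2 mx xM).
        by rewrite ler_wpM2r// lerDr.
      * by move=> _; rewrite ge_min lexx orbT.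
    apply: minimax_risk_sub => f [f0 fq]; split=> //.
    exact: F0_sub mk _ f0.
  + have [e he] := net n M PX (ltnW n2) bf.
    apply: le_trans (minimax_risk_le S _ e) _.
    apply: (@le_trans _ _ (max_risk S (Fq PX q t L) e)).
      by apply: max_risk_sub => f [].
    apply: le_trans (he L sigma S sb) _.
    rewrite lee_fin -mulrA ler_pM2l//; apply: min1_le_scale.
      by rewrite lerDl ltW.
    exact: (lq_order_le q01 t0 s00 ssb n2 M2 xM).
rewrite (minn_idPl (ltnW km)) in src.
rewrite -/(rate_0 n M k).
have r0 := rate_0_ge0 R n kM.
apply: (within_factors_intro (c' := c2 / (1 + eA)) (C' := C1)) => //.
- by rewrite ge_min lexx orbT.
- by rewrite lerDl ltW.
- apply: lower_scale (low2 n M k PX sigma S (ltnW n2) kM M2 s0s bf src).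
  + exact: ltW.
  + by rewrite addr_gt0.
  + apply: le_scale_min; rewrite ?(ltW eA0) ?powR_ge0 ?l0_rate_ge0//.
      by rewrite mul1r ge_min lexx orbT.
    by apply: (rate_0_le_pow q01 t0 s00 ssb n2 M2); rewrite k0.
- have [e he] := sparse n M k PX (ltnW n2) kM src.
  apply: le_trans (minimax_risk_le S _ e) _.
  apply: le_trans (he sigma S sb).
  by apply: max_risk_sub => f [].
Qed.

Lemma sparse_estimator (R : realType) (L sbar alo ahi : R) :
  0 < L -> 0 < sbar -> 0 < alo -> 0 < ahi ->
  exists C : R, 0 < C /\
  exists fhat : forall n M : nat, nat ->
       probability (M.-tuple R) R -> estimator R n M,
   forall (n M k : nat) (PX : probability (M.-tuple R) R) (sigma : R)
     (S : sample n PX sigma),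
     (0 < n)%N -> (0 < k <= M)%N -> 0 < sigma <= sbar -> SRC PX alo ahi k ->
     (max_risk S (F0 PX k L) (fhat n M k PX) <= (C * rate_0 n M k)%:E)%E.
Proof.
move=> L_0 sbar0 alo0 ahi0.
have [C C0 sparse] := sparse_upper L_0 sbar0 alo0 ahi0.
exists C; split=> //.
have H n M k (PX : probability (M.-tuple R) R) : {e : estimator R n M |
    (0 < n)%N -> (0 < k <= M)%N -> SRC PX alo ahi k ->
    forall (sigma : R) (S : sample n PX sigma), 0 < sigma <= sbar ->
    (max_risk S (F0 PX k L) e <= (C * rate_0 n M k)%:E)%E}.
  apply: cid.
  have [n0|/negP n0] := boolP (0 < n)%N; last by exists (cst 0).
  have [kM|/negP kM] := boolP (0 < k <= M)%N; last by exists (cst 0).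
  have [src|src] := pselect (SRC PX alo ahi k); last by exists (cst 0).
  by have [e he] := sparse n M k PX n0 kM src; exists e.
exists (fun n M k PX => sval (H n M k PX)) => n M k PX sigma S n0 kM sb src.
by case: (H n M k PX) => e /= he; exact: he.
Qed.

Unset Implicit Arguments.

Theorem theorem6 (R : realType) (L L0 sbar alo ahi : R)
    (L_gt0 : 0 < L) (L0_gt0 : 0 < L0) (sbar_gt0 : 0 < sbar)
    (alo_gt0 : 0 < alo) (ahi_gt0 : 0 < ahi) :
  (* (i) *)
  (forall q t : R, 0 < q <= 1 -> 0 < t ->
   exists fhat : forall n M : nat,
       probability (M.-tuple R) R -> estimator R n M,
   forall s0 : R, 0 < s0 ->
   exists c C : R, [/\ 0 < c, 0 < C &
   forall (n M : nat) (PX : probability (M.-tuple R) R) (sigma : R)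
     (S : sample n PX sigma),
     (2 <= n)%N -> (2 <= M)%N -> s0 <= sigma <= sbar ->
     bounded_features PX L0 ->
     SRC PX alo ahi (m_low n M q t sigma) ->
     within_factors c C (minimax_risk S (Fq PX q t L)) (rate_q n M q t sigma)
     /\ (max_risk S (Fq PX q t L) (fhat n M PX)
           <= (C * rate_q n M q t sigma)%:E)%E])
  /\
  (* (ii) *)
  (forall K0 : R, 0 < K0 ->
   exists fhat : forall n M : nat, nat ->
       probability (M.-tuple R) R -> estimator R n M,
   forall s0 : R, 0 < s0 ->
   exists c C : R, [/\ 0 < c, 0 < C &
   forall (n M k : nat) (PX : probability (M.-tuple R) R) (sigma : R)
     (S : sample n PX sigma),
     (2 <= n)%N -> (2 <= M)%N -> (1 <= k <= M)%N -> s0 <= sigma <= sbar ->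
     bounded_features PX L0 -> sparsity_bound n M k K0 ->
     SRC PX alo ahi k ->
     within_factors c C (minimax_risk S (F0 PX k L `&` Finf L0)) (rate_0 n M k)
     /\ (max_risk S (F0 PX k L `&` Finf L0) (fhat n M k PX)
           <= (C * rate_0 n M k)%:E)%E])
  /\
  (* (iii), first claim *)
  (forall K0 s0 : R, 0 < K0 -> 0 < s0 ->
   exists c C : R, [/\ 0 < c, 0 < C &
   forall (n M k : nat) (PX : probability (M.-tuple R) R) (sigma : R)
     (S : sample n PX sigma),
     (2 <= n)%N -> (2 <= M)%N -> (1 <= k <= M)%N -> s0 <= sigma <= sbar ->
     bounded_features PX L0 -> sparsity_bound n M k K0 ->
     SRC PX alo ahi k ->
     within_factors c C (minimax_risk S (F0 PX k L)) (rate_0 n M k)])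
  /\
  (* (iii), second claim *)
  (forall q t s0 : R, 0 < q <= 1 -> 0 < t -> 0 < s0 ->
   exists c C : R, [/\ 0 < c, 0 < C &
   forall (n M k : nat) (PX : probability (M.-tuple R) R) (sigma : R)
     (S : sample n PX sigma),
     (2 <= n)%N -> (2 <= M)%N -> (1 <= k <= M)%N -> s0 <= sigma <= sbar ->
     bounded_features PX L0 ->
     SRC PX alo ahi (minn k (m_low n M q t sigma)) ->
     ((m_low n M q t sigma <= k)%N -> snr n q t sigma <= M%:R) ->
     within_factors c C (minimax_risk S (F0 PX k L `&` Fq PX q t L))
       (rate_0q n M k q t sigma)]).
Proof.
have [C0 [C00 [fhat0 up0]]] := sparse_estimator L_gt0 sbar_gt0 alo_gt0 ahi_gt0.
have sigma_bd (s0 sigma : R) : 0 < s0 -> s0 <= sigma <= sbar -> 0 < sigma <= sbar.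
  by move=> s00 /andP[h ->]; rewrite (lt_le_trans s00 h).
split; [|split; [|split]].
- move=> q t q01 t0.
  have [fhat up] := lq_estimator q01 t0 L_gt0 L0_gt0 sbar_gt0 alo_gt0 ahi_gt0.
  exists fhat => s0 s00; have [C C_gt0 {}up] := up s0 s00.
  have [c c_gt0 low] :=
    lq_minimax_lower q01 t0 L_gt0 L0_gt0 s00 sbar_gt0 alo_gt0 ahi_gt0.
  exists c, C; split=> // n M PX sigma S n2 M2 ssb bf src.
  have h := up n M PX sigma S n2 M2 ssb bf src.
  split=> //; apply/andP; split; first exact: low.
  exact: le_trans (minimax_risk_le S _ _) h.
- move=> K0 K00; exists fhat0 => s0 s00.
  have [c c_gt0 low] :=
    sparse_lower L0_gt0 L_gt0 s00 alo_gt0 ahi_gt0 K00.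
  exists c, C0; split=> // n M k PX sigma S n2 M2 kM ssb bf K src.
  have s0s : s0 <= sigma by case/andP: ssb.
  have h : (max_risk S (F0 PX k L `&` Finf L0) (fhat0 n M k PX)
      <= (C0 * rate_0 n M k)%:E)%E.
    apply: le_trans (up0 n M k PX sigma S (ltnW n2) kM (sigma_bd _ _ s00 ssb) src).
    by apply: max_risk_sub => f [].
  split=> //; apply/andP; split; last exact: le_trans (minimax_risk_le S _ _) h.
  exact: (low n M k PX sigma S (ltnW n2) kM M2 s0s bf src K).
- move=> K0 s0 K00 s00.
  have [c c_gt0 low] :=
    sparse_lower L0_gt0 L_gt0 s00 alo_gt0 ahi_gt0 K00.
  exists c, C0; split=> // n M k PX sigma S n2 M2 kM ssb bf K src.
  have s0s : s0 <= sigma by case/andP: ssb.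
  apply/andP; split.
    apply: le_trans (low n M k PX sigma S (ltnW n2) kM M2 s0s bf src K) _.
    by apply: minimax_risk_sub => f [].
  apply: le_trans (minimax_risk_le S _ (fhat0 n M k PX)) _.
  exact: up0 (ltnW n2) kM (sigma_bd _ _ s00 ssb) src.
- move=> q t s0 q01 t0 s00.
  exact: l0_lq_minimax.
Qed.
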